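(* Assume that $\gamma\in(1/3,1)$, $\delta(\varepsilon)=\varepsilon^{\frac{1-\gamma}{1+\gamma}}$, and let $n\ge 1$ be an integer. (1) For any $x_0\neq 0$, $d_{n,\varepsilon}(\cdot,x_0)$ exhibits window cut-off as $\varepsilon\to 0$, with cut-off time $t_\varepsilon$ defined (for sufficiently small $\varepsilon>0$) as the unique solution to $d_{1,\varepsilon}(t_\varepsilon,x_0)=1$, in other words $$t_\varepsilon=\frac{1}{\lambda_{1,\varepsilon}}\log\left(\left|\int_{\mathbb R}\varrho_{\varepsilon,0}(x)\psi_{1,\varepsilon}(x)\,dx\right|\right),$$ and time window $w_\varepsilon:=\varepsilon^{\frac{1-\gamma}{1+\gamma}}$. (2) For $x_0=0$, let $E_n:=\{1\le j\le n:\ \psi_j(0)\neq 0\}$. If $E_n=\emptyset$, then $d_{n,\varepsilon}(t,0)=0$ for all $t\ge 0$. Otherwise, letting $m:=\max E_n$, $d_{n,\varepsilon}(\cdot,0)$ exhibits window cut-off, and indeed profile cut-off, with cut-off time $t_\varepsilon$ determined (for sufficiently small $\varepsilon>0$) by $$e^{-2\lambda_{m,\varepsilon}t_\varepsilon}\left(\int_{\mathbb R}\varrho_{\varepsilon,0}(x)\psi_{m,\varepsilon}(x)\,dx\right)^2=1,$$ the same time window $w_\varepsilon:=\varepsilon^{\frac{1-\gamma}{1+\gamma}}$, and profile function $\mathfrak p(r)=e^{-\lambda_m r}$, $r\in\mathbb R$.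
   Context: Let $V(x)=\frac{1}{\gamma+1}|x|^{\gamma+1}$, $x\in\mathbb R$, with $\gamma>0$. For $\varepsilon\in(0,1]$ let $\mathcal L_\varepsilon u=\varepsilon u''-V'u'$ and let $\varrho_{\varepsilon,\infty}(x)=C_\varepsilon e^{-V(x)/\varepsilon}$, where $C_\varepsilon$ makes it a probability density. The operator $-\mathcal L_\varepsilon$ on $L^2(\varrho_{\varepsilon,\infty}dx)$ has discrete simple spectrum $0=\lambda_{0,\varepsilon}<\lambda_{1,\varepsilon}<\lambda_{2,\varepsilon}<\cdots$ with eigenfunctions $\psi_{0,\varepsilon}=1,\psi_{1,\varepsilon},\psi_{2,\varepsilon},\dots$ forming an orthonormal basis of $L^2(\varrho_{\varepsilon,\infty}dx)$. When $\varepsilon=1$ write $\lambda_k,\psi_k$ for $\lambda_{k,1},\psi_{k,1}$. The initial density is $\varrho_{\varepsilon,0}=\frac{1}{2\delta(\varepsilon)}\mathbf 1_{(x_0-\delta(\varepsilon),x_0+\delta(\varepsilon))}$, with $x_0\in\mathbb R$, and $\varrho_{\varepsilon,t}$ denotes the solution at time $t$ of the Fokker–Planck equation $\partial_t\varrho=(\varrho V'+\varepsilon\varrho')'$ with initial datum $\varrho_{\varepsilon,0}$. Let $\Pi_{n,\varepsilon}f=\sum_{k=0}^n\langle f,\psi_{k,\varepsilon}\rangle_{L^2(\varrho_{\varepsilon,\infty}dx)}\psi_{k,\varepsilon}$. The truncated $\chi^2$-distance is $$d_{n,\varepsilon}(t,x_0)=\left(\int_{\mathbb R}\left|\Pi_{n,\varepsilon}\left[\frac{\varrho_{\varepsilon,t}}{\varrho_{\varepsilon,\infty}}\right](x)-1\right|^2\varrho_{\varepsilon,\infty}(x)\,dx\right)^{1/2},\quad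 t\ge0,$$ equivalently $$d_{n,\varepsilon}(t,x_0)=\left(\sum_{k=1}^n e^{-2\lambda_{k,\varepsilon}t}\left(\int_{\mathbb R}\varrho_{\varepsilon,0}(x)\psi_{k,\varepsilon}(x)\,dx\right)^2\right)^{1/2}.$$ Window cut-off with cut-off time $t_\varepsilon>0$ and time window $w_\varepsilon>0$ means: $w_\varepsilon/t_\varepsilon\to0$ as $\varepsilon\to0$, and, setting for $r\in\mathbb R$ $\mathfrak p_+(r):=\limsup_{\varepsilon\to0}d_{n,\varepsilon}(t_\varepsilon+rw_\varepsilon,x_0)$ and $\mathfrak p_-(r):=\liminf_{\varepsilon\to0}d_{n,\varepsilon}(t_\varepsilon+rw_\varepsilon,x_0)$, one has $\lim_{r\to-\infty}\mathfrak p_-(r)=\infty$ and $\lim_{r\to\infty}\mathfrak p_+(r)=0$. Profile cut-off with profile function $\mathfrak p$ means that in addition $\lim_{\varepsilon\to0}d_{n,\varepsilon}(t_\varepsilon+rw_\varepsilon,x_0)=\mathfrak p(r)$ for all $r\in\mathbb R$. *)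

(* Defs.v *)
From HB Require Import structures.
From mathcomp Require Import all_boot all_order all_algebra.
From mathcomp Require Import all_classical all_reals all_analysis.

Set Implicit Arguments.
Unset Strict Implicit.
Unset Printing Implicit Defensive.

Import Order.TTheory GRing.Theory Num.Theory.
Import numFieldNormedType.Exports.

Local Open Scope classical_set_scope.
Local Open Scope ring_scope.

Section Defs.
Context {R : realType}.
Implicit Types (gamma eps delta t : R) (f g u phi : R -> R).

Definition integrableR f := (@lebesgue_measure R).-integrable setT (EFin \o f).
Definition intR f : R := (\int[@lebesgue_measure R]_x f x)%R.

Definition V gamma : R -> R := fun x => (gamma + 1)^-1 * `|x| `^ (gamma + 1).

Definition gen gamma eps u : R -> R :=
  fun x => eps * derive1 (derive1 u) x - derive1 (V gamma) x * derive1 u x.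

Definition rho_inf gamma eps : R -> R :=
  fun x => (intR (fun y => expR (- V gamma y / eps)))^-1
           * expR (- V gamma x / eps).

(* The real Hilbert space L^2(rho_inf dx), with functions as representatives. *)
Definition inL2 gamma eps f :=
  measurable_fun setT f /\ integrableR (fun x => f x ^+ 2 * rho_inf gamma eps x).
Definition inner gamma eps f g : R :=
  intR (fun x => f x * g x * rho_inf gamma eps x).
Definition norm2 gamma eps f : R := Num.sqrt (inner gamma eps f f).

(* Since V' is continuous, L^2 solutions of gen u = - l u are classical;
   the endpoints -oo and +oo are in the limit-point case, so that square
   integrability is the only boundary condition. *)
Definition eigenfunction gamma eps (l : R) u :=
  [/\ inL2 gamma eps u,
      exists x, u x != 0,
      forall x, derivable u x 1,
      forall x, derivable (derive1 u) x 1 &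
      forall x, - gen gamma eps u x = l * u x].

Definition proj gamma eps (psi : nat -> R -> R) (n : nat) f : R -> R :=
  fun x => \sum_(k < n.+1) inner gamma eps f (psi k) * psi k x.

Definition orthonormal_basis gamma eps (psi : nat -> R -> R) :=
  [/\ forall k, inL2 gamma eps (psi k),
      forall j k, inner gamma eps (psi j) (psi k) = (j == k)%:R &
      forall f, inL2 gamma eps f ->
        norm2 gamma eps (fun x => f x - proj gamma eps psi n f x)
          @[n --> \oo] --> (0 : R)].

Definition spectral_decomposition gamma eps (lam : nat -> R)
    (psi : nat -> R -> R) :=
  [/\ lam 0%N = 0 /\ (forall x, psi 0%N x = 1),
      (forall k, lam k < lam k.+1) /\ (lam k @[k --> \oo] --> +oo),
      forall k, eigenfunction gamma eps (lam k) (psi k),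
      forall l u, eigenfunction gamma eps l u ->
        exists k, l = lam k /\ exists c, forall x, u x = c * psi k x &
      orthonormal_basis gamma eps psi].

Definition rho0 delta (x0 : R) : R -> R :=
  fun x => (2 * delta)^-1 * \1_(`]x0 - delta, x0 + delta[%classic) x.

Definition test_function phi :=
  [/\ forall x, derivable phi x 1,
      forall x, derivable (derive1 phi) x 1,
      continuous (derive1 (derive1 phi)) &
      exists M : R, forall x, M < `|x| -> phi x = 0].

(* Weak solution on [0, +oo[ of d_t rho = (rho V' + eps rho')', with
   rho / rho_inf continuous in time with values in L^2(rho_inf dx).
   The density need not be differentiable in x: integrating by parts twice moves
   the right-hand side onto the test function as gen phi. *)
Definition fokker_planck_solution gamma eps (init : R -> R)
    (rho : R -> R -> R) :=
  let h t x := rho t x / rho_inf gamma eps x in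
  [/\ forall x, rho 0 x = init x,
      forall t, 0 <= t -> inL2 gamma eps (h t),
      forall t, 0 <= t ->
        norm2 gamma eps (fun x => h s x - h t x)
          @[s --> within [set s | 0 <= s] (nbhs t)] --> (0 : R) &
      forall phi, test_function phi -> forall t, 0 < t ->
        is_derive t 1 (fun s => intR (fun x => rho s x * phi x))
          (intR (fun x => rho t x * gen gamma eps phi x))].

Definition trunc_dist gamma eps (psi : nat -> R -> R) (rho : R -> R -> R)
    (n : nat) (t : R) : R :=
  norm2 gamma eps
    (fun x => proj gamma eps psi n
                (fun y => rho t y / rho_inf gamma eps y) x - 1).

(* A distance d is a function of eps and of the time t. *)
Definition window_cutoff (d : R -> R -> R) (t w : R -> R) :=
  let p_plus r :=
    limf_esup (fun eps => (d eps (t eps + r * w eps))%:E) (0 : R)^'+ in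
  let p_minus r :=
    limf_einf (fun eps => (d eps (t eps + r * w eps))%:E) (0 : R)^'+ in
  [/\ \forall eps \near (0 : R)^'+, 0 < t eps /\ 0 < w eps,
      w eps / t eps @[eps --> (0 : R)^'+] --> (0 : R),
      p_minus r @[r --> -oo] --> +oo%E &
      p_plus r @[r --> +oo] --> 0%E].

Definition profile_cutoff (d : R -> R -> R) (t w p : R -> R) :=
  window_cutoff d t w /\
  forall r, d eps (t eps + r * w eps) @[eps --> (0 : R)^'+] --> p r.

End Defs.

(* Main.v *)
Require Import Defs.
From mathcomp Require Import all_boot all_order all_algebra.
From mathcomp Require Import all_classical all_reals all_analysis.
From mathcomp Require Import measurable_realfun ring lra.

Import Order.TTheory GRing.Theory Num.Theory.
Import numFieldNormedType.Exports.

Set Implicit Arguments.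
Unset Strict Implicit.
Unset Printing Implicit Defensive.

Local Open Scope classical_set_scope.
Local Open Scope ring_scope.

(** Put [s = eps ^ (1 / (1 + gamma))]. The potential is homogeneous of degree
    [gamma + 1], so the dilation by [s] turns the generator at noise [eps]
    into the generator at noise 1 divided by [w = s ^ (1 - gamma)], which is
    both the time window and the radius of the initial interval. Since the
    spectrum is simple, [lam eps k = lam 1 k / w] and [psi eps k x = +- psi 1
    k (x / s)] ([rescaled_spectrum], [rescaled_eigenfunction]). Testing the
    Fokker-Planck equation with eigenfunctions ([fokker_planck_mode]) shows
    that the [k]-th mode of the solution is [exp (- lam eps k * t)] times the
    average [a k] of [psi eps k] over the initial interval, and the truncated
    distance is the Euclidean norm of these modes ([trunc_dist_formula]).

    Everything then depends on the growth of [psi 1 k] at infinity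
    ([eigenfunction_growth]). Square integrability forces [u = psi 1 k] on the
    slow branch of [u'' = y ^ gamma * u' - l * u], where [l = lam 1 k] and [u'
    / u] is of order [l / y ^ gamma]; the correction to this quotient is of
    order [y ^ (- 3 * gamma)], integrable precisely because [gamma > 1 / 3].
    Hence, up to sign, [psi 1 k] lies between two multiples of [exp (l * phase
    y)], with [phase y = y ^ (1 - gamma) / (1 - gamma)].

    Away from the origin, [phase (x / s) = phase x / w] varies by O(1) over an
    interval of radius [w], so that [a k] is comparable to [exp (lam 1 k *
    phase x0 / w)] ([average_away]). All modes become of order 1 at the same
    time up to O(w), which is window cut-off.

    At the origin, odd modes vanish by symmetry, and for even ones the average
    is comparable to [g * exp (lam 1 k * phase ell)], where [ell = w / s] is
    the radius in microscopic units and [g = ell ^ (gamma - 1)] tends to 0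
    ([average_center]). When the mode [m] has size 1, the mode [k < m] has
    size about [g ^ (1 - lam 1 k / lam 1 m)], which tends to 0: only the
    highest even mode is left, whence the profile [exp (- lam 1 m * r)]. Both
    regimes are instances of criteria formulated with modes measured at the
    cut-off time of a reference mode ([window_cutoff_criterion],
    [profile_criterion]). *)

(** * Differentiation and monotonicity on the real line *)

Section Calculus.
Context {R : realType}.
Implicit Types (f g df dg : R -> R) (x y a b c d : R).

(** The rules of differentiation are stated for pointwise functions and with
    plain products, so that [ring] and [field] can bring derivatives to the
    form that each application needs. *)
Lemma is_derive_mul f g x a b :
  is_derive x 1 f a -> is_derive x 1 g b ->
  is_derive x 1 (fun y => f y * g y) (a * g x + f x * b).
Proof.
move=> fa gb; rewrite [a * _]mulrC [_ + _]addrC.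
exact: (is_deriveM fa gb).
Qed.

Lemma is_derive_add f g x a b :
  is_derive x 1 f a -> is_derive x 1 g b ->
  is_derive x 1 (fun y => f y + g y) (a + b).
Proof. by move=> fa gb; exact: (is_deriveD fa gb). Qed.

Lemma is_derive_opp f x a :
  is_derive x 1 f a -> is_derive x 1 (fun y => - f y) (- a).
Proof. by move=> fa; exact: (is_deriveN fa). Qed.

Lemma is_derive_sub f g x a b :
  is_derive x 1 f a -> is_derive x 1 g b ->
  is_derive x 1 (fun y => f y - g y) (a - b).
Proof. by move=> fa gb; exact: (is_deriveB fa gb). Qed.

Lemma is_derive_scal c f x a :
  is_derive x 1 f a -> is_derive x 1 (fun y => c * f y) (c * a).
Proof. by move=> fa; exact: (is_deriveZ c fa). Qed.

Lemma is_derive_const c x : is_derive x 1 (fun=> c : R) 0.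
Proof. exact: is_derive_cst. Qed.

Lemma is_derive_var x : is_derive x 1 (fun y => y : R) 1.
Proof. exact: is_derive_id. Qed.

Lemma is_derive_comp f g x a b :
  is_derive (g x) 1 f a -> is_derive x 1 g b ->
  is_derive x 1 (fun y => f (g y)) (b * a).
Proof.
move=> fa gb; have := @is_derive1_comp _ f g x a b fa gb.
by rewrite /GRing.scale /= mulrC.
Qed.

Lemma is_derive_exp f x a :
  is_derive x 1 f a ->
  is_derive x 1 (fun y => expR (f y)) (a * expR (f x)).
Proof. by move=> fa; exact: (is_derive_comp (is_derive_expR (f x)) fa). Qed.

Lemma is_derive_inv f x a : f x != 0 ->
  is_derive x 1 f a -> is_derive x 1 (fun y => (f y)^-1) (- a / f x ^+ 2).
Proof.
move=> fx0 fa; have := is_deriveV fx0 fa.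
by rewrite /GRing.scale /= mulrC mulNr mulrN.
Qed.

Lemma is_derive_log f x a : 0 < f x ->
  is_derive x 1 f a -> is_derive x 1 (fun y => ln (f y)) (a / f x).
Proof. by move=> fx fa; exact: (is_derive_comp (is_derive1_ln fx) fa). Qed.

Lemma is_derive_power c x : 0 < x ->
  is_derive x 1 (fun y => y `^ c) (c * x `^ c / x).
Proof.
move=> x0; apply: is_derive_eq (is_derive1_powR c x0) _.
rewrite powRB ?powRr1 ?ltW// ?mulrA//; apply/implyP => _; exact: lt0r_neq0.
Qed.

Lemma is_derive_continuous f x a : is_derive x 1 f a -> {for x, continuous f}.
Proof. by case=> fd _; apply/differentiable_continuous/derivable1_diffP. Qed.

Lemma is_derive_derivable f df : (forall x, is_derive x 1 f (df x)) ->
  (forall x, derivable f x 1) /\ derive1 f = df.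
Proof.
move=> dfE; split=> [x|]; first by case: (dfE x).
by apply/funext => x; rewrite derive1E; case: (dfE x).
Qed.

Lemma derivable_is_derive f : (forall x, derivable f x 1) ->
  forall x, is_derive x 1 f (derive1 f x).
Proof. by move=> fd x; rewrite derive1E; exact/derivableP/fd. Qed.

Lemma mean_value f df a b : a < b ->
  (forall x, a <= x <= b -> is_derive x 1 f (df x)) ->
  exists2 c, a < c < b & f b - f a = df c * (b - a).
Proof.
move=> ab fd; have [x||c cab ->] := @MVT R f df a b ab.
- by rewrite in_itv /= => /andP[/ltW ax /ltW xb]; apply: fd; rewrite ax.
- apply: continuous_in_subspaceT => x; rewrite inE /= in_itv /= => xab.
  exact: is_derive_continuous (fd x xab).
- by exists c; [move: cab; rewrite in_itv|].
Qed.

Lemma nondecreasing_of_derive f df a b : a <= b ->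
  (forall x, a <= x <= b -> is_derive x 1 f (df x)) ->
  (forall x, a <= x <= b -> 0 <= df x) -> f a <= f b.
Proof.
rewrite le_eqVlt => /predU1P[->//|ab] fd df0.
have [c /andP[ac cb] fab] := mean_value ab fd.
by rewrite -subr_ge0 fab mulr_ge0 ?subr_ge0 ?(ltW ab)// df0// !ltW.
Qed.

Lemma nonincreasing_of_derive f df a b : a <= b ->
  (forall x, a <= x <= b -> is_derive x 1 f (df x)) ->
  (forall x, a <= x <= b -> df x <= 0) -> f b <= f a.
Proof.
rewrite le_eqVlt => /predU1P[->//|ab] fd df0.
have [c /andP[ac cb] fab] := mean_value ab fd.
by rewrite -subr_le0 fab mulr_le0_ge0 ?subr_ge0 ?(ltW ab)// df0// !ltW.
Qed.

Lemma increasing_of_derive f df a b : a < b ->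
  (forall x, a <= x <= b -> is_derive x 1 f (df x)) ->
  (forall x, a <= x <= b -> 0 < df x) -> f a < f b.
Proof.
move=> ab fd df0; have [c /andP[ac cb] fab] := mean_value ab fd.
by rewrite -subr_gt0 fab mulr_gt0 ?subr_gt0// df0// !ltW.
Qed.

Lemma constant_of_derive f a b : a <= b ->
  (forall x, a <= x <= b -> is_derive x 1 f 0) -> f a = f b.
Proof.
move=> ab fd; apply/eqP; rewrite eq_le.
by rewrite (nondecreasing_of_derive ab fd)// (nonincreasing_of_derive ab fd).
Qed.

End Calculus.

(** * Powers, signs and limits at 0 from the right *)

Section Auxiliary.
Context {R : realType}.
Implicit Types (c b p x : R).

Lemma powRV c p : 0 <= c -> c^-1 `^ p = (c `^ p)^-1.
Proof. by move=> c0; rewrite -(powR_inv1 c0) powRAC powR_inv1 ?powR_ge0. Qed.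

Lemma small_powR b c : 0 < b -> 0 < c ->
  \forall eps \near (0 : R)^'+, eps `^ b <= c.
Proof.
move=> b0 c0; move/cvgrPdist_le: (powR_cvg0 b0) => /(_ _ c0).
by apply: filterS => eps; rewrite sub0r normrN ger0_norm ?powR_ge0.
Qed.

Lemma cvg_infty_powR (f : R -> R) b c : 0 < b -> 0 < c ->
  (\forall eps \near (0 : R)^'+, c / eps `^ b <= f eps) ->
  f eps @[eps --> (0 : R)^'+] --> +oo.
Proof.
move=> b0 c0 hf; apply/cvgryPge => A; have A1 : 0 < `|A| + 1 by rewrite
  ltr_wpDl.
near=> eps.
have e0 : 0 < eps by near: eps; exact: nbhs_right_gt.
have : eps `^ b < c / (`|A| + 1).
  near: eps; move/cvgrPdist_lt: (powR_cvg0 b0) => /(_ _ (divr_gt0 c0 A1)).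
  apply: filterS => eps; rewrite sub0r normrN ger0_norm ?powR_ge0//.
rewrite ltr_pdivlMr// mulrC -ltr_pdivlMr ?powR_gt0// => h.
have : c / eps `^ b <= f eps by near: eps.
by have := ler_norm A; lra.
Unshelve. all: end_near. Qed.

Lemma norm_of_sqr1 c : c ^+ 2 = 1 -> `|c| = 1.
Proof. by move=> /eqP; rewrite sqrf_eq1 => /orP[] /eqP->; rewrite ?normrN
  normr1. Qed.

Lemma norm_between c (p lo hi : R) : c ^+ 2 = 1 -> 0 <= lo ->
  lo <= c * p <= hi -> lo <= `|p| <= hi.
Proof.
move=> c1 lo0 /andP[h1 h2]; have -> : `|p| = c * p; last by rewrite h1.
by rewrite -[LHS]mul1r -(norm_of_sqr1 c1) -normrM ger0_norm// (le_trans lo0).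
Qed.

End Auxiliary.

(** * The potential *)

Section Potential.
Context {R : realType}.
Variable gamma : R.
Hypothesis gamma_gt0 : 0 < gamma.
Implicit Types x y s : R.

(** [V'], continuous at 0 although [V''] blows up there when [gamma < 1]; the
    physical force is its opposite. *)
Definition force x : R := Num.sg x * `|x| `^ gamma.

Lemma forceE x : 0 < x -> force x = x `^ gamma.
Proof. by move=> x0; rewrite /force gtr0_sg// mul1r gtr0_norm. Qed.

Lemma forceN x : force (- x) = - force x.
Proof. by rewrite /force sgrN normrN mulNr. Qed.

Lemma norm_force x : `|force x| = `|x| `^ gamma.
Proof.
rewrite /force normrM (ger0_norm (powR_ge0 _ _)) normr_sg.
have [->|x0] := eqVneq x 0; last by rewrite mul1r.
by rewrite normr0 powR0 ?mul0r// gt_eqF.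
Qed.

Lemma VN x : V gamma (- x) = V gamma x.
Proof. by rewrite /V normrN. Qed.

Lemma V_ge0 x : 0 <= V gamma x.
Proof.
by rewrite /V mulr_ge0 ?powR_ge0// invr_ge0 addr_ge0// ltW.
Qed.

Lemma powRD1 x : 0 <= x -> x `^ (gamma + 1) = x * x `^ gamma.
Proof.
move=> x0; have := @mulr_powRB1 R x (gamma + 1) x0.
by rewrite addrK => ->//; rewrite addr_gt0.
Qed.

Lemma is_derive_V_gt0 x : 0 < x -> is_derive x 1 (V gamma) (force x).
Proof.
have g0 := gamma_gt0; move=> x0; apply: (@near_eq_is_derive _ _ _
  (fun y => (gamma + 1)^-1 * y `^ (gamma + 1))).
  near=> y; rewrite /V gtr0_norm//.
  by near: y; exact: lt_nbhsr.
apply: is_derive_eq (is_derive_scal _ (is_derive_power _ x0)) _.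
rewrite forceE// powRD1 ?ltW//; field.
by rewrite gt_eqF//= gt_eqF//; lra.
Unshelve. end_near. Qed.

Lemma cvg_force0 : force y @[y --> (0 : R)] --> (0 : R).
Proof.
apply/cvgrPdist_le => e e0; have e1 : 0 < e `^ gamma^-1 by rewrite powR_gt0.
have := @nbhs0_le _ R _ e1; apply: filterS => y ye; rewrite sub0r normrN
  norm_force.
have -> : e = (e `^ gamma^-1) `^ gamma.
  by rewrite -powRrM mulVf ?gt_eqF// powRr1// ltW.
by rewrite ge0_ler_powR ?nnegrE ?normr_ge0 ?(ltW e1) ?(ltW gamma_gt0).
Qed.

Lemma is_derive_V x : is_derive x 1 (V gamma) (force x).
Proof.
have g0 := gamma_gt0; have [x0|x0|->] := ltgtP x 0.
- have Vx : V gamma = (fun y => V gamma (- y)) by apply/funext => y; rewrite VN.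
  rewrite Vx.
  apply: is_derive_eq
    (@is_derive_comp _ (V gamma) (fun y => - y) x _ _ _ _) _.
  + by apply: is_derive_V_gt0; rewrite oppr_gt0.
  + by rewrite forceN mulN1r opprK.
- exact: is_derive_V_gt0.
- apply/is_derive1_caratheodory; exists (fun y => (gamma + 1)^-1 * force y).
  split.
  + move=> y; rewrite /V subr0 normr0 powR0 ?mulr0 ?subr0; last by lra.
    have yE p : `|y| * p = Num.sg y * p * y by rewrite normrEsg; ring.
    by rewrite /force powRD1// yE; ring.
  + rewrite /prop_for /continuous_at [force 0]/force sgr0 mul0r.
    by apply: cvgM; [exact: cvg_cst|exact: cvg_force0].
  + by rewrite /force sgr0 mul0r mulr0.
Qed.

Lemma derive1_V : derive1 (V gamma) = force.
Proof. by have [] := is_derive_derivable is_derive_V. Qed.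

Lemma continuous_force : continuous force.
Proof.
suff cf (x : R) : force y @[y --> x] --> force x by move=> x; exact: cf.
have [x0|x0|->] := ltgtP x 0.
- have Nx : 0 < - x by rewrite oppr_gt0.
  have fx := is_derive_opp (@is_derive_comp R (fun y => y `^ gamma) _ x _ _
    (is_derive_power gamma Nx) (is_derive_opp (is_derive_var x))).
  have -> : force x = - (- x) `^ gamma.
    by rewrite -[x in LHS]opprK forceN forceE ?oppr_gt0.
  apply: (cvg_trans _ (is_derive_continuous fx)); apply: near_eq_cvg.
  near=> y; rewrite -[y in RHS]opprK forceN forceE// oppr_gt0.
  by near: y; exact: lt_nbhsl.
- rewrite forceE//.
  apply: (cvg_trans _ (is_derive_continuous (is_derive_power gamma x0))).
  apply: near_eq_cvg; near=> y; rewrite forceE//.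
  by near: y; exact: lt_nbhsr.
- by rewrite [force 0]/force sgr0 mul0r; exact: cvg_force0.
Unshelve. all: end_near. Qed.

Lemma V_scale s x : 0 <= s -> V gamma (s * x) = s `^ (gamma + 1) * V gamma x.
Proof. by move=> s0; rewrite /V normrM (ger0_norm s0) powRM//; ring. Qed.

Lemma force_scale s x : 0 < s -> force (s * x) = s `^ gamma * force x.
Proof.
move=> s0; rewrite /force sgrM gtr0_sg// mul1r normrM (gtr0_norm s0).
by rewrite powRM ?(ltW s0)//; ring.
Qed.

End Potential.

(** * Uniqueness for linear second-order equations *)

Section LinearODE.
Context {R : realType}.
Implicit Types (f p u : R -> R) (a b q x : R).

Lemma continuous_bounded f a b : continuous f ->
  exists2 M : R, 0 <= M & forall x, a <= x <= b -> `|f x| <= M.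
Proof.
move=> cf; have [ab|ba] := leP a b; last first.
  exists 0 => // x /andP[ax xb].
  by have := le_trans ax xb; rewrite leNgt ba.
have cnf : {within `[a, b], continuous (fun x => `|f x|)}.
  by apply: continuous_subspaceT => x; apply: cvg_norm; exact: cf.
have [c _ cM] := EVT_max ab cnf.
by exists `|f c| => // x xab; apply: cM; rewrite in_itv.
Qed.

(** An energy estimate: [u ^ 2 + u1 ^ 2] grows at most exponentially in both
    directions on bounded intervals, so it cannot leave the value 0. *)
Lemma linear_ode_unique u u1 p q a : continuous p ->
  (forall x, is_derive x 1 u (u1 x)) ->
  (forall x, is_derive x 1 u1 (p x * u1 x - q * u x)) ->
  u a = 0 -> u1 a = 0 -> forall x, u x = 0.
Proof.
move=> cp du du1 ua u1a x.
have [M M0 pM] := continuous_bounded (Num.min a x) (Num.max a x) cp.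
pose K : R := `|1 - q| + 2 * M.
pose En y : R := u y * u y + u1 y * u1 y.
pose En' y : R := 2 * (1 - q) * (u y * u1 y) + 2 * p y * (u1 y * u1 y).
have dEn (y : R) : is_derive y 1 En (En' y).
  apply: is_derive_eq
    (is_derive_add (is_derive_mul (du y) (du y))
                   (is_derive_mul (du1 y) (du1 y))) _.
  by rewrite /En'; ring.
have En'le (y : R) : Num.min a x <= y <= Num.max a x -> `|En' y| <= K * En y.
  move=> /pM py; rewrite /En' (le_trans (ler_normD _ _))//.
  have uu1 : 2 * `|u y * u1 y| <= En y.
    have := sqr_ge0 (u y - u1 y); have := sqr_ge0 (u y + u1 y).
    by rewrite /En; case: (ger0P (u y * u1 y)) => _; nra.
  have := normr_ge0 (1 - q); have := sqr_ge0 (u y).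
  rewrite !normrM (ger0_norm (_ : 0 <= 2))// /K.
  rewrite -normrM [`|u1 y| * _]mulrC -normrM -expr2 (ger0_norm (sqr_ge0 _)).
  have := normr_ge0 (p y); have := sqr_ge0 (u1 y).
  by move: uu1; rewrite /En -!expr2; nra.
have En0 (y : R) : 0 <= En y by rewrite /En -!expr2 addr_ge0 ?sqr_ge0.
have dexp (c y : R) : is_derive y 1 (fun z => expR (c * z)) (c * expR (c * y)).
  apply: is_derive_eq (is_derive_exp (is_derive_scal c (is_derive_var y))) _.
  by rewrite mulr1.
have Ena : En a = 0 by rewrite /En ua u1a; ring.
suff Enx : En x <= 0.
  have := sqr_ge0 (u x); have := sqr_ge0 (u1 x).
  move: Enx; rewrite /En -!expr2 => Enx u1x ux.
  by apply/eqP; rewrite -sqrf_eq0 eq_le ux andbT; lra.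
have [ax|xa] := leP a x.
- have := @nonincreasing_of_derive _ _ _ _ _ ax
    (fun y _ => is_derive_mul (dEn y) (dexp (- K) y)) _.
  rewrite Ena mul0r pmulr_lle0 ?expR_gt0//; apply => y yax.
  have := En'le y; rewrite (min_idPl ax) (max_idPr ax) => /(_ yax).
  rewrite ler_norml => /andP[_ h]; have := expR_ge0 (- K * y); nra.
- have := @nondecreasing_of_derive _ _ _ _ _ (ltW xa)
    (fun y _ => is_derive_mul (dEn y) (dexp K y)) _.
  rewrite Ena mul0r pmulr_lle0 ?expR_gt0//; apply => y yax.
  have := En'le y; rewrite (min_idPr (ltW xa)) (max_idPl (ltW xa)) => /(_ yax).
  rewrite ler_norml => /andP[h _]; have := expR_ge0 (K * y); nra.
Qed.

End LinearODE.

(** * Growth of the eigenfunctions at infinity *)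

Section Growth.
Context {R : realType}.
Implicit Types (f u : R -> R) (x y l k a : R).
Local Notation mu := (@lebesgue_measure R).

Lemma not_integrable_ge f k a : 0 < k -> (forall x, 0 <= f x) ->
  (forall x, a <= x -> k <= f x) -> ~ integrableR f.
Proof.
move=> k0 f0 fk fi; have mf' := measurable_int _ (integrable_abse fi).
move/integrableP: fi => [mf].
apply/negP; rewrite -leNgt.
rewrite (@le_trans _ _ (\int[mu]_(x in `[a, +oo[) k%:E)%E)//.
  rewrite integral_cst//= lebesgue_measure_itv/= ltry mulry gtr0_sg//.
  by rewrite mul1e.
rewrite (@le_trans _ _ (\int[mu]_(x in `[a, +oo[) `|(EFin \o f) x|)%E)//.
  apply: ge0_le_integral => //.
  - by move=> x _; rewrite lee_fin ltW.
  - exact: measurable_funS mf'.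
  - move=> x; rewrite set_itvE /= => ax.
    by rewrite lee_fin ger0_norm// fk.
exact: ge0_subset_integral.
Qed.

End Growth.

Section Asymptotics.
Context {R : realType}.
Variable gamma : R.
Hypotheses (gamma_gt0 : 0 < gamma) (gamma_lt1 : gamma < 1).
Implicit Types x y l : R.

(** An antiderivative of [y ^ (- gamma)] on the positive half-line. For large
    [y] the equation [u'' = y ^ gamma * u' - l * u] leaves two possible growth
    rates for [u' / u]: the fast one [y ^ gamma], excluded by square
    integrability, and the slow one [l / y ^ gamma], which integrates to [l *
    phase y]. *)
Definition phase y : R := (1 - gamma)^-1 * `|y| `^ (1 - gamma).

Lemma powR1B y : 0 < y -> y `^ (1 - gamma) = y / y `^ gamma.
Proof.
move=> y0; rewrite powRB ?powRr1 ?ltW//.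
by apply/implyP => _; exact: lt0r_neq0.
Qed.

Lemma is_derive_phase y : 0 < y -> is_derive y 1 phase (y `^ gamma)^-1.
Proof.
have g1 := gamma_lt1; move=> y0; apply: (@near_eq_is_derive _ _ _
  (fun y => (1 - gamma)^-1 * y `^ (1 - gamma))).
  near=> z; rewrite /phase gtr0_norm//.
  by near: z; exact: lt_nbhsr.
apply: is_derive_eq (is_derive_scal _ (is_derive_power _ y0)) _.
rewrite powR1B//; have Py := powR_gt0 gamma y0; field.
by rewrite !gt_eqF//= subr_gt0.
Unshelve. end_near. Qed.

Lemma phase_scale (c : R) y : 0 < c -> phase (y / c) = phase y / c `^ (1 -
  gamma).
Proof.
move=> c0; rewrite /phase normrM normfV (gtr0_norm c0) powRM ?invr_ge0 ?(ltW
  c0)//.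
by rewrite powRV ?(ltW c0)// mulrA.
Qed.

Lemma phase_lipschitz (h : R) x y : 0 < h -> h <= x -> h <= y ->
  `|phase y - phase x| <= (h `^ gamma)^-1 * `|y - x|.
Proof.
move=> h0; wlog xy : x y / x <= y => [hwlog hx hy|hx _].
  have [|/ltW] := leP x y; first by move=> xy; exact: hwlog.
  by move=> yx; rewrite distrC [`|y - x|]distrC; exact: hwlog.
have dphase z : x <= z <= y -> is_derive z 1 (phase) (z `^ gamma)^-1.
  move=> /andP[xz _]; apply: is_derive_phase => //.
  exact: lt_le_trans h0 (le_trans hx xz).
have inc : phase x <= phase y.
  apply: (nondecreasing_of_derive xy dphase) => z _.
  by rewrite invr_ge0 powR_ge0.
have le : (h `^ gamma)^-1 * x - phase x <= (h `^ gamma)^-1 * y - phase y.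
  apply: (@nondecreasing_of_derive R (fun z => (h `^ gamma)^-1 * z - phase z)
    (fun z => (h `^ gamma)^-1 * 1 - (z `^ gamma)^-1) _ _ xy) => z xzy.
    exact: (is_derive_sub (is_derive_scal _ (is_derive_var z)) (dphase z xzy)).
  have hz : h <= z by case/andP: xzy => xz _; exact: le_trans xz.
  rewrite mulr1 subr_ge0 lef_pV2 ?posrE ?powR_gt0//; last exact: lt_le_trans hz.
  by rewrite ge0_ler_powR ?nnegrE ?(ltW gamma_gt0) ?(ltW h0)// (le_trans (ltW
    h0)).
by rewrite !ger0_norm ?subr_ge0//; lra.
Qed.

Lemma powR_large M : exists2 Y : R, 1 <= Y &
  forall y, Y <= y -> M <= y `^ gamma.
Proof.
exists (Num.max 1 ((`|M|) `^ gamma^-1)); first by rewrite le_max lexx.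
move=> y; rewrite ge_max => /andP[y1 My].
have y0 : 0 <= y by apply: le_trans y1.
rewrite (le_trans (ler_norm M))// -[`|M|]powRr1//.
rewrite -(mulVf (lt0r_neq0 gamma_gt0)) powRrM.
by rewrite ge0_ler_powR ?nnegrE ?powR_ge0// ltW.
Qed.

Lemma powR_ge1 y : 1 <= y -> 1 <= y `^ gamma.
Proof. by move=> y1; rewrite -(powRr0 y) ler_powR// ltW. Qed.

Lemma powR_le_id y : 1 <= y -> y `^ gamma <= y.
Proof. by move=> y1; rewrite -{2}(powRr1 (le_trans ler01 y1)) ler_powR// ltW.
  Qed.

Variables (l : R) (u u1 : R -> R).
Hypothesis l_gt0 : 0 < l.
Hypothesis du : forall x, is_derive x 1 u (u1 x).
Hypothesis du1 :
  forall x, is_derive x 1 u1 (force gamma x * u1 x - l * u x).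
Hypothesis u_neq0 : exists x, u x != 0.
Hypothesis u_L2 : integrableR (fun x => u x ^+ 2 * expR (- V gamma x)).

Lemma eigen_nonzero y : u y = 0 -> u1 y = 0 -> False.
Proof.
move=> uy u1y; have [x /eqP] := u_neq0; apply.
exact: (linear_ode_unique (continuous_force gamma_gt0) du du1 uy u1y).
Qed.

Let b y : R := 2 * l / y `^ gamma.
Let Q y : R := u y * (u1 y - b y * u y).
Let Q' y : R := y `^ gamma * Q y + (u1 y - b y * u y) ^+ 2
  + (l - b y ^+ 2 + b y * gamma / y) * u y ^+ 2.

(** With the barrier [b = 2 * l / y ^ gamma] the coefficient of [u ^ 2] in
    [Q'] is eventually at least [l / 2]. *)
Lemma is_derive_barrier y : 0 < y -> is_derive y 1 Q (Q' y).
Proof.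
move=> y0; have Py := powR_gt0 gamma y0.
have db : is_derive y 1 b (- (b y * gamma / y)).
  apply: is_derive_eq
    (is_derive_scal (2 * l) (@is_derive_inv R (fun y => y `^ gamma) y _
       (lt0r_neq0 Py) (is_derive_power _ y0))) _.
  by rewrite /b; field; rewrite !gt_eqF.
apply: is_derive_eq (is_derive_mul (du y)
  (is_derive_sub (du1 y) (is_derive_mul db (du y)))) _.
rewrite /Q' /Q (forceE _ y0) /b; field.
by rewrite !gt_eqF.
Qed.

Let W c y : R := Q y * expR (- (V gamma y + c * y)).
Let W' c y : R :=
  (Q' y - (y `^ gamma + c) * Q y) * expR (- (V gamma y + c * y)).

Lemma is_derive_weighted_barrier c y : 0 < y ->
  is_derive y 1 (W c) (W' c y).
Proof.
move=> y0; apply: is_derive_eq (is_derive_mul (is_derive_barrier y0)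
  (is_derive_exp (is_derive_opp (is_derive_add (is_derive_V gamma_gt0 y)
    (is_derive_scal c (is_derive_var y)))))) _.
by rewrite (forceE _ y0) /W'; ring.
Qed.

(** Above the barrier [b] the quotient [u1 / u] is driven to the fast branch
    [u1 / u ~ y ^ gamma], along which [u ^ 2 * exp (- V)] is not integrable.
    Working with [u * u1 - b * u ^ 2] avoids any division by [u]. *)
Lemma below_barrier : exists2 Y : R, 1 <= Y &
  forall y, Y <= y -> u y * (u1 y - 2 * l / y `^ gamma * u y) < 0.
Proof.
suff [Y Y1 QY] : exists2 Y : R, 1 <= Y & forall y, Y <= y -> Q y < 0.
  by exists Y.
have l0 := l_gt0; have [Y Y1 YP] := powR_large (8 * l + 1); exists Y => // y0
  Yy0.
rewrite ltNge; apply/negP => Qy0.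
have PY y : Y <= y -> [/\ 1 <= y, 0 < y, 8 * l + 1 <= y `^ gamma & 0 < b y].
  move=> Yy; have y1 := le_trans Y1 Yy; have y0' := lt_le_trans ltr01 y1.
  split => //; first exact: YP.
  by apply: divr_gt0; [exact: mulr_gt0|exact: powR_gt0].
have Bge y : Y <= y -> l / 2 <= l - b y ^+ 2 + b y * gamma / y.
  move=> /PY[y1 y0' P8 by0].
  have : 0 <= b y * gamma / y by apply: divr_ge0; [apply: mulr_ge0|]; exact:
    ltW.
  suff : b y ^+ 2 <= l / 2 by lra.
  have P0 := powR_gt0 gamma y0'.
  rewrite /b expr_div_n ler_pdivrMr ?exprn_gt0//.
  set P := y `^ gamma in P8 P0 *; have : 8 * l <= P ^+ 2 by nra.
  by nra.
(* [z ^ 2 + k ^ 2 * u ^ 2 >= 2 * k * u * z] lets [Q] grow by the extra factor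
   [exp (2 * k * y)], which pays for the factor [y ^ gamma] in [(exp V)']. *)
pose k : R := Num.min 1 (l / 2).
have k0 : 0 < k by rewrite lt_min ltr01 divr_gt0.
have kl : k ^+ 2 <= l / 2.
  have k1 : k <= 1 by rewrite ge_min lexx.
  have : k <= l / 2 by rewrite ge_min lexx orbT.
  by nra.
pose y1 := y0 + 1; have Yy1 : Y <= y1 by rewrite /y1; lra.
(* If [Q] vanishes at [y0], it is positive right after: [u] and [u1] have no
   common zero. *)
have Qy1 : 0 < Q y1.
  suff : W 0 y0 < W 0 y1.
    have W0 : 0 <= W 0 y0 by rewrite mulr_ge0 ?expR_ge0.
    by move=> /(le_lt_trans W0); rewrite pmulr_lgt0 ?expR_gt0.
  apply: (@increasing_of_derive R (W 0) (W' 0)) => [|y|y]; first by rewrite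
    /y1; lra.
    move=> /andP[/(le_trans Yy0)/PY[_ ? _ _] _].
    exact: is_derive_weighted_barrier.
  move=> /andP[/(le_trans Yy0) Yy _]; rewrite mulr_gt0 ?expR_gt0//.
  have By := Bge y Yy; have -> : Q' y - (y `^ gamma + 0) * Q y =
      (u1 y - b y * u y) ^+ 2 + (l - b y ^+ 2 + b y * gamma / y) * u y ^+ 2.
    by rewrite /Q'; ring.
  have [uy|uy] := eqVneq (u y) 0.
    rewrite uy mulr0 subr0 expr0n /= mulr0 addr0 lt_def sqr_ge0 andbT.
    by rewrite sqrf_eq0; apply/eqP => u1y; exact: (eigen_nonzero uy u1y).
  rewrite ltr_wpDl ?sqr_ge0// mulr_gt0//; first by lra.
  by rewrite lt_def sqr_ge0 sqrf_eq0 uy.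
have [q q0 Qge] : exists2 q, 0 < q &
    forall y, y1 <= y -> q * expR (V gamma y + 2 * k * y) <= Q y.
  exists (W (2 * k) y1) => [|y y1y]; first by rewrite mulr_gt0 ?expR_gt0.
  suff : W (2 * k) y1 <= W (2 * k) y.
    by rewrite [W _ y]/W expRN ler_pdivlMr ?expR_gt0.
  apply: (@nondecreasing_of_derive R (W (2 * k)) (W' (2 * k))) => [//|z|z].
    move=> /andP[/(le_trans Yy1)/PY[_ ? _ _] _].
    exact: is_derive_weighted_barrier.
  move=> /andP[/(le_trans Yy1) Yz _]; rewrite mulr_ge0 ?expR_ge0//.
  have Bz := Bge z Yz; have -> : Q' z - (z `^ gamma + 2 * k) * Q z =
      (u1 z - b z * u z - k * u z) ^+ 2
      + (l - b z ^+ 2 + b z * gamma / z - k ^+ 2) * u z ^+ 2.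
    by rewrite /Q' /Q; ring.
  by rewrite addr_ge0 ?sqr_ge0// mulr_ge0 ?sqr_ge0//; lra.
have [K [K0 KE]] : exists K, 0 < K /\ K = 4 * q * k.
  by exists (4 * q * k); split=> //; apply: mulr_gt0 => //; apply: mulr_gt0.
have uge y : y1 <= y -> K * (expR (V gamma y) - expR (V gamma y1)) <= u y ^+ 2.
  move=> y1y.
  suff : u y1 * u y1 - K * expR (V gamma y1) <= u y * u y - K * expR (V gamma
    y).
    have := sqr_ge0 (u y1); rewrite mulrBr [u y1 ^+ 2]expr2 [u y ^+ 2]expr2.
    by move: (expR (V gamma y)) (expR (V gamma y1)) => *; lra.
  apply: (nondecreasing_of_derive y1y (fun z _ =>
    is_derive_sub (is_derive_mul (du z) (du z))
      (is_derive_scal K (is_derive_exp (is_derive_V gamma_gt0 z))))).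
  move=> z /andP[y1z _]; have [z1 z0 Pz bz] := PY z (le_trans Yy1 y1z).
  have := Qge z y1z; rewrite expRD (forceE _ z0).
  have Pzz := powR_le_id z1; have E0 := expR_gt0 (V gamma z).
  have ez : 2 * k * z <= expR (2 * k * z).
    by have := expR_ge1Dx (2 * k * z); lra.
  rewrite /Q KE => Qz; rewrite subr_ge0.
  have h1 : 4 * q * k * (z `^ gamma * expR (V gamma z))
            <= 2 * (q * (expR (V gamma z) * expR (2 * k * z))).
    have -> : 4 * q * k * (z `^ gamma * expR (V gamma z)) =
      2 * (q * (expR (V gamma z) * (2 * k * z `^ gamma))) by ring.
    rewrite ler_pM2l// ler_pM2l// ler_pM2l// (le_trans _ ez)//.
    by rewrite ler_pM2l// mulr_gt0.
  have := mulr_ge0 (ltW bz) (sqr_ge0 (u z)); rewrite expr2.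
  by move: h1 Qz; lra.
apply: (@not_integrable_ge R _ (K / 2) (y1 + 1) _ _ _ u_L2) => [|x|y yy].
- by rewrite divr_gt0.
- by rewrite mulr_ge0 ?sqr_ge0 ?expR_ge0.
have y1y : y1 <= y by lra.
rewrite expRN ler_pdivlMr ?expR_gt0//; apply: le_trans (uge y y1y).
suff h : expR (V gamma y1) <= expR (V gamma y) / 2.
  move: (ler_wpM2l (ltW K0) h).
  by move: (expR (V gamma y)) (expR (V gamma y1)) => *; lra.
have : V gamma y1 - y1 <= V gamma y - y.
  apply: (nondecreasing_of_derive y1y (fun z _ =>
    is_derive_sub (is_derive_V gamma_gt0 z) (is_derive_var z))).
  move=> z /andP[y1z _]; have [z1 z0 _ _] := PY z (le_trans Yy1 y1z).
  by rewrite (forceE _ z0) subr_ge0 powR_ge1.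
move=> Vy; have : expR (V gamma y1 + 1) <= expR (V gamma y).
  by rewrite ler_expR; lra.
rewrite expRD ler_pdivlMr//; apply: le_trans.
by rewrite ler_pM2l ?expR_gt0//; have := expR_ge1Dx (1 : R); lra.
Qed.

End Asymptotics.

Section ExponentialGrowth.
Context {R : realType}.
Implicit Types x y s : R.
Variable gamma : R.
Hypotheses (gamma_gt0 : 0 < gamma) (gamma_lt1 : gamma < 1).
Variables (l : R) (u u1 : R -> R).
Hypothesis l_gt0 : 0 < l.
Hypothesis du : forall x, is_derive x 1 u (u1 x).
Hypothesis du1 :
  forall x, is_derive x 1 u1 (force gamma x * u1 x - l * u x).
Hypothesis u_neq0 : exists x, u x != 0.
Hypothesis u_L2 : integrableR (fun x => u x ^+ 2 * expR (- V gamma x)).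

(** A positive solution whose derivative is nonpositive somewhere would become
    negative, because [exp (- V) * u1] decreases as long as [u] is positive. *)
Lemma derivative_positive s Y : 1 <= Y ->
  (forall y, Y <= y -> 0 < s * u y) -> forall y, Y <= y -> 0 < s * u1 y.
Proof.
move=> Y1 su y0 Yy0; rewrite ltNge; apply/negP => su1.
pose q (y : R) : R := s * (u1 y * expR (- V gamma y)).
have dq y : is_derive y 1 q (- (l * (s * u y)) * expR (- V gamma y)).
  apply: is_derive_eq (is_derive_scal s (is_derive_mul (du1 y)
    (is_derive_exp (is_derive_opp (is_derive_V gamma_gt0 y))))) _.
  by ring.
pose y1 := y0 + 1; have y01 : y0 < y1 by rewrite /y1; lra.
have q1 : q y1 < 0.
  have q0 : q y0 <= 0 by rewrite /q mulrA mulr_le0_ge0 ?expR_ge0.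
  apply: lt_le_trans q0; rewrite -ltrN2.
  apply: (increasing_of_derive y01 (fun y _ => is_derive_opp (dq y))) => y.
  move=> /andP[y0y _]; rewrite mulNr opprK mulr_gt0 ?expR_gt0// mulr_gt0//.
  by apply: su; apply: le_trans y0y.
pose c := - q y1; have c0 : 0 < c by rewrite /c oppr_gt0.
have u1c y : y1 <= y -> s * u1 y <= - c.
  move=> y1y; have qc : q y <= - c.
    rewrite /c opprK; apply: (nonincreasing_of_derive y1y (fun z _ => dq z)).
    move=> z /andP[y1z _]; rewrite mulNr oppr_le0 mulr_ge0 ?expR_ge0//.
    rewrite mulr_ge0 ?(ltW l_gt0)// ltW// su//.
    by apply: le_trans Yy0 _; apply: le_trans (ltW y01) y1z.
  have E0 := expR_gt0 (V gamma y).
  have -> : s * u1 y = q y * expR (V gamma y).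
    by rewrite /q expRN; field; rewrite gt_eqF.
  have E1 : 1 <= expR (V gamma y).
    by rewrite -[leLHS]expR0 ler_expR V_ge0.
  apply: le_trans (_ : - c * expR (V gamma y) <= _); first by rewrite ler_pM2r.
  by rewrite mulNr lerN2 ler_peMr// ltW.
pose y2 := y1 + s * u y1 / c.
have su1y : 0 < s * u y1 by apply: su; apply: le_trans Yy0 (ltW y01).
have y12 : y1 <= y2 by rewrite lerDl ltW// divr_gt0.
have : s * u y2 + c * y2 <= s * u y1 + c * y1.
  apply: (nonincreasing_of_derive y12 (fun z _ => is_derive_add
    (is_derive_scal s (du z)) (is_derive_scal c (is_derive_var z)))).
  by move=> z /andP[y1z _]; rewrite mulr1; have := u1c z y1z; lra.
have : 0 < s * u y2.
  by apply: su; apply: le_trans Yy0 _; apply: le_trans (ltW y01) y12.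
rewrite {3}/y2 mulrDr [c * (_ / c)]mulrC divfK ?gt_eqF//.
by move: (u y1) (u y2) => *; lra.
Qed.

(** Below the barrier [u] has no zero, hence a constant sign [s], and the
    barrier becomes an upper bound for [u1 / u]. *)
Lemma eventual_sign : exists Y s : R, [/\ 1 <= Y, s ^+ 2 = 1 &
  forall y, Y <= y -> [/\ 0 < s * u y, 0 < s * u1 y &
    s * u1 y <= 2 * l / y `^ gamma * (s * u y)]].
Proof.
have [Y Y1 uY] := below_barrier gamma_gt0 gamma_lt1 l_gt0 du du1 u_neq0 u_L2.
have u0 y : Y <= y -> u y != 0.
  by move=> /uY; apply: contraTneq => ->; rewrite mul0r ltxx.
pose s := Num.sg (u Y); have s1 : s ^+ 2 = 1 by rewrite sqr_sg u0.
have su y : Y <= y -> 0 < s * u y.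
  move=> Yy; rewrite ltNge; apply/negP => su0.
  have cu : {within `[Y, y], continuous u}.
    by apply: continuous_subspaceT => x; exact: is_derive_continuous (du x).
  have [|c] := @IVT _ u Y y 0 Yy cu.
    rewrite ge_min le_max; move: su0; rewrite /s.
    have := u0 Y (lexx _).
    by case: sgrP => // uY0 _; rewrite ?mul1r ?mulN1r ?oppr_le0 => ->;
      rewrite ?orbT.
  by rewrite in_itv /= => /andP[Yc _] /eqP; apply/negP/u0.
exists Y, s; split => // y Yy; split; first exact: su.
  exact: derivative_positive su _ Yy.
have := uY y Yy; have -> : u y * (u1 y - 2 * l / y `^ gamma * u y) =
    (s * u y) * (s * u1 y - 2 * l / y `^ gamma * (s * u y)).
  by rewrite -[LHS]mul1r -s1; ring.
by rewrite pmulr_rlt0 ?su// subr_lt0 => /ltW.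
Qed.

Hypothesis gamma_gt3 : 3^-1 < gamma.

(** The equation for [p = u1 / u] reads
    [p = l / y ^ gamma + p ^ 2 / y ^ gamma + p' / y ^ gamma].  Integrating the
    last term by parts leaves errors of order [y ^ (- 3 * gamma)], which are
    integrable because [3 * gamma > 1]; hence [ln u = l * phase + O(1)]. *)
Theorem eigenfunction_growth : exists Y c C s : R,
  [/\ 1 <= Y, 0 < c, 0 < C, s ^+ 2 = 1 & forall y, Y <= y ->
    [/\ c * expR (l * phase gamma y) <= s * u y,
        s * u y <= C * expR (l * phase gamma y) &
        `|u1 y| <= 2 * l * `|u y| ]].
Proof.
have l0 := l_gt0; have g3 := gamma_gt3; have g0 := gamma_gt0.
have [Y [s [Y1 s1 uY]]] := eventual_sign.
pose P (y : R) : R := y `^ gamma; pose p (y : R) : R := s * u1 y / (s * u y).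
pose Phi (y : R) : R := ln (s * u y) - p y / P y - l * phase gamma y.
pose Phi' (y : R) : R := p y ^+ 2 / P y + gamma * p y / (P y * y).
(* [Psi'] dominates [Phi'] by [p <= 2 * l / P], and [Psi <= 0] because
   [1 - 3 * gamma < 0]; hence [Phi] is bounded. *)
pose Psi (y : R) : R := (4 * l ^+ 2 / (1 - 3 * gamma)) * (y / P y ^+ 3) - l / P
  y ^+ 2.
pose Psi' (y : R) : R := 4 * l ^+ 2 / P y ^+ 3 + 2 * l * gamma / (P y ^+ 2 * y).
have PY y : Y <= y -> [/\ 0 < y, 1 <= P y & 0 < P y].
  move=> Yy; have y1 := le_trans Y1 Yy; have y0 := lt_le_trans ltr01 y1.
  by split => //; [exact: powR_ge1|exact: powR_gt0].
have dP y : Y <= y -> is_derive y 1 P (gamma * P y / y).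
  by move=> /PY[y0 _ _]; exact: is_derive_power.
have s0 : s != 0 by apply/eqP => s0; move: s1; rewrite s0 expr0n /= =>
  /esym/eqP; rewrite oner_eq0.
have dPhi y : Y <= y -> is_derive y 1 Phi (Phi' y).
  move=> Yy; have [y0 P1 P0] := PY y Yy; have [su _ _] := uY y Yy.
  have su0 := lt0r_neq0 su.
  have dp := is_derive_mul (is_derive_scal s (du1 y))
    (@is_derive_inv R (fun y => s * u y) y _ su0 (is_derive_scal s (du y))).
  have dpP := is_derive_mul dp (@is_derive_inv R P y _ (lt0r_neq0 P0) (dP y
    Yy)).
  apply: is_derive_eq (is_derive_sub (is_derive_sub
    (@is_derive_log R (fun y => s * u y) y _ su (is_derive_scal s (du y)))
    dpP)
    (is_derive_scal l (is_derive_phase gamma_lt1 y0))) _.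
  have Py : P y != 0 by rewrite gt_eqF.
  move: su0; rewrite mulf_eq0 negb_or => /andP[_ uy0].
  rewrite (forceE _ y0) -/(P y) /Phi' /p; field.
  by rewrite Py uy0 s0 gt_eqF.
have dPsi y : Y <= y -> is_derive y 1 Psi (Psi' y).
  move=> Yy; have [y0 P1 P0] := PY y Yy.
  have dP2 := is_derive_mul (dP y Yy) (dP y Yy).
  have dP3 := is_derive_mul (dP y Yy) dP2.
  have Pn := lt0r_neq0 P0; have P20 : P y * P y != 0 by apply: mulf_neq0.
  have P30 : P y * (P y * P y) != 0 by apply: mulf_neq0.
  have -> : Psi = fun y => (4 * l ^+ 2 / (1 - 3 * gamma)) *
      (y * (P y * (P y * P y))^-1) - l * (P y * P y)^-1.
    by apply/funext => z; rewrite /Psi !exprS expr0 !mulr1.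
  apply: is_derive_eq (is_derive_sub
    (is_derive_scal (4 * l ^+ 2 / (1 - 3 * gamma))
     (is_derive_mul (is_derive_var y)
      (@is_derive_inv R (fun y => P y * (P y * P y)) y _ P30 dP3)))
    (is_derive_scal l
      (@is_derive_inv R (fun y => P y * P y) y _ P20 dP2))) _.
  rewrite /Psi'; field.
  rewrite Pn gt_eqF//=; apply/eqP; lra.
have pP y : Y <= y -> 0 < p y /\ p y <= 2 * l / P y.
  move=> Yy; have [su su1 sle] := uY y Yy.
  by rewrite /p divr_gt0//; split => //; rewrite ler_pdivrMr.
have Phi'0 y : Y <= y -> 0 <= Phi' y.
  move=> Yy; have [y0 _ P0] := PY y Yy; have [p0 _] := pP y Yy.
  apply: addr_ge0; apply: divr_ge0; rewrite ?sqr_ge0 ?(ltW P0)//.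
    by apply: mulr_ge0; exact: ltW.
  by apply: mulr_ge0; exact: ltW.
have Phi'le y : Y <= y -> Phi' y <= Psi' y.
  move=> Yy; have [y0 _ P0] := PY y Yy; have [p0 ple] := pP y Yy.
  rewrite /Phi' /Psi'; apply: lerD.
    have -> : 4 * l ^+ 2 / P y ^+ 3 = (2 * l / P y) ^+ 2 / P y.
      by field; rewrite gt_eqF.
    by rewrite ler_pM2r ?invr_gt0// lerXn2r ?nnegrE// ?(ltW p0)// (le_trans _
      ple)// ltW.
  have -> : 2 * l * gamma / (P y ^+ 2 * y) = gamma * (2 * l / P y) / (P y * y).
    by field; rewrite !gt_eqF.
  by rewrite ler_pM2r ?invr_gt0 ?mulr_gt0// ler_pM2l.
have Psi0 y : Y <= y -> Psi y <= 0.
  move=> Yy; have [y0 _ P0] := PY y Yy.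
  have h1 : 0 < y / P y ^+ 3 by rewrite divr_gt0 ?exprn_gt0.
  have h2 : 0 < l / P y ^+ 2 by rewrite divr_gt0 ?exprn_gt0.
  have h3 : 4 * l ^+ 2 / (1 - 3 * gamma) < 0.
    rewrite pmulr_rlt0 ?mulr_gt0 ?exprn_gt0// invr_lt0; lra.
  by rewrite /Psi; have := nmulr_rlt0 (y / P y ^+ 3) h3; rewrite h1; lra.
have uE y : Y <= y ->
    s * u y = expR (Phi y + p y / P y) * expR (l * phase gamma y).
  move=> Yy; have [su _ _] := uY y Yy.
  by rewrite -expRD /Phi -[LHS]lnK//; congr expR; ring.
exists Y, (expR (Phi Y)), (expR (Phi Y - Psi Y + 2 * l)), s.
split; rewrite ?expR_gt0// => y Yy.
have [y0 P1 P0] := PY y Yy; have [p0 ple] := pP y Yy.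
have [su su1 sle] := uY y Yy.
have pP0 : 0 < p y / P y by rewrite divr_gt0.
have lP : 2 * l / P y <= 2 * l by rewrite ler_pdivrMr// ler_peMr// mulr_ge0//
  ltW.
have pPle : p y / P y <= 2 * l.
  by rewrite ler_pdivrMr// (le_trans ple)// (le_trans lP)// ler_peMr//
    mulr_ge0// ltW.
have hlo : Phi Y <= Phi y.
  apply: (@nondecreasing_of_derive R Phi Phi' _ _ Yy) => z /andP[Yz _].
    exact: dPhi.
  exact: Phi'0.
have hhi : Psi Y - Phi Y <= Psi y - Phi y.
  apply: (@nondecreasing_of_derive R (fun z => Psi z - Phi z)
    (fun z => Psi' z - Phi' z) _ _ Yy) => z /andP[Yz _].
    exact: (is_derive_sub (dPsi z Yz) (dPhi z Yz)).
  by rewrite subr_ge0 Phi'le.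
have Psiy := Psi0 y Yy.
split.
- rewrite uE// ler_pM2r ?expR_gt0// ler_expR.
  by move: (Phi Y) (Phi y) hlo (p y / P y) pP0 => *; lra.
- rewrite uE// ler_pM2r ?expR_gt0// ler_expR.
  by move: (Phi Y) (Phi y) (Psi y) (Psi Y) hhi Psiy (p y / P y) pPle => *; lra.
- have ns : `|s| = 1.
    by apply/eqP; rewrite -sqrp_eq1 // real_normK ?num_real// s1.
  have nsM z : `|z| = `|s * z| by rewrite normrM ns mul1r.
  rewrite (nsM (u1 y)) (nsM (u y)).
  rewrite (gtr0_norm su) (gtr0_norm su1) (le_trans sle)//.
  by apply: ler_wpM2r; [exact: ltW|exact: lP].
Qed.

End ExponentialGrowth.

(** * Integrals over the line and the weighted L2 space *)

Section IntegralR.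
Context {R : realType}.
Implicit Types (f g h : R -> R) (c x : R).
Local Notation mu := (@lebesgue_measure R).

Lemma integrable_add f g : integrableR f -> integrableR g ->
  integrableR (fun x => f x + g x).
Proof. by move=> fi gi; exact: (integrableD measurableT fi gi). Qed.

Lemma integrable_scal c f : integrableR f -> integrableR (fun x => c * f x).
Proof. by move=> fi; exact: (integrableZl measurableT c fi). Qed.

Lemma intR_add f g : integrableR f -> integrableR g ->
  intR (fun x => f x + g x) = intR f + intR g.
Proof. by move=> fi gi; exact: (RintegralD measurableT fi gi). Qed.

Lemma intR_scal c f : integrableR f -> intR (fun x => c * f x) = c * intR f.
Proof. by move=> fi; exact: (RintegralZl c measurableT fi). Qed.

Lemma intR_ge0 f : (forall x, 0 <= f x) -> 0 <= intR f.
Proof. by move=> f0; apply: Rintegral_ge0 => x _. Qed.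

Lemma intR_le f g : integrableR f -> integrableR g ->
  (forall x, f x <= g x) -> intR f <= intR g.
Proof. by move=> fi gi fg; apply: (le_Rintegral measurableT fi gi) => x _. Qed.

Lemma integrable_measurable f : integrableR f -> measurable_fun setT f.
Proof. by move=> /measurable_int/measurable_EFinP. Qed.

Lemma integrable_le f g : measurable_fun setT f -> integrableR g ->
  (forall x, `|f x| <= g x) -> integrableR f.
Proof.
move=> mf gi fg; apply: (le_integrable measurableT _ _ gi).
  exact/measurable_EFinP.
by move=> x _ /=; rewrite lee_fin (le_trans (fg x))// ler_norm.
Qed.

Lemma intR_dominated (F : nat -> R -> R) f g :
  (forall n, measurable_fun setT (F n)) -> measurable_fun setT f ->
  integrableR g -> (forall n x, `|F n x| <= g x) ->
  (forall x, F n x @[n --> \oo] --> f x) ->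
  intR (F n) @[n --> \oo] --> intR f.
Proof.
move=> mF mf gi Fg Ff.
have mF' n : measurable_fun setT (EFin \o F n) by exact/measurable_EFinP.
have mf' : measurable_fun setT (EFin \o f) by exact/measurable_EFinP.
have [| |fi _ lim] :=
    @dominated_convergence _ _ _ mu _ measurableT _ _ _ mF' mf' _ gi.
- by apply: aeW => x _; apply/cvg_EFin; [exact: nearW|exact: Ff].
- by apply: aeW => x n _ /=; rewrite lee_fin.
by apply: fine_cvg; rewrite fineK ?integrable_fin_num.
Qed.

End IntegralR.

Section WeightedL2.
Context {R : realType}.
Variables gamma eps : R.
Hypothesis gamma_gt0 : 0 < gamma.
Implicit Types (f g h : R -> R) (c x : R).
Local Notation rho := (rho_inf gamma eps).
Local Notation inL2 := (inL2 gamma eps).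
Local Notation inner := (inner gamma eps).
Local Notation norm2 := (norm2 gamma eps).

Lemma continuous_is_derive f f' : (forall x, is_derive x 1 f (f' x)) ->
  continuous f.
Proof. by move=> df x; exact: is_derive_continuous (df x). Qed.

Lemma continuous_measurable f : continuous f -> measurable_fun setT f.
Proof. exact: continuous_measurable_fun. Qed.

Lemma is_derive_gibbs (x : R) : is_derive x 1 (fun x => expR (- V gamma x /
  eps))
  (- force gamma x / eps * expR (- V gamma x / eps)).
Proof.
have dV := is_derive_scal eps^-1 (is_derive_opp (is_derive_V gamma_gt0 x)).
apply: is_derive_exp; have -> : (fun y => - V gamma y / eps) =
  (fun y => eps^-1 * - V gamma y) by apply/funext => y; rewrite mulrC.
by apply: is_derive_eq dV _; rewrite mulrC.
Qed.

Lemma rho_inf_ge0 (x : R) : 0 <= rho x.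
Proof.
by rewrite mulr_ge0 ?expR_ge0// invr_ge0 intR_ge0// => y; rewrite expR_ge0.
Qed.

Lemma measurable_rho_inf : measurable_fun setT rho.
Proof.
apply: continuous_measurable => x.
exact: is_derive_continuous (is_derive_scal _ (is_derive_gibbs x)).
Qed.

Lemma inL2_integrable_mul f g : inL2 f -> inL2 g ->
  integrableR (fun x => f x * g x * rho x).
Proof.
move=> [mf fi] [mg gi].
apply: (integrable_le _ (integrable_add fi gi)) => [|x].
  by apply: measurable_funM measurable_rho_inf; exact: measurable_funM.
rewrite normrM (ger0_norm (rho_inf_ge0 x)) -mulrDl ler_wpM2r ?rho_inf_ge0//.
have := sqr_ge0 (f x - g x); have := sqr_ge0 (f x + g x).
by case: (ger0P (f x * g x)) => _; nra.
Qed.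

Lemma innerC f g : inner f g = inner g f.
Proof. by rewrite /Defs.inner; under eq_fun do rewrite [f _ * _]mulrC. Qed.

Lemma inner_ge0 f : 0 <= inner f f.
Proof.
by apply: intR_ge0 => x; rewrite mulr_ge0 ?rho_inf_ge0// -expr2 sqr_ge0.
Qed.

Lemma norm2_sqr f : norm2 f ^+ 2 = inner f f.
Proof. by rewrite sqr_sqrtr ?inner_ge0. Qed.

Lemma inL2_add f g : inL2 f -> inL2 g -> inL2 (fun x => f x + g x).
Proof.
move=> fL gL; have [[mf fi] [mg gi]] := (fL, gL).
have mfg : measurable_fun setT (fun x => f x + g x) by exact: measurable_funD.
split=> //; have := integrable_add (integrable_scal 2 fi) (integrable_scal 2
  gi).
move=> /integrable_le; apply.
  by apply: measurable_funM measurable_rho_inf; exact: measurable_funX.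
move=> x; rewrite normrM (ger0_norm (rho_inf_ge0 x)) ger0_norm ?sqr_ge0//.
have -> : 2 * (f x ^+ 2 * rho x) + 2 * (g x ^+ 2 * rho x) =
  (2 * f x ^+ 2 + 2 * g x ^+ 2) * rho x by ring.
rewrite ler_wpM2r ?rho_inf_ge0//.
by have := sqr_ge0 (f x - g x); nra.
Qed.

Lemma inL2_scal c f : inL2 f -> inL2 (fun x => c * f x).
Proof.
move=> [mf fi]; split; first exact: measurable_funM.
have := integrable_scal (c ^+ 2) fi.
by under eq_fun do rewrite mulrA -exprMn.
Qed.

Lemma inL2_sub f g : inL2 f -> inL2 g -> inL2 (fun x => f x - g x).
Proof.
move=> fL /(inL2_scal (-1))/(inL2_add fL).
by under eq_fun do rewrite mulN1r.
Qed.

Lemma inL2_le f g : measurable_fun setT f -> inL2 g ->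
  (forall x, `|f x| <= `|g x|) -> inL2 f.
Proof.
move=> mf [_ gi] fg; split=> //; apply: (integrable_le _ gi) => [|x].
  by apply: measurable_funM measurable_rho_inf; exact: measurable_funX.
rewrite normrM (ger0_norm (rho_inf_ge0 x)) ler_wpM2r ?rho_inf_ge0//.
rewrite ger0_norm ?sqr_ge0// -[f x ^+ 2]real_normK ?num_real//.
by rewrite -[g x ^+ 2]real_normK ?num_real// lerXn2r ?nnegrE.
Qed.

Lemma norm2_le f g : inL2 f -> inL2 g ->
  (forall x, `|f x| <= `|g x|) -> norm2 f <= norm2 g.
Proof.
move=> fL gL fg; rewrite ler_wsqrtr//.
apply: intR_le => [||x]; try exact: inL2_integrable_mul.
rewrite ler_wpM2r ?rho_inf_ge0// -!expr2.
rewrite -[f x ^+ 2]real_normK ?num_real//.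
by rewrite -[g x ^+ 2]real_normK ?num_real// lerXn2r ?nnegrE.
Qed.

Lemma innerDl f g h : inL2 f -> inL2 g -> inL2 h ->
  inner (fun x => f x + g x) h = inner f h + inner g h.
Proof.
move=> fL gL hL; rewrite -intR_add; try exact: inL2_integrable_mul.
by congr intR; apply/funext => x; ring.
Qed.

Lemma innerZl c f h : inL2 f -> inL2 h ->
  inner (fun x => c * f x) h = c * inner f h.
Proof.
move=> fL hL; rewrite -intR_scal; last exact: inL2_integrable_mul.
by congr intR; apply/funext => x; ring.
Qed.

Lemma innerBl f g h : inL2 f -> inL2 g -> inL2 h ->
  inner (fun x => f x - g x) h = inner f h - inner g h.
Proof.
move=> fL gL hL; rewrite -mulN1r -innerZl// -innerDl//; last exact: inL2_scal.
by congr intR; apply/funext => x; ring.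
Qed.

Lemma innerZr c f h : inL2 f -> inL2 h ->
  inner h (fun x => c * f x) = c * inner h f.
Proof. by move=> fL hL; rewrite innerC innerZl// innerC. Qed.

Lemma innerDr f g h : inL2 f -> inL2 g -> inL2 h ->
  inner h (fun x => f x + g x) = inner h f + inner h g.
Proof.
by move=> fL gL hL; rewrite innerC innerDl// innerC [inner g h]innerC.
Qed.

Lemma innerBr f g h : inL2 f -> inL2 g -> inL2 h ->
  inner h (fun x => f x - g x) = inner h f - inner h g.
Proof.
by move=> fL gL hL; rewrite innerC innerBl// innerC [inner g h]innerC.
Qed.

(** The polynomial [c |-> norm2 (c * f - g) ^ 2] is nonnegative; the
    inequality is the sign of its discriminant, and in the degenerate case
    [norm2 f = 0] an affine function of [c] that stays nonnegative must be
    constant. *)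
Lemma cauchy_schwarz f g : inL2 f -> inL2 g ->
  `|inner f g| <= norm2 f * norm2 g.
Proof.
move=> fL gL.
have pos c : 0 <= c ^+ 2 * inner f f - 2 * c * inner f g + inner g g.
  have cL := inL2_scal c fL; have dL := inL2_sub cL gL.
  have := inner_ge0 (fun x => c * f x - g x).
  rewrite innerBl// innerZl// !innerBr// !innerZr// [inner g f]innerC.
  by lra.
have ff := inner_ge0 f; have gg := inner_ge0 g.
rewrite -ler_sqr ?nnegrE ?mulr_ge0 ?sqrtr_ge0// exprMn !norm2_sqr.
rewrite real_normK ?num_real//.
move: (inner f f) (inner f g) (inner g g) ff gg pos => A B C A0 C0 pos.
have [A00|A1] := eqVneq A 0.
  have [->|B0] := eqVneq B 0; first by rewrite expr0n /= mulr_ge0.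
  have := pos ((C + 1) / (2 * B)); rewrite A00.
  have -> : 2 * ((C + 1) / (2 * B)) * B = C + 1 by field.
  by lra.
have := pos (B / A); have -> : (B / A) ^+ 2 * A - 2 * (B / A) * B + C =
  C - B ^+ 2 / A by field.
have Ap : 0 < A by rewrite lt_def A1.
by rewrite subr_ge0 ler_pdivrMr// mulrC.
Qed.

End WeightedL2.

(** * A cut-off function of class C2 *)

Section Cutoff.
Context {R : realType}.
Implicit Types x y r : R.

Lemma continuous_fun_comp (f g : R -> R) : continuous f -> continuous g ->
  continuous (fun x => g (f x)).
Proof. by move=> cf cg x; exact: (continuous_comp (cf x) (cg (f x))). Qed.

Lemma continuous_fun_mul (f g : R -> R) : continuous f -> continuous g ->
  continuous (fun x => f x * g x).
Proof. by move=> cf cg x; exact: (cvgM (cf x) (cg x)). Qed.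

Lemma continuous_fun_add (f g : R -> R) : continuous f -> continuous g ->
  continuous (fun x => f x + g x).
Proof. by move=> cf cg x; exact: (cvgD (cf x) (cg x)). Qed.

Lemma continuous_fun_const (c : R) : continuous (fun _ : R => c : R).
Proof. by move=> x; exact: cvg_cst. Qed.

Definition pos_part y : R := Num.max 0 y.

Lemma pos_part_ge0 y : 0 <= pos_part y.
Proof. by rewrite le_max lexx. Qed.

Lemma pos_part_mul y : pos_part y * y = pos_part y ^+ 2.
Proof.
by rewrite /pos_part; have [y0|y0] := leP 0 y; rewrite expr2// !mul0r.
Qed.

Lemma continuous_pos_part : continuous pos_part.
Proof.
move=> x; apply: continuous_max; [exact: cvg_cst|exact: cvg_id].
Qed.

Lemma is_derive_pos_part_sqr y :
  is_derive y 1 (fun y => pos_part y ^+ 2) (2 * pos_part y).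
Proof.
have [y0|y0|->] := ltgtP y 0.
- rewrite /pos_part (max_idPl (ltW y0)) mulr0.
  apply: near_eq_is_derive (is_derive_const 0 y).
  near=> z; rewrite (max_idPl _) ?expr0n//.
  by near: z; apply: filterS (lt_nbhsl y0) => z /ltW.
- rewrite {2}/pos_part (max_idPr (ltW y0)).
  have dy : is_derive y 1 (fun z => z * z) (2 * y).
    apply: is_derive_eq (is_derive_mul (is_derive_var y) (is_derive_var y)) _.
    by ring.
  apply: near_eq_is_derive dy; near=> z.
  rewrite /pos_part (max_idPr _) ?expr2//.
  by near: z; apply: filterS (lt_nbhsr y0) => z /ltW.
- have p0 : pos_part 0 = 0 by rewrite /pos_part maxxx.
  apply/is_derive1_caratheodory; exists pos_part; split.
  + by move=> z; rewrite subr0 pos_part_mul p0 expr0n subr0.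
  + exact: continuous_pos_part.
  + by rewrite p0 mulr0.
Unshelve. all: end_near. Qed.

(** The cut-off is twice continuously differentiable because the third power of
    the positive part is. *)
Definition cutoff r x : R := pos_part (1 - r * x ^+ 2) ^+ 3.
Definition cutoff1 r x : R :=
  - (6 * r * x) * pos_part (1 - r * x ^+ 2) ^+ 2.
Definition cutoff2 r x : R :=
  24 * r ^+ 2 * x ^+ 2 * pos_part (1 - r * x ^+ 2)
  - 6 * r * pos_part (1 - r * x ^+ 2) ^+ 2.

Lemma is_derive_quadratic r x :
  is_derive x 1 (fun x => 1 - r * x ^+ 2) (- (2 * r * x)).
Proof.
have -> : (fun x => 1 - r * x ^+ 2) = (fun x => 1 - r * (x * x)).
  by apply/funext => z; rewrite expr2.
apply: is_derive_eq (is_derive_sub (is_derive_const 1 x) (is_derive_scal r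
  (is_derive_mul (is_derive_var x) (is_derive_var x)))) _.
by ring.
Qed.

Lemma is_derive_cutoff r x : is_derive x 1 (cutoff r) (cutoff1 r x).
Proof.
have dq := is_derive_quadratic r x.
have dp := @is_derive_comp R (fun y => pos_part y ^+ 2)
  (fun x => 1 - r * x ^+ 2) x _ _ (is_derive_pos_part_sqr _) dq.
have -> : cutoff r =
    (fun x => pos_part (1 - r * x ^+ 2) ^+ 2 * (1 - r * x ^+ 2)).
  apply/funext => z; rewrite /cutoff.
  by rewrite [X in _ = X * _]expr2 -mulrA pos_part_mul -exprS.
apply: is_derive_eq (is_derive_mul dp dq) _.
rewrite /cutoff1; have := pos_part_mul (1 - r * x ^+ 2).
move: (pos_part _) => p pE.
have -> : - (2 * r * x) * (2 * p) * (1 - r * x ^+ 2) =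
  - (4 * r * x) * (p * (1 - r * x ^+ 2)) by ring.
by rewrite pE; ring.
Qed.

Lemma is_derive_cutoff1 r x : is_derive x 1 (cutoff1 r) (cutoff2 r x).
Proof.
have dq := is_derive_quadratic r x.
have dp := @is_derive_comp R (fun y => pos_part y ^+ 2)
  (fun x => 1 - r * x ^+ 2) x _ _ (is_derive_pos_part_sqr _) dq.
apply: is_derive_eq (is_derive_mul (is_derive_opp
  (is_derive_scal (6 * r) (is_derive_var x))) dp) _.
by rewrite /cutoff2; ring.
Qed.

Lemma continuous_cutoff2 r : continuous (cutoff2 r).
Proof.
have cq : continuous (fun x => 1 - r * x ^+ 2).
  exact: continuous_is_derive (is_derive_quadratic r).
have cp := continuous_fun_comp cq continuous_pos_part.
have cc := @continuous_fun_const.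
have csqr : continuous (fun x : R => x ^+ 2) by exact: exprn_continuous.
have -> : cutoff2 r = (fun x => 24 * r ^+ 2 * x ^+ 2 * pos_part (1 - r * x ^+ 2)
    + - (6 * r) * pos_part (1 - r * x ^+ 2) ^+ 2).
  by apply/funext => x; rewrite /cutoff2 mulNr.
apply: continuous_fun_add; apply: continuous_fun_mul => //.
  by apply: continuous_fun_mul.
exact: (continuous_fun_comp cp csqr).
Qed.

Lemma cutoff_support r x : 1 <= r * x ^+ 2 ->
  [/\ cutoff r x = 0, cutoff1 r x = 0 & cutoff2 r x = 0].
Proof.
rewrite -subr_le0 => h.
have p0 : pos_part (1 - r * x ^+ 2) = 0 by apply/max_idPl.
by rewrite /cutoff /cutoff1 /cutoff2 p0 !expr0n /= !mulr0 subr0.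
Qed.

Lemma pos_part_le1 r x : 0 <= r -> pos_part (1 - r * x ^+ 2) <= 1.
Proof. by move=> r0; rewrite ge_max ler01 gerBl mulr_ge0 ?sqr_ge0. Qed.

Lemma cutoff_bounds r x : 0 <= r -> 0 <= cutoff r x <= 1.
Proof.
move=> r0; rewrite exprn_ge0 ?pos_part_ge0//=.
by rewrite exprn_ile1 ?pos_part_ge0 ?pos_part_le1.
Qed.

(** On the support [`|x| <= n]; in the variable [x / n] the derivatives are
    those of a fixed function, divided by [n] and [n ^ 2]. *)
Lemma cutoff_deriv_bounds n x : 1 <= n ->
  `|cutoff1 (n ^- 2) x| <= 6 / n /\ `|cutoff2 (n ^- 2) x| <= 30 / n.
Proof.
move=> n1; have n0 := lt_le_trans ltr01 n1; have ni0 : 0 < n^-1 by rewrite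
  invr_gt0.
have [h|h] := leP 1 (n ^- 2 * x ^+ 2).
  have [_ -> ->] := cutoff_support h.
  by rewrite normr0; split; rewrite mulr_ge0// ltW.
have r0 : 0 <= n ^- 2 by rewrite invr_ge0 exprn_ge0// ltW.
have [p0 p1] := (pos_part_ge0 (1 - n ^- 2 * x ^+ 2), pos_part_le1 x r0).
rewrite /cutoff1 /cutoff2; move: (pos_part _) p0 p1 => p p0 p1.
have -> : n ^- 2 = n^-1 ^+ 2 by rewrite exprVn.
rewrite -exprVn -exprMn in h.
pose y := n^-1 * x; have y1 : `|y| <= 1.
  by rewrite -(expr_le1 (n := 2))// real_normK ?num_real// ltW.
have -> : - (6 * n^-1 ^+ 2 * x) * p ^+ 2 = - (6 * n^-1 * p ^+ 2 * y).
  by rewrite /y; ring.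
have -> : 24 * (n^-1 ^+ 2) ^+ 2 * x ^+ 2 * p - 6 * n^-1 ^+ 2 * p ^+ 2 =
    n^-1 * (n^-1 * (24 * y ^+ 2 * p - 6 * p ^+ 2)) by rewrite /y; ring.
have i1 : n^-1 <= 1 by rewrite invf_le1.
have p2 : 0 <= p ^+ 2 <= 1 by rewrite sqr_ge0 expr_le1.
have y2 : 0 <= y ^+ 2 <= 1 by rewrite sqr_ge0 /= ltW.
split.
  rewrite normrN normrM ger0_norm; last first.
    by case/andP: p2 => p2 _; rewrite !mulr_ge0// ltW.
  rewrite -[leRHS]mulr1 ler_pM//; first by rewrite !mulr_ge0 ?sqr_ge0// ltW.
  by rewrite ler_piMr ?mulr_ge0 ?(ltW ni0)//; case/andP: p2.
rewrite [leRHS]mulrC normrM (gtr0_norm ni0) ler_pM2l// normrM (gtr0_norm ni0).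
rewrite -[leRHS]mul1r ler_pM ?(ltW ni0)//.
by rewrite ler_norml; apply/andP; split; nra.
Qed.

Lemma cutoff_cvg1 x : cutoff (n.+1%:R ^- 2) x @[n --> \oo] --> (1 : R).
Proof.
have h : (n.+1%:R ^- 2 * x ^+ 2 : R) @[n --> \oo] --> (0 : R).
  have h1 : ((n.+1%:R : R)^-1 * x) @[n --> \oo] --> (0 : R).
    by rewrite -[0](mul0r x); apply: cvgM; [exact: cvg_harmonic|exact: cvg_cst].
  rewrite -[0](mulr0 0); apply: cvg_trans (cvgM h1 h1).
  apply: near_eq_cvg; apply: nearW => n /=.
  by rewrite -exprVn; ring.
have cp : (fun y => pos_part (1 - y) ^+ 3) y @[y --> (0 : R)] --> (1 : R).
  have E : pos_part (1 - 0) ^+ 3 = 1 :> R.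
    by rewrite /pos_part subr0 (max_idPr ler01) expr1n.
  have c1 : continuous (fun y : R => 1 - y).
    by move=> y; apply: cvgB; [exact: cvg_cst|exact: cvg_id].
  have c3 : continuous (fun y : R => y ^+ 3) by exact: exprn_continuous.
  have := continuous_fun_comp (continuous_fun_comp c1 continuous_pos_part) c3.
  by move=> /(_ 0); rewrite /continuous_at E.
exact: cvg_comp h cp.
Qed.

End Cutoff.

(** * Decay of the modes of a solution of the Fokker-Planck equation *)

Section FokkerPlanck.
Context {R : realType}.
Variables gamma eps : R.
Hypotheses (gamma_gt0 : 0 < gamma) (gamma_lt1 : gamma < 1) (eps_gt0 : 0 < eps).
Implicit Types x t s e : R.
Local Notation rho_inf := (rho_inf gamma eps).
Local Notation inL2 := (inL2 gamma eps).
Local Notation inner := (inner gamma eps).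
Local Notation norm2 := (norm2 gamma eps).

Hypothesis mass_gt0 : 0 < intR (fun y => expR (- V gamma y / eps)).
Hypothesis one_L2 : inL2 (fun=> 1).

Variables (l K : R) (psi psi1 : R -> R).
Hypotheses (l_ge0 : 0 <= l) (K_ge0 : 0 <= K) (psi_L2 : inL2 psi).
Hypothesis dpsi : forall x, is_derive x 1 psi (psi1 x).
Hypothesis dpsi1 : forall x,
  is_derive x 1 psi1 ((force gamma x * psi1 x - l * psi x) / eps).
Hypothesis psi1_le : forall x, `|psi1 x| <= K * (`|psi x| + 1).

Let r n : R := n.+1%:R ^- 2.
Let phi n x : R := psi x * cutoff (r n) x.
Let phi1 n x : R := psi1 x * cutoff (r n) x + psi x * cutoff1 (r n) x.
Let phi2 n x : R := (force gamma x * psi1 x - l * psi x) / eps * cutoff (r n) x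
  + 2 * (psi1 x * cutoff1 (r n) x) + psi x * cutoff2 (r n) x.
Let rem n x : R := 2 * eps * psi1 x * cutoff1 (r n) x
  + psi x * (eps * cutoff2 (r n) x - force gamma x * cutoff1 (r n) x).

Let dphi n x : is_derive x 1 (phi n) (phi1 n x).
Proof. exact: (is_derive_mul (dpsi x) (is_derive_cutoff (r n) x)). Qed.

Let dphi1 n x : is_derive x 1 (phi1 n) (phi2 n x).
Proof.
apply: is_derive_eq (is_derive_add
  (is_derive_mul (dpsi1 x) (is_derive_cutoff (r n) x))
  (is_derive_mul (dpsi x) (is_derive_cutoff1 (r n) x))) _.
by rewrite /phi2; ring.
Qed.

Let cpsi : continuous psi. Proof. exact: continuous_is_derive dpsi. Qed.
Let cpsi1 : continuous psi1. Proof. exact: continuous_is_derive dpsi1. Qed.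
Let cforce : continuous (force gamma). Proof. exact: continuous_force. Qed.
Let ccut n : continuous (cutoff (r n)).
Proof. exact: continuous_is_derive (is_derive_cutoff (r n)). Qed.
Let ccut1 n : continuous (cutoff1 (r n)).
Proof. exact: continuous_is_derive (is_derive_cutoff1 (r n)). Qed.
Let cconst (c : R) : continuous (fun _ : R => c).
Proof. exact: continuous_fun_const. Qed.

Let cphi2 n : continuous (phi2 n).
Proof.
have -> : phi2 n = (fun x => (eps^-1 * (force gamma x * psi1 x + - l * psi x))
    * cutoff (r n) x + 2 * (psi1 x * cutoff1 (r n) x)
    + psi x * cutoff2 (r n) x).
  by apply/funext => x; rewrite /phi2 mulNr [_ / eps]mulrC.
have cL := continuous_fun_mul (@cconst eps^-1) (continuous_fun_add
  (continuous_fun_mul cforce cpsi1) (continuous_fun_mul (@cconst (- l)) cpsi)).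
exact: (continuous_fun_add (continuous_fun_add
  (continuous_fun_mul cL (@ccut n))
  (continuous_fun_mul (@cconst 2) (continuous_fun_mul cpsi1 (@ccut1 n))))
  (continuous_fun_mul cpsi (@continuous_cutoff2 R (r n)))).
Qed.

Let crem n : continuous (rem n).
Proof.
have -> : rem n = (fun x => 2 * eps * psi1 x * cutoff1 (r n) x
  + psi x * (eps * cutoff2 (r n) x + -1 * (force gamma x * cutoff1 (r n) x))).
  by apply/funext => x; rewrite mulN1r.
exact: (continuous_fun_add
  (continuous_fun_mul (continuous_fun_mul (@cconst (2 * eps)) cpsi1) (@ccut1 n))
  (continuous_fun_mul cpsi (continuous_fun_add
    (continuous_fun_mul (@cconst eps) (@continuous_cutoff2 R (r n)))
    (continuous_fun_mul (@cconst (-1))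
      (continuous_fun_mul cforce (@ccut1 n)))))).
Qed.

Let test_phi n : test_function (phi n).
Proof.
have [d1 D1] := is_derive_derivable (dphi n).
have [d2 D2] := is_derive_derivable (dphi1 n).
split; [exact: d1|by rewrite D1|by rewrite D1 D2; exact: cphi2|].
exists n.+1%:R => x nx; rewrite /phi.
have n0 : 0 < n.+1%:R :> R by rewrite ltr0n.
suff /cutoff_support[-> _ _] : 1 <= r n * x ^+ 2 by rewrite mulr0.
rewrite /r mulrC ler_pdivlMr ?exprn_gt0// mul1r -[leRHS]real_normK ?num_real//.
by rewrite lerXn2r ?nnegrE ?(ltW n0)// ltW.
Qed.

Let gen_phi n x : gen gamma eps (phi n) x = - l * phi n x + rem n x.
Proof.
have [_ D1] := is_derive_derivable (dphi n).
have [_ D2] := is_derive_derivable (dphi1 n).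
rewrite /gen D1 D2 derive1_V// /phi2 /phi1 /phi /rem; field.
by rewrite gt_eqF.
Qed.

(** The commutator of the generator with the cut-off at radius [n.+1] is of
    order [n ^ (gamma - 1)] because the force grows only like [x ^ gamma]. *)
Let rem_small e : 0 < e ->
  \forall n \near \oo, forall x, `|rem n x| <= e * (`|psi x| + 1).
Proof.
move=> e0; pose M := (12 * eps * K + 30 * eps + 6) / e.
have g1 : 0 < 1 - gamma by rewrite subr_gt0.
have [Y Y1 YM] := powR_large g1 M.
near=> n => x; have nY : Y <= n.+1%:R.
  near: n; have [m _ mY] := nbhs_infty_ger Y; exists m => // k mk.
  by rewrite (le_trans (mY k mk))// ler_nat.
pose N : R := n.+1%:R; have N1 : 1 <= N by apply: le_trans nY.
have N0 : 0 < N := lt_le_trans ltr01 N1.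
have [c1 c2] := cutoff_deriv_bounds x N1; rewrite -/(r n) in c1 c2.
have PN1 : 1 <= N `^ gamma by apply: powR_ge1.
have fc1 : `|force gamma x * cutoff1 (r n) x| <= N `^ gamma * (6 / N).
  have [h|h] := leP 1 (r n * x ^+ 2).
    have [_ -> _] := cutoff_support h.
    by rewrite mulr0 normr0 mulr_ge0 ?powR_ge0// divr_ge0// ltW.
  rewrite normrM ler_pM//.
  rewrite norm_force// ge0_ler_powR ?nnegrE ?(ltW gamma_gt0) ?(ltW N0)//.
  move: h; rewrite /r mulrC ltr_pdivrMr ?exprn_gt0// mul1r.
  by rewrite -[x ^+ 2]real_normK ?num_real// => /ltW; rewrite ler_sqr ?nnegrE
    ?(ltW N0).
have small : N `^ gamma * ((12 * eps * K + 30 * eps + 6) / N) <= e.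
  have := YM _ nY; rewrite powR1B// /M -/N.
  rewrite ler_pdivrMr// [leRHS]mulrAC ler_pdivlMr ?powR_gt0// => h.
  by rewrite mulrA ler_pdivrMr// mulrC [leRHS]mulrC.
have psi0 := normr_ge0 (psi x); have e0' := ltW eps_gt0.
pose A := `|psi x| + 1.
have A0 : 0 <= A by rewrite addr_ge0.
have Ni0 : 0 <= N^-1 by rewrite invr_ge0 ltW.
have b1 : `|2 * eps * psi1 x * cutoff1 (r n) x| <= 12 * eps * K * A * N^-1.
  rewrite normrM.
  apply: (@le_trans _ _ (`|2 * eps * psi1 x| * (6 / N))).
    by rewrite ler_wpM2l.
  rewrite !normrM (ger0_norm e0') (ger0_norm (_ : 0 <= 2))//.
  have := psi1_le x; rewrite -/A => pA.
  have -> : 12 * eps * K * A * N^-1 = 2 * eps * (K * A) * (6 / N) by ring.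
  by rewrite ler_wpM2r ?divr_ge0 ?(ltW N0)// ler_wpM2l// mulr_ge0.
have b2 : `|psi x * (eps * cutoff2 (r n) x - force gamma x * cutoff1 (r n) x)|
    <= A * (30 * eps * N^-1 + N `^ gamma * (6 / N)).
  rewrite normrM ler_pM//; first by rewrite /A lerDl.
  rewrite (le_trans (ler_normB _ _))// lerD// normrM (ger0_norm e0').
  have -> : 30 * eps * N^-1 = eps * (30 / N) by ring.
  by rewrite ler_wpM2l.
rewrite (le_trans (ler_normD _ _))// (le_trans (lerD b1 b2))//.
rewrite -/A; apply: le_trans (ler_wpM2r A0 small).
have -> : 12 * eps * K * A * N^-1 + A * (30 * eps * N^-1 + N `^ gamma * (6 /
  N)) =
  (12 * eps * K + 30 * eps + 6 * N `^ gamma) * (A * N^-1) by ring.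
have -> : N `^ gamma * ((12 * eps * K + 30 * eps + 6) / N) * A =
  (N `^ gamma * (12 * eps * K + 30 * eps + 6)) * (A * N^-1) by ring.
rewrite ler_wpM2r ?mulr_ge0//.
have : 0 <= 12 * eps * K + 30 * eps by rewrite addr_ge0 ?mulr_ge0.
by move: (N `^ gamma) PN1 (12 * eps * K + 30 * eps) => *; nra.
Unshelve. all: end_near. Qed.

Variables (init : R -> R) (rho : R -> R -> R).
Hypothesis sol : fokker_planck_solution gamma eps init rho.
Let h t x : R := rho t x / rho_inf x.
Let G n t : R := expR (l * t) * inner (h t) (phi n).

Let rho_inf_neq0 x : rho_inf x != 0.
Proof. by rewrite mulf_neq0 ?invr_neq0 ?gt_eqF ?expR_gt0. Qed.

Let intR_rho t f : intR (fun x => rho t x * f x) = inner (h t) f.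
Proof.
congr intR; apply/funext => x; rewrite /h [RHS]mulrAC divfK//.
Qed.

Let h_L2 t : 0 <= t -> inL2 (h t). Proof. by case: sol => _ + _ _; apply. Qed.

Let phi_L2 n : inL2 (phi n).
Proof.
apply: (inL2_le gamma_gt0 _ psi_L2) => [|x].
  exact: continuous_measurable (continuous_fun_mul cpsi (@ccut n)).
have r0 : 0 <= r n by rewrite /r invr_ge0.
have /andP[c0 c1] := cutoff_bounds x r0.
by rewrite normrM ler_piMr// ger0_norm.
Qed.

Let abs_psi_L2 : inL2 (fun x => `|psi x| + 1).
Proof.
apply: (inL2_add gamma_gt0 _ one_L2).
apply: (inL2_le gamma_gt0 _ psi_L2) => [|x]; last by rewrite normr_id.
exact: measurableT_comp (continuous_measurable cpsi).
Qed.

Let inner_continuous f t : inL2 f -> 0 <= t ->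
  inner (h s) f @[s --> within [set s | 0 <= s] (nbhs t)] --> inner (h t) f.
Proof.
move=> fL t0; case: sol => _ _ /(_ t t0)/cvgrPdist_lt hc _.
apply/cvgrPdist_lt => e e0.
have f1 : 0 < norm2 f + 1 by rewrite ltr_wpDl ?sqrtr_ge0.
have := hc (e / (norm2 f + 1)); rewrite divr_gt0// => /(_ isT).
rewrite !near_withinE; apply: filterS => s + s0 => /(_ s0).
rewrite sub0r normrN ger0_norm ?sqrtr_ge0// => hs.
rewrite distrC -innerBl ?(h_L2 s0) ?(h_L2 t0)//; try exact: h_L2.
have := cauchy_schwarz gamma_gt0 (inL2_sub gamma_gt0 (h_L2 s0) (h_L2 t0)) fL.
move=> /le_lt_trans; apply.
rewrite ltr_pdivlMr// in hs; apply: le_lt_trans hs.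
by rewrite ler_wpM2l ?sqrtr_ge0// lerDl.
Qed.

Let dG n t : 0 < t -> inL2 (rem n) ->
  is_derive t 1 (G n) (expR (l * t) * inner (h t) (rem n)).
Proof.
move=> t0 remL; case: sol => _ _ _ /(_ (phi n) (test_phi n) t t0).
have -> : (fun s => intR (fun x => rho s x * phi n x)) =
  (fun s => inner (h s) (phi n)) by apply/funext => s; rewrite intR_rho.
rewrite intR_rho => dF.
apply: is_derive_eq (is_derive_mul
  (is_derive_exp (is_derive_scal l (is_derive_var t))) dF) _.
have -> : inner (h t) (gen gamma eps (phi n)) =
    inner (h t) (fun x => - l * phi n x + rem n x).
  by congr (inner (h t)); apply/funext => x; rewrite gen_phi.
have htL := h_L2 (ltW t0).
rewrite innerDr//; last exact: inL2_scal.
by rewrite innerZr//; ring.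
Qed.

Let B : R := norm2 (fun x => `|psi x| + 1).

Let rem_norm e : 0 < e ->
  \forall n \near \oo, inL2 (rem n) /\ norm2 (rem n) <= e * B.
Proof.
move=> e0; near=> n.
have small : forall x, `|rem n x| <= e * (`|psi x| + 1).
  by near: n; exact: rem_small.
have le_rem x : `|rem n x| <= `|e * (`|psi x| + 1)|.
  by rewrite [leRHS]ger0_norm ?mulr_ge0 ?(ltW e0).
have eL : inL2 (fun x => e * (`|psi x| + 1)) by exact: inL2_scal.
have remL : inL2 (rem n).
  exact: (inL2_le gamma_gt0 (continuous_measurable (@crem n)) eL le_rem).
split=> //; apply: (le_trans (norm2_le gamma_gt0 remL eL le_rem)).
rewrite -(@ler_sqr _ _ _) ?nnegrE ?mulr_ge0 ?sqrtr_ge0 ?(ltW e0)//.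
rewrite exprMn /B !norm2_sqr// innerZl// innerZr//.
by rewrite expr2 mulrA.
Unshelve. all: end_near. Qed.

Let G_cont f t : inL2 f -> 0 <= t ->
  expR (l * s) * inner (h s) f @[s --> within [set s | 0 <= s] (nbhs t)]
  --> expR (l * t) * inner (h t) f.
Proof.
move=> fL t0; apply: cvgM; last exact: inner_continuous.
apply: cvg_within_filter.
exact: (is_derive_continuous
  (is_derive_exp (is_derive_scal l (is_derive_var t)))).
Qed.

Let G_within f s s' : inL2 f -> 0 <= s ->
  {within `[s, s'], continuous (fun t => expR (l * t) * inner (h t) f)}.
Proof.
move=> fL s0; apply/subspace_continuousP => t; rewrite /= in_itv /= => /andP[st
  _].
apply: cvg_trans (G_cont fL (le_trans s0 st)).
apply: cvg_app; apply: within_subset => x /=.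
by rewrite in_itv /= => /andP[+ _]; apply: le_trans.
Qed.

Let G_lim t : 0 <= t ->
  G n t @[n --> \oo] --> expR (l * t) * inner (h t) psi.
Proof.
move=> t0; apply: cvgM; first exact: cvg_cst.
have hL := h_L2 t0; have hpsi := inL2_integrable_mul gamma_gt0 hL psi_L2.
have hmeas : measurable_fun setT (h t) by case: hL.
apply: (@intR_dominated R _ _ (fun x => `|h t x * psi x * rho_inf x|)).
- move=> n; apply: measurable_funM (measurable_rho_inf _ _) => //.
  apply: measurable_funM => //.
  exact: (continuous_measurable (continuous_fun_mul cpsi (@ccut n))).
- exact: integrable_measurable hpsi.
- exact: integrable_abse hpsi.
- move=> n x; have r0 : 0 <= r n by rewrite /r invr_ge0.
  have /andP[c0 c1] := cutoff_bounds x r0.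
  rewrite [leLHS]normrM [leRHS]normrM; apply: ler_wpM2r => //.
  rewrite [leLHS]normrM [leRHS]normrM; apply: ler_wpM2l => //.
  by rewrite [leLHS]normrM ler_piMr// ger0_norm.
- move=> x; apply: cvgM; last exact: cvg_cst.
  apply: cvgM; first exact: cvg_cst.
  rewrite -[X in _ --> X]mulr1; apply: cvgM; first exact: cvg_cst.
  exact: cutoff_cvg1.
Qed.

Let Gpsi t : R := expR (l * t) * inner (h t) psi.

(** Near each time the norm of the density is bounded, so that the error made
    by the cut-off tends to 0 uniformly and [Gpsi] is locally constant. *)
Let Gpsi_locally_constant t : 0 <= t -> exists2 d : R, 0 < d &
  forall s s', 0 <= s -> s <= s' -> `|s - t| < d -> `|s' - t| < d ->
  Gpsi s = Gpsi s'.
Proof.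
move=> t0; case: (sol) => _ _ /(_ t t0)/cvgrPdist_lt/(_ _ ltr01) + _.
rewrite near_withinE => /nbhs_ballP[d /= d0 hd]; exists d => // s s' s0 ss' sd
  s'd.
have ht1 u : 0 <= u -> `|u - t| < d -> norm2 (fun x => h u x - h t x) < 1.
  move=> u0 ud; have := hd u; rewrite /ball /= distrC => /(_ ud u0).
  by rewrite sub0r normrN ger0_norm ?sqrtr_ge0.
have s'0 := le_trans s0 ss'.
have [->//|sns'] := eqVneq s s'.
have lt_ss' : s < s' by rewrite lt_neqAle sns'.
apply/eqP; rewrite -subr_eq0 -normr_le0; apply/ler_addgt0Pr => e e0.
rewrite add0r.
pose M := expR (l * s') * ((1 + norm2 (h t)) * B) * (s' - s).
have M0 : 0 <= M.
  apply: mulr_ge0; last by rewrite subr_ge0.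
  apply: mulr_ge0; first exact: expR_ge0.
  by apply: mulr_ge0; [apply: addr_ge0|]; rewrite ?sqrtr_ge0.
pose e' := e / (2 * (M + 1)); have e'0 : 0 < e'.
  by rewrite divr_gt0// mulr_gt0// ltr_wpDl.
have lim : G n s - G n s' @[n --> \oo] --> Gpsi s - Gpsi s'.
  by apply: cvgB; exact: G_lim.
have e20 : 0 < e / 2 by rewrite divr_gt0.
have Gn : \forall n \near \oo, `|G n s - G n s'| <= M * e'.
  near=> n; have [remL remB] : inL2 (rem n) /\ norm2 (rem n) <= e' * B.
    by near: n; exact: rem_norm.
  have [|c] := MVT lt_ss' _ (G_within (phi_L2 n) s0)
    (df := fun u => expR (l * u) * inner (h u) (rem n)).
    move=> u; rewrite in_itv /= => /andP[su _].
    by apply: dG => //; exact: le_lt_trans su.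
  rewrite in_itv /= => /andP[sc cs'] Gss'.
  have c0 : 0 <= c by apply: le_trans s0 (ltW sc).
  have ctd : `|c - t| < d.
    by move: sd s'd; rewrite !ltr_norml => /andP[? _] /andP[_ ?]; lra.
  rewrite distrC [`|_|](_ : _ = `|expR (l * c) * inner (h c) (rem n) * (s' -
    s)|);
    last by rewrite -Gss'.
  rewrite !normrM (gtr0_norm (expR_gt0 _)) (gtr0_norm (_ : 0 < s' - s))
    ?subr_gt0//.
  have -> : M * e' = expR (l * s') * ((1 + norm2 (h t)) * (e' * B)) * (s' - s).
    by rewrite /M; ring.
  rewrite ler_wpM2r ?subr_ge0// ler_pM ?expR_ge0//.
    by rewrite ler_expR ler_wpM2l// ltW.
  have htL := h_L2 t0; have hcL := h_L2 c0.
  have -> : inner (h c) (rem n) =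
      inner (fun x => h c x - h t x) (rem n) + inner (h t) (rem n).
    by rewrite innerBl//; ring.
  have hctL := inL2_sub gamma_gt0 hcL htL.
  rewrite (le_trans (ler_normD _ _))//.
  apply: le_trans (lerD (cauchy_schwarz gamma_gt0 hctL remL)
    (cauchy_schwarz gamma_gt0 htL remL)) _.
  by rewrite -mulrDl ler_pM ?addr_ge0 ?sqrtr_ge0// lerD2r ltW// ht1.
move/cvgrPdist_lt/(_ _ e20) : lim => lim.
have [n [hn1 hn2]] := filter_ex (filterI lim Gn).
have Me' : M * e' <= e / 2.
  rewrite /e' mulrCA ler_pM2l// ler_pdivrMr ?mulr_gt0 ?ltr_wpDl//.
  by rewrite mulrA mulVf// mul1r lerDl.
have -> : Gpsi s - Gpsi s' =
  (Gpsi s - Gpsi s' - (G n s - G n s')) + (G n s - G n s') by ring.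
rewrite (le_trans (ler_normD _ _))// [e in leRHS]splitr lerD//; first exact:
  ltW.
exact: le_trans hn2 Me'.
Unshelve. all: end_near. Qed.

(** Testing the equation with the eigenfunction [psi] formally gives
    [d/dt <h, psi> = - l * <h, psi>]. As [psi] has no compact support, the test
    function is [psi * cutoff], and [psi1_le] controls the commutator with the
    generator. *)
Theorem fokker_planck_mode t : 0 <= t ->
  inner (h t) psi = expR (- l * t) * intR (fun x => init x * psi x).
Proof.
move=> t0; suff : Gpsi 0 = Gpsi t.
  rewrite /Gpsi mulr0 expR0 mul1r => /(congr1 (fun z => expR (- l * t) * z)).
  rewrite mulrA -expRD mulNr addNr expR0 mul1r => <-; congr (_ * _).
  rewrite -intR_rho; congr intR; apply/funext => x.
  by case: sol => ->.
move: t0; rewrite le_eqVlt => /predU1P[->//|t0].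
have [u|c _] := MVT t0 _ (G_within psi_L2 (lexx 0)) (df := cst 0).
  rewrite in_itv /= => /andP[u0 _].
  have [d d0 hd] := Gpsi_locally_constant (ltW u0).
  apply: near_eq_is_derive (is_derive_const (Gpsi u) u).
  near=> v; have v0 : 0 < v by near: v; exact: lt_nbhsr.
  have vd : `|v - u| < d.
    near: v; have := @nbhsx_ballx _ R u d d0.
    by apply: filterS => v; rewrite /ball /= distrC.
  have ud : `|u - u| < d by rewrite subrr normr0.
  by have [uv|/ltW vu] := leP u v; [apply: hd|apply/esym; apply: hd] => //;
    exact: ltW.
by rewrite mul0r => /eqP; rewrite subr_eq0 => /eqP.
Unshelve. all: end_near. Qed.

End FokkerPlanck.

(** * Dilations and reflections under the integral *)

Section ChangeOfVariables.
Context {R : realType}.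
Implicit Types (G : R -> R) (s x : R).
Local Notation mu := (@lebesgue_measure R).

Lemma ge0_integrableP G : measurable_fun setT G -> (forall x, 0 <= G x) ->
  integrableR G <-> (\int[mu]_x (G x)%:E < +oo)%E.
Proof.
move=> mG G0.
have GE : (\int[mu]_x (G x)%:E = \int[mu]_x `|(EFin \o G) x|)%E.
  by apply: eq_integral => x _; rewrite /= ger0_norm.
split=> [/integrableP[_]|Goo]; first by rewrite GE.
by apply/integrableP; rewrite -GE; split=> //; exact/measurable_EFinP.
Qed.

Lemma ge0_integral_scale s G : 0 < s -> continuous G -> (forall x, 0 <= G x) ->
  (\int[mu]_x (G x)%:E = \int[mu]_x (s * G (s * x))%:E)%E.
Proof.
move=> s0 cG G0.
have ds x : is_derive x 1 (fun x => s * x) s.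
  apply: is_derive_eq (is_derive_scal s (is_derive_var x)) _.
  by rewrite mulr1.
have [d1 D1] := is_derive_derivable ds.
rewrite (@increasing_ge0_integration_by_substitutionT R (fun x => s * x) G).
- apply: eq_integral => x _; congr (_%:E).
  by rewrite D1 /= mulrC.
- by move=> x y xy; rewrite ltr_pM2l.
- by rewrite D1; exact: continuous_fun_const.
- by rewrite D1; exact: is_cvg_cst.
- by rewrite D1; exact: is_cvg_cst.
- exact: d1.
- exact: gt0_cvgMrNy.
- exact: gt0_cvgMry.
- exact: cG.
- exact: G0.
Qed.

Lemma ge0_integrable_scale s G : 0 < s -> continuous G ->
  (forall x, 0 <= G x) -> integrableR G ->
  integrableR (fun x => G (s * x)) /\ intR G = s * intR (fun x => G (s * x)).
Proof.
move=> s0 cG G0 Gi; have sG0 x : 0 <= s * G (s * x).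
  by rewrite mulr_ge0// ltW.
have csx : continuous (fun x => s * x).
  by apply: continuous_fun_mul; [exact: continuous_fun_const|move=> x; exact:
    cvg_id].
have csG : continuous (fun x => s * G (s * x)).
  apply: continuous_fun_mul; first exact: continuous_fun_const.
  exact: continuous_fun_comp.
have sGi : integrableR (fun x => s * G (s * x)).
  apply/ge0_integrableP => //; first exact: continuous_measurable.
  rewrite -ge0_integral_scale//; apply/ge0_integrableP => //.
  exact: continuous_measurable.
have Gsi : integrableR (fun x => G (s * x)).
  have := integrable_scal s^-1 sGi.
  by under eq_fun do rewrite mulrA mulVf ?gt_eqF// mul1r.
split => //; rewrite -intR_scal//; congr fine.
exact: ge0_integral_scale.
Qed.

(** The reflection exchanges the two half-lines, on each of which the integral
    is finite. *)
Lemma ge0_integrable_reflect G : continuous G -> (forall x, 0 <= G x) ->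
  integrableR G -> integrableR (fun x => G (- x)).
Proof.
move=> cG G0 Gi.
have cN : continuous (fun x => G (- x)).
  by move=> x; apply: continuous_comp; [exact: opp_continuous|exact: cG].
have mG := continuous_measurable cG; have mN := continuous_measurable cN.
have half (F : R -> R) : continuous F -> (forall x, 0 <= F x) ->
    (\int[mu]_(x in `]-oo, 0%R]) (F x)%:E =
     \int[mu]_(x in `[0%R, +oo[) (F (- x)%R)%:E)%E.
  move=> cF F0; rewrite -[in LHS]oppr0 ge0_integration_by_substitutionNy//.
  exact: continuous_subspaceT.
have fin (A : set R) : measurable A -> (\int[mu]_(x in A) (G x)%:E < +oo)%E.
  move=> mA; move/(ge0_integrableP mG G0) : Gi; apply: le_lt_trans.
  apply: ge0_subset_integral => //; first exact/measurable_EFinP.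
  by move=> x _; rewrite lee_fin.
apply/ge0_integrableP => //.
have -> : [set: R] = `]-oo, 0%R] `|` `]0%R, +oo[.
  by rewrite -setCitvl setUv.
rewrite ge0_integral_setU//=; last 3 first.
- by apply/measurable_EFinP; exact: measurable_funS mN.
- by move=> x _; rewrite lee_fin.
- by rewrite -setCitvl; apply/disj_setPCl.
rewrite (half (fun x => G (- x)))//.
under eq_integral do rewrite opprK.
rewrite integral_itv_obnd_cbnd; last first.
  by apply/measurable_EFinP; exact: measurable_funS mN.
by rewrite -half// lte_add_pinfty ?fin.
Qed.

End ChangeOfVariables.

(** * Spectral data: normalisation, scaling and parity *)

Section Spectrum.
Context {R : realType}.
Variable gamma : R.
Hypotheses (gamma_gt0 : 0 < gamma) (gamma_lt1 : gamma < 1).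
Implicit Types (eps l s x y c : R) (u : R -> R) (k j : nat).
Implicit Types (lam : nat -> R) (psi : nat -> R -> R).
Local Notation gibbs eps := (fun x => expR (- V gamma x / eps)).

Lemma continuous_gibbs eps : continuous (gibbs eps).
Proof. exact: continuous_is_derive (is_derive_gibbs eps gamma_gt0). Qed.

(** The value of a divergent [intR] being 0, [rho_inf] would vanish identically
    if the Gibbs weight were not integrable; this is incompatible with the unit
    norm of the constant eigenfunction. *)
Lemma spectral_mass eps lam psi : spectral_decomposition gamma eps lam psi ->
  [/\ 0 < intR (gibbs eps), integrableR (gibbs eps) &
      inL2 gamma eps (fun=> 1)].
Proof.
case=> -[_ psi0] _ _ _ [psiL psiE _].
have psi0E : psi 0%N = fun=> 1 by apply/funext.
have L1 : inL2 gamma eps (fun=> 1) by rewrite -psi0E.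
have Z0 : 0 <= intR (gibbs eps) by apply: intR_ge0 => x; rewrite expR_ge0.
have Zn0 : intR (gibbs eps) != 0.
  apply/eqP => Z; have := psiE 0%N 0%N; rewrite psi0E /inner /rho_inf Z invr0.
  have -> : (fun x => 1 * 1 * (0 * expR (- V gamma x / eps))) = fun=> 0 :> R.
    by apply/funext => x; rewrite mul0r mulr0.
  rewrite /intR Rintegral_cst// mul0r eqxx => /esym/eqP.
  by rewrite oner_eq0.
split=> //; first by rewrite lt_def Zn0.
case: L1 => _ /(integrable_scal (intR (gibbs eps))).
congr integrableR; apply/funext => x.
by rewrite /rho_inf expr1n mul1r mulrA mulfV// mul1r.
Qed.

Lemma eigenfunction_ode eps l u : 0 < eps -> eigenfunction gamma eps l u ->
  (forall x, is_derive x 1 u (derive1 u x)) /\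
  (forall x, is_derive x 1 (derive1 u)
    ((force gamma x * derive1 u x - l * u x) / eps)).
Proof.
move=> eps0 [_ _ du ddu uE]; split; first exact: derivable_is_derive.
move=> x; apply: is_derive_eq (derivable_is_derive ddu x) _.
have := uE x; rewrite /gen derive1_V// => <-; field.
by rewrite gt_eqF.
Qed.

Lemma ode_eigenfunction eps l u (u1 : R -> R) : 0 < eps ->
  inL2 gamma eps u -> (exists x, u x != 0) ->
  (forall x, is_derive x 1 u (u1 x)) ->
  (forall x, is_derive x 1 u1 ((force gamma x * u1 x - l * u x) / eps)) ->
  eigenfunction gamma eps l u.
Proof.
move=> eps0 uL u0 du du1; have [d D] := is_derive_derivable du.
have [d1 D1] := is_derive_derivable du1.
split; [exact: uL|exact: u0|exact: d|by rewrite D|move=> x].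
rewrite /gen D D1 derive1_V//; field.
by rewrite gt_eqF.
Qed.

(** Both the potential and the diffusion are homogeneous, so that the dilation
    by [s] maps the noise intensity [eps1] to [eps1 / s ^ (gamma + 1)]. *)
Lemma eigenfunction_scale eps1 eps2 s l u : 0 < eps2 -> 0 < s ->
  eps1 = eps2 * s `^ (gamma + 1) ->
  0 < intR (gibbs eps1) -> integrableR (gibbs eps1) ->
  eigenfunction gamma eps1 l u ->
  eigenfunction gamma eps2 (l * s `^ (1 - gamma)) (fun x => u (s * x)) /\
  inner gamma eps2 (fun x => u (s * x)) (fun x => u (s * x)) =
  inner gamma eps1 u u.
Proof.
move=> e2 s0 e12 Z1 gi ef.
have Ps := powR_gt0 gamma s0; have P1s := powR_gt0 (gamma + 1) s0.
have e1 : 0 < eps1 by rewrite e12 mulr_gt0.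
have [du du1] := eigenfunction_ode e1 ef.
have gE : (fun x => gibbs eps1 (s * x)) = gibbs eps2.
  apply/funext => x; rewrite V_scale ?(ltW s0)// e12; congr expR; field.
  by rewrite !gt_eqF.
have [_ ZE] := ge0_integrable_scale s0 (@continuous_gibbs eps1)
  (fun x => expR_ge0 _) gi.
rewrite gE in ZE.
have rhoE x : rho_inf gamma eps1 (s * x) = s^-1 * rho_inf gamma eps2 x.
  have := congr1 (fun f => f x) gE => /= gx.
  by rewrite /rho_inf gx ZE invfM mulrA.
pose H x := u x * u x * rho_inf gamma eps1 x.
have cu : continuous u := continuous_is_derive du.
have crho : continuous (rho_inf gamma eps1).
  apply: continuous_fun_mul; first exact: continuous_fun_const.
  exact: continuous_gibbs.
have cH : continuous H.
  by apply: continuous_fun_mul crho; exact: continuous_fun_mul.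
have H0 x : 0 <= H x by rewrite /H -expr2 mulr_ge0 ?sqr_ge0 ?rho_inf_ge0.
have uL : inL2 gamma eps1 u by case: ef.
have Hi : integrableR H := inL2_integrable_mul gamma_gt0 uL uL.
have [Hsi HE] := ge0_integrable_scale s0 cH H0 Hi.
have HsE : (fun x => u (s * x) * u (s * x) * rho_inf gamma eps2 x) =
    (fun x => s * H (s * x)).
  by apply/funext => x; rewrite /H rhoE; field; rewrite gt_eqF.
have csx : continuous (fun x => s * x).
  by apply: continuous_fun_mul; [exact: continuous_fun_const|move=> x; exact:
    cvg_id].
split; last by rewrite [in LHS]/inner HsE intR_scal// -HE.
have dsx x : is_derive x 1 (fun x => s * x) s.
  apply: is_derive_eq (is_derive_scal s (is_derive_var x)) _.
  by rewrite mulr1.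
apply: (ode_eigenfunction (u1 := fun x => s * derive1 u (s * x))) => //.
- split; first exact: continuous_measurable (continuous_fun_comp csx cu).
  have := integrable_scal s Hsi; rewrite -HsE.
  by under eq_fun do rewrite -expr2.
- case: ef => _ [x ux] _ _ _; exists (s^-1 * x).
  by rewrite mulVKf// lt0r_neq0.
- by move=> x; exact: (@is_derive_comp R u (fun x => s * x) x _ _ (du _) (dsx
  x)).
- move=> x; apply: is_derive_eq (is_derive_scal s
    (@is_derive_comp R (derive1 u) (fun x => s * x) x _ _ (du1 _) (dsx x))) _.
  rewrite force_scale// e12 powRD1 ?(ltW s0)// powR1B//; field.
  by rewrite !gt_eqF.
Qed.

Lemma increasing_lt lam : (forall k, lam k < lam k.+1) ->
  {mono lam : j k / (j < k)%N >-> j < k}.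
Proof.
move=> inc; have h : {homo lam : j k / (j < k)%N >-> j < k}.
  by apply: homo_ltn => //; exact: lt_trans.
move=> j k; have [jk|kj] := ltnP j k; first exact: h.
move: kj; rewrite leq_eqVlt => /predU1P[->|/h kj]; first exact: ltxx.
by apply/negbTE; rewrite -leNgt ltW.
Qed.

Lemma increasing_inj lam : (forall k, lam k < lam k.+1) -> injective lam.
Proof.
move=> /increasing_lt inc j k jk; apply/eqP; rewrite eqn_leq.
by rewrite leqNgt -inc jk ltxx leqNgt -inc jk ltxx.
Qed.

(** The dilation matches the spectra as sets; this lemma makes it preserve the
    index of each eigenvalue. *)
Lemma increasing_range_eq (a b : nat -> R) :
  (forall k, a k < a k.+1) -> (forall k, b k < b k.+1) ->
  (forall k, exists j, a k = b j) -> (forall k, exists j, b k = a j) ->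
  forall k, a k = b k.
Proof.
move=> ia ib ab ba; elim/ltn_ind => k IH.
have le (c d : nat -> R) : (forall k, c k < c k.+1) -> (forall k, d k < d k.+1)
  ->
    (forall k, exists j, c k = d j) -> (forall j, (j < k)%N -> c j = d j) ->
    d k <= c k.
  move=> ic id /(_ k)[j ckj] cd; rewrite ckj.
  have [jk|] := ltnP j k.
    by have := increasing_lt ic j k; rewrite jk ckj cd// ltxx.
  rewrite leq_eqVlt => /predU1P[->//|kj].
  by rewrite ltW// increasing_lt.
apply/eqP; rewrite eq_le (le a b) // (le b a) // => j jk.
by rewrite IH.
Qed.

Section Rescaling.
Variables (eps : R) (lam lam' : nat -> R) (psi psi' : nat -> R -> R).
Hypothesis eps_gt0 : 0 < eps.
Hypothesis spec : spectral_decomposition gamma 1 lam psi.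
Hypothesis spec' : spectral_decomposition gamma eps lam' psi'.
Let s := eps `^ (gamma + 1)^-1.

Let s_gt0 : 0 < s. Proof. exact: powR_gt0. Qed.

Let powRs : s `^ (gamma + 1) = eps.
Proof.
rewrite /s -powRrM mulVf ?powRr1 ?ltW//.
by rewrite gt_eqF// addr_gt0.
Qed.

Lemma rescaled_spectrum k : lam' k = lam k / s `^ (1 - gamma).
Proof.
have w0 : 0 < s `^ (1 - gamma) by exact: powR_gt0.
have [Z gi _] := spectral_mass spec; have [Z' gi' _] := spectral_mass spec'.
case: (spec) => _ [inc _] ef all _; case: (spec') => _ [inc' _] ef' all' _.
apply/(canRL (mulfK (lt0r_neq0 w0))).
apply: (@increasing_range_eq (fun k => lam' k * s `^ (1 - gamma)) lam).
- by move=> j; rewrite ltr_pM2r.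
- exact: inc.
- move=> j; have [] := eigenfunction_scale ltr01 s_gt0 _ Z' gi' (ef' j).
    by rewrite mul1r powRs.
  by move=> /all[i [-> _]] _; exists i.
- move=> j; have si0 : 0 < s^-1 by rewrite invr_gt0.
  have [] := eigenfunction_scale eps_gt0 si0 _ Z gi (ef j).
    by rewrite -powR_inv1 ?(ltW s_gt0)// powRAC powRs powR_inv1 ?(ltW
      eps_gt0)// mulfV// gt_eqF.
  move=> /all'[i [liE _]] _; exists i; rewrite -liE.
  rewrite -powR_inv1 ?(ltW s_gt0)// powRAC powR_inv1 ?(ltW w0)//.
  by rewrite divfK// gt_eqF.
Qed.

Lemma rescaled_eigenfunction k :
  exists2 c : R, c ^+ 2 = 1 & forall x, psi' k x = c * psi k (x / s).
Proof.
have [Z' gi' _] := spectral_mass spec'.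
case: (spec) => _ [inc _] ef all [psiL psiE _].
case: (spec') => _ [inc' _] ef' all' [_ psiE' _].
have [] := eigenfunction_scale ltr01 s_gt0 _ Z' gi' (ef' k).
  by rewrite mul1r powRs.
have w0 : s `^ (1 - gamma) != 0 by rewrite gt_eqF ?powR_gt0.
rewrite rescaled_spectrum divfK// psiE' eqxx.
move=> /all[j [/(increasing_inj inc) <- [c cE]]].
have -> : (fun x => psi' k (s * x)) = (fun x => c * psi k x) by apply/funext.
rewrite innerZl//; last exact: inL2_scal.
rewrite innerZr// psiE eqxx mulr1 => cc; exists c; first by rewrite expr2.
by move=> x; rewrite -cE mulrC divfK// gt_eqF.
Qed.

End Rescaling.

(** The reflected eigenfunction belongs to the same simple eigenvalue, hence
    is a multiple [c] of the original one, and reflecting twice gives [c ^ 2 =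
    1]. *)
Lemma eigenfunction_parity lam psi k :
  spectral_decomposition gamma 1 lam psi ->
  exists2 c : R, c ^+ 2 = 1 & forall x, psi k (- x) = c * psi k x.
Proof.
move=> spec; case: (spec) => _ [inc _] ef all [psiL _ _].
have [du du1] := eigenfunction_ode ltr01 (ef k).
have dN x : is_derive x 1 (fun x => - x) (- 1).
  exact: is_derive_opp (is_derive_var x).
have cN : continuous (fun x : R => - x) by exact: opp_continuous.
have cu : continuous (psi k) := continuous_is_derive du.
have rhoN x : rho_inf gamma 1 (- x) = rho_inf gamma 1 x.
  by rewrite /rho_inf VN.
have crho : continuous (rho_inf gamma 1).
  apply: continuous_fun_mul; first exact: continuous_fun_const.
  exact: continuous_gibbs.
have ec : eigenfunction gamma 1 (lam k) (fun x => psi k (- x)).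
  apply: (ode_eigenfunction (u1 := fun x => - derive1 (psi k) (- x))) => //.
  - split; first exact: continuous_measurable (continuous_fun_comp cN cu).
    have := @ge0_integrable_reflect R
      (fun x => psi k x * psi k x * rho_inf gamma 1 x) _ _
      (inL2_integrable_mul gamma_gt0 (psiL k) (psiL k)).
    under [X in _ -> _ -> integrableR X]eq_fun do rewrite rhoN -expr2.
    apply; first by apply: continuous_fun_mul crho; exact: continuous_fun_mul.
    by move=> x; rewrite -expr2 mulr_ge0 ?sqr_ge0 ?rho_inf_ge0.
  - case: (ef k) => _ [x ux] _ _ _; exists (- x).
    by rewrite opprK.
  - move=> x; apply: is_derive_eq
      (@is_derive_comp R (psi k) (fun x => - x) x _ _ (du _) (dN x)) _.
    by rewrite mulN1r.
  - move=> x; apply: is_derive_eq (is_derive_opp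
      (@is_derive_comp R (derive1 (psi k)) (fun x => - x) x _ _ (du1 _) (dN
        x))) _.
    by rewrite forceN; ring.
have [j [/(increasing_inj inc) <- [c cE]]] := all _ _ ec.
exists c => //; case: (ef k) => _ [x ux] _ _ _.
have := cE (- x); rewrite opprK cE mulrA => /eqP.
rewrite -subr_eq0 -{1}[psi k x]mul1r -mulrBl mulf_eq0 (negbTE ux) orbF subr_eq0.
by move=> /eqP; rewrite expr2 => <-.
Qed.

End Spectrum.

(** * Averages over intervals *)

Section Averages.
Context {R : realType}.
Implicit Types (f F H : R -> R) (a b c x y delta : R).
Local Notation mu := (@lebesgue_measure R).

Lemma continuous_integrable_itv f a b : continuous f ->
  mu.-integrable `[a, b] (EFin \o f).
Proof.
move=> cf; apply: continuous_compact_integrable; first exact: segment_compact.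
exact: continuous_subspaceT.
Qed.

Lemma is_derive_integral f a x : continuous f -> a < x ->
  is_derive x 1 (fun y => \int[mu]_(t in `[a, y]) f t)%R (f x).
Proof.
move=> cf ax; have xx1 : x < x + 1 by rewrite ltrDl.
have [|dF <-] := @continuous_FTC1 R f (BLeft a) x (x + 1) xx1
  (continuous_integrable_itv a (x + 1) cf) _ (cf x).
  by rewrite /= lte_fin.
by rewrite derive1E; exact/derivableP.
Qed.

(** The integrals from a base point [a] are antiderivatives on [a, +oo) only;
    normalised at 0 they no longer depend on [a] and glue to the whole line. *)
Lemma exists_antiderivative f : continuous f ->
  exists H, forall x, is_derive x 1 H (f x).
Proof.
move=> cf; pose F a x : R := (\int[mu]_(t in `[a, x]) f t)%R.
have dF a x : a < x -> is_derive x 1 (F a) (f x).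
  by move=> ax; exact: is_derive_integral.
have indep a b x : a < 0 -> b < 0 -> a < x -> b < x ->
    F a x - F a 0 = F b x - F b 0.
  move=> a0 b0 ax bx.
  suff : F a x - F b x = F a 0 - F b 0 by move: (F _ _) (F _ _) (F _ _) (F _ _)
    => *; lra.
  have dFF y : a < y -> b < y -> is_derive y 1 (fun y => F a y - F b y) 0.
    move=> ay yb; apply: is_derive_eq (is_derive_sub (dF a y ay) (dF b y yb)) _.
    by rewrite subrr.
  have [x0|x0] := leP x 0.
    apply: (@constant_of_derive R (fun y => F a y - F b y) _ _ x0) => y
      /andP[xy _].
    by apply: dFF; apply: lt_le_trans xy.
  apply/esym.
  apply: (@constant_of_derive R (fun y => F a y - F b y) _ _ (ltW x0)).
  move=> y /andP[y0 _].
  by apply: dFF; apply: lt_le_trans y0.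
exists (fun x => F (- `|x| - 1) x - F (- `|x| - 1) 0) => x.
pose a := - `|x| - 2.
have ax : a < x by rewrite /a; have := lerNnormlW (lexx `|x|); lra.
have a0 : a < 0 by rewrite /a; have := normr_ge0 x; lra.
apply: (@near_eq_is_derive _ _ _ (fun y => F a y - F a 0)); last first.
  apply: is_derive_eq (is_derive_sub (dF a x ax) (is_derive_const _ x)) _.
  by rewrite subr0.
suff near_x (y : R) : `|x - y| < 1 ->
    F a y - F a 0 = F (- `|y| - 1) y - F (- `|y| - 1) 0.
  by have := @nbhsx_ballx _ R x 1 ltr01; apply: filterS => y; exact: near_x.
move=> xy; have hx : - `|x| <= x := lerNnormlW (lexx _).
have hy : - `|y| <= y := lerNnormlW (lexx _); have y0 := normr_ge0 y.
move: xy; rewrite ltr_norml => /andP[xy1 xy2].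
by apply: indep => //; rewrite /a; lra.
Qed.

Lemma average_antiderivative f H delta x0 : 0 < delta -> continuous f ->
  (forall x, is_derive x 1 H (f x)) ->
  intR (fun x => rho0 delta x0 x * f x) =
  (2 * delta)^-1 * (H (x0 + delta) - H (x0 - delta)).
Proof.
move=> d0 cf dH; have ab : x0 - delta < x0 + delta by lra.
pose A := `]x0 - delta, x0 + delta[%classic : set R.
have -> : (fun x => rho0 delta x0 x * f x) =
    (fun x => (2 * delta)^-1 * (f \_ A) x).
  apply/funext => x; rewrite /rho0 -mulrA; congr (_ * _).
  by rewrite patchE indicE; case: ifPn => _; rewrite ?mul1r ?mul0r.
have [M M0 fM] := continuous_bounded (x0 - delta) (x0 + delta) cf.
have fAi : integrableR (f \_ A).
  have Ai := integrable_indic_itv (x0 - delta) (x0 + delta) false true.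
  apply: (integrable_le _ (integrable_scal M Ai)) => [|x].
    apply/(measurable_restrictT _ _).1; first exact: measurable_itv.
    exact: measurable_funTS (continuous_measurable cf).
  rewrite patchE indicE; case: ifPn => xA; last by rewrite normr0 mulr0.
  rewrite mulr1; apply: fM; move: xA; rewrite inE /A /= in_itv /=.
  by move=> /andP[/ltW-> /ltW->].
rewrite intR_scal//; congr (_ * _).
have -> : intR (fun x => (f \_ A) x) = (\int[mu]_(x in A) f x)%R.
  by rewrite [RHS]Rintegral_mkcond.
rewrite /Rintegral -(@integral_itv_bndoo R _ _ _ true false); last first.
  by apply/measurable_EFinP; exact: measurable_funTS (continuous_measurable cf).
have cH : continuous H := continuous_is_derive dH.
have [dH' DH] := is_derive_derivable dH.
rewrite (@continuous_FTC2 R f H)//; first exact: continuous_subspaceT.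
- split; first by move=> x _; exact: dH'.
  + exact: cvg_at_right_filter (cH _).
  + exact: cvg_at_left_filter (cH _).
- by move=> x _; rewrite DH.
Qed.

Lemma average_mean_value f H delta x0 : 0 < delta -> continuous f ->
  (forall x, is_derive x 1 H (f x)) ->
  exists2 c, `|c - x0| < delta & intR (fun x => rho0 delta x0 x * f x) = f c.
Proof.
move=> d0 cf dH; have ab : x0 - delta < x0 + delta by lra.
have [c /andP[ac cb] Hc] := mean_value ab (fun x _ => dH x).
exists c; first by rewrite ltr_norml; apply/andP; split; lra.
rewrite (average_antiderivative _ d0 cf dH) Hc.
by field; rewrite gt_eqF.
Qed.

End Averages.

(** * Parity and growth of the normalised eigenfunctions *)

Section SpectralGrowth.
Context {R : realType}.
Variable gamma : R.
Hypotheses (gamma_gt0 : 0 < gamma) (gamma_lt1 : gamma < 1).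
Hypothesis gamma_gt3 : 3^-1 < gamma.
Implicit Types (x y c : R).
Variables (lam : nat -> R) (psi : nat -> R -> R).
Hypothesis spec : spectral_decomposition gamma 1 lam psi.

Let dpsi k x : is_derive x 1 (psi k) (derive1 (psi k) x).
Proof. by case: spec => _ _ /(_ k)/(eigenfunction_ode gamma_gt0 ltr01)[]. Qed.

Let dpsi1 k x : is_derive x 1 (derive1 (psi k))
  (force gamma x * derive1 (psi k) x - lam k * psi k x).
Proof.
case: spec => _ _ /(_ k)/(eigenfunction_ode gamma_gt0 ltr01)[_ + _ _].
by move=> /(_ x); rewrite divr1.
Qed.

Lemma eigenvalue_gt0 k : (0 < k)%N -> 0 < lam k.
Proof.
by case: spec => -[<- _] [inc _] _ _ _; rewrite (increasing_lt inc).
Qed.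

Lemma even_of_neq0 k : psi k 0 != 0 -> forall x, psi k (- x) = psi k x.
Proof.
move=> p0 x; have [c _ cE] := eigenfunction_parity gamma_gt0 k spec.
have := cE 0; rewrite oppr0 cE => /eqP.
rewrite -subr_eq0 -{1}[psi k 0]mul1r -mulrBl mulf_eq0 (negbTE p0) orbF.
by rewrite subr_eq0 => /eqP <-; rewrite mul1r.
Qed.

Lemma derive1_reflect k x c : (forall x, psi k (- x) = c * psi k x) ->
  derive1 (psi k) (- x) = - c * derive1 (psi k) x.
Proof.
move=> cE; have dN : is_derive x 1 (fun x => - x) (- 1).
  exact: is_derive_opp (is_derive_var x).
have d1 := @is_derive_comp R (psi k) (fun x => - x) x _ _ (dpsi k (- x)) dN.
have d2 := is_derive_scal c (dpsi k x).
have fE : (fun x => psi k (- x)) = (fun x => c * psi k x) by apply/funext.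
rewrite fE in d1; case: d1 d2 => _ d1 [_]; rewrite d1 => h.
by rewrite mulNr -h; ring.
Qed.

(** An even eigenfunction that vanishes at 0 has a double zero there and is
    identically 0 by uniqueness for the differential equation. *)
Lemma odd_of_eq0 k : psi k 0 = 0 -> forall x, psi k (- x) = - psi k x.
Proof.
move=> p0 x; have [c c1 cE] := eigenfunction_parity gamma_gt0 k spec.
rewrite cE; move: c1 => /eqP; rewrite sqrf_eq1 => /orP[] /eqP cc; last first.
  by rewrite cc mulN1r.
have d0 : derive1 (psi k) 0 = 0.
  have := @derive1_reflect k 0 c cE; rewrite oppr0 cc mulN1r.
  by move: (derive1 _ _) => *; lra.
have := linear_ode_unique (continuous_force gamma_gt0) (dpsi k) (dpsi1 k) p0 d0.
by move=> p; rewrite !p mulr0 oppr0.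
Qed.

Lemma spectral_growth k : (0 < k)%N -> exists Y c C s : R,
  [/\ 1 <= Y, 0 < c, 0 < C, s ^+ 2 = 1 & forall y, Y <= y ->
    [/\ c * expR (lam k * phase gamma y) <= s * psi k y,
        s * psi k y <= C * expR (lam k * phase gamma y) &
        `|derive1 (psi k) y| <= 2 * lam k * `|psi k y| ]].
Proof.
move=> k0; have l0 := eigenvalue_gt0 k0.
have [Z0 _ _] := spectral_mass spec.
case: (spec) => _ _ /(_ k)[[_ uL] u0 _ _ _] _ _.
apply: (eigenfunction_growth gamma_gt0 gamma_lt1 l0 (dpsi k)
  (fun x => dpsi1 k x) u0 _ gamma_gt3).
move: uL => /(integrable_scal (intR (fun y => expR (- V gamma y / 1)))).
congr integrableR; apply/funext => x; rewrite /rho_inf mulrCA !mulrA.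
by rewrite divr1 -mulrA -[RHS]mulr1; field; rewrite gt_eqF.
Qed.

(** The same bounds on the negative half-line, by parity. *)
Lemma spectral_growth_side k b : (0 < k)%N -> b ^+ 2 = 1 -> exists Y c C s : R,
  [/\ 1 <= Y, 0 < c, 0 < C, s ^+ 2 = 1 & forall y, Y <= y ->
    c * expR (lam k * phase gamma y) <= s * psi k (b * y) <=
    C * expR (lam k * phase gamma y)].
Proof.
move=> k0 b1; have [Y [c [C [s [Y1 c0 C0 s1 uY]]]]] := spectral_growth k0.
have [e e1 eE] := eigenfunction_parity gamma_gt0 k spec.
move: b1 => /eqP; rewrite sqrf_eq1 => /orP[] /eqP->.
  exists Y, c, C, s; split => // y Yy; rewrite mul1r.
  by have [-> -> _] := uY y Yy.
exists Y, c, C, (s * e); split => // [|y Yy]; first by rewrite exprMn s1 e1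
  mulr1.
rewrite mulN1r eE -mulrA [e * (_ * _)]mulrA -expr2 e1 mul1r.
by have [-> -> _] := uY y Yy.
Qed.

(** Far out the growth estimate bounds the derivative by the function itself;
    the additive 1 covers the zeros in the remaining compact set. *)
Lemma eigenfunction_derivative_bound k : exists2 K : R, 0 <= K &
  forall x, `|derive1 (psi k) x| <= K * (`|psi k x| + 1).
Proof.
have [->|k0] := eqVneq k 0%N.
  exists 0 => // x; case: spec => -[_ p0] _ _ _ _.
  have -> : psi 0%N = cst 1 by apply/funext.
  by rewrite derive1_cst normr0 mul0r.
rewrite -lt0n in k0; have l0 := eigenvalue_gt0 k0.
have [Y [c [C [s [Y1 c0 C0 s1 uY]]]]] := spectral_growth k0.
have [e e1 eE] := eigenfunction_parity gamma_gt0 k spec.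
have cd : continuous (derive1 (psi k)) := continuous_is_derive (dpsi1 k).
have [M M0 dM] := continuous_bounded (- Y) Y cd.
exists (2 * lam k + M) => [|x]; first by rewrite addr_ge0// mulr_ge0// ltW.
have p0 := normr_ge0 (psi k x).
have side y : Y <= y -> `|derive1 (psi k) y| <= 2 * lam k * `|psi k y|.
  by move=> /uY[].
have goal : `|derive1 (psi k) x| <= 2 * lam k * `|psi k x| ->
    `|derive1 (psi k) x| <= (2 * lam k + M) * (`|psi k x| + 1).
  by move=> h; nra.
have [xY|/ltW Yx] := leP x Y; last by apply: goal; exact: side.
have [Yx|/ltW xY'] := leP (- Y) x.
  by have := dM x; rewrite Yx xY => /(_ isT); nra.
apply: goal; have := side (- x); rewrite lerNr => /(_ xY').
rewrite eE (derive1_reflect x eE) !normrM normrN (norm_of_sqr1 e1).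
by rewrite !mul1r.
Qed.

(** For an even eigenfunction the symmetric integral has derivative
    [2 * psi L], of the order of the derivative of
    [L ^ gamma * exp (lam * phase L)]. *)
Lemma even_integral_growth k (H : R -> R) : (0 < k)%N -> psi k 0 != 0 ->
  (forall x, is_derive x 1 H (psi k x)) ->
  exists Y c C : R, [/\ 1 <= Y, 0 < c, 0 < C & forall y, Y <= y ->
    c * (y `^ gamma * expR (lam k * phase gamma y)) <= `|H y - H (- y)| <=
    C * (y `^ gamma * expR (lam k * phase gamma y))].
Proof.
move=> k0 p0 dH; have even := even_of_neq0 p0; have l0 := eigenvalue_gt0 k0.
have [Y [c [C [s [Y1 c0 C0 s1 uY]]]]] := spectral_growth k0.
set l := lam k in l0 uY *.
pose I y : R := s * (H y - H (- y)).
pose J y : R := y `^ gamma * expR (l * phase gamma y).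
have dI y : is_derive y 1 I (2 * (s * psi k y)).
  have dN : is_derive y 1 (fun x => - x) (- 1).
    exact: is_derive_opp (is_derive_var y).
  apply: is_derive_eq (is_derive_scal s (is_derive_sub (dH y)
    (@is_derive_comp R H (fun x => - x) y _ _ (dH (- y)) dN))) _.
  by rewrite even; ring.
have dJ y : 0 < y -> is_derive y 1 J
    ((l + gamma * y `^ gamma / y) * expR (l * phase gamma y)).
  move=> y0; have Py := powR_gt0 gamma y0.
  apply: is_derive_eq (is_derive_mul (is_derive_power gamma y0)
    (is_derive_exp (is_derive_scal l (is_derive_phase gamma_lt1 y0)))) _.
  by field; rewrite !gt_eqF.
have Ypos y : Y <= y -> [/\ 1 <= y, 0 < y & 0 <= gamma * y `^ gamma / y <=
  gamma].
  move=> Yy; have y1 := le_trans Y1 Yy; have y0 := lt_le_trans ltr01 y1.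
  split=> //; rewrite divr_ge0 ?mulr_ge0 ?powR_ge0 ?(ltW gamma_gt0) ?(ltW
    y0)//=.
  by rewrite ler_pdivrMr// ler_pM2l// powR_le_id.
pose E y : R := expR (l * phase gamma y).
have E0 y : 0 < E y by exact: expR_gt0.
have JY0 : 0 < J Y.
  by rewrite mulr_gt0 ?E0// powR_gt0//; case: (Ypos Y (lexx _)).
have Jmono y : Y <= y -> J Y <= J y.
  move=> Yy; apply: (@nondecreasing_of_derive R J _ _ _ Yy) => z /andP[Yz _];
    have [z1 z0 /andP[g1 g2]] := Ypos z Yz; first exact: dJ.
  by rewrite mulr_ge0 ?expR_ge0// addr_ge0// ltW.
pose c1 := 2 * c / (l + gamma); pose C1 := 2 * C / l.
have lg0 : 0 < l + gamma by rewrite addr_gt0.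
have c10 : 0 < c1 by rewrite divr_gt0// mulr_gt0.
have C10 : 0 < C1 by rewrite divr_gt0// mulr_gt0.
have lo y : Y <= y -> I Y - c1 * J Y <= I y - c1 * J y.
  move=> Yy; apply: (@nondecreasing_of_derive R (fun y => I y - c1 * J y)
    (fun y => 2 * (s * psi k y) - c1 * ((l + gamma * y `^ gamma / y) * E y))
    _ _ Yy) => z /andP[Yz _]; have [z1 z0 /andP[g1 g2]] := Ypos z Yz.
    exact: (is_derive_sub (dI z) (is_derive_scal c1 (dJ z z0))).
  have [h _ _] := uY z Yz; rewrite subr_ge0.
  apply: (@le_trans _ _ (2 * (c * E z))); last by rewrite ler_pM2l.
  have -> : 2 * (c * E z) = c1 * ((l + gamma) * E z).
    by rewrite /c1; field; rewrite gt_eqF.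
  apply: ler_wpM2l; first exact: ltW.
  by apply: ler_wpM2r; [exact: ltW|rewrite lerD2l].
have hi y : Y <= y -> C1 * J Y - I Y <= C1 * J y - I y.
  move=> Yy; apply: (@nondecreasing_of_derive R (fun y => C1 * J y - I y)
    (fun y => C1 * ((l + gamma * y `^ gamma / y) * E y) - 2 * (s * psi k y))
    _ _ Yy) => z /andP[Yz _]; have [z1 z0 /andP[g1 g2]] := Ypos z Yz.
    exact: (is_derive_sub (is_derive_scal C1 (dJ z z0)) (dI z)).
  have [_ h _] := uY z Yz; rewrite subr_ge0.
  apply: (@le_trans _ _ (2 * (C * E z))); first by rewrite ler_pM2l.
  have -> : 2 * (C * E z) = C1 * (l * E z).
    by rewrite /C1; field; rewrite gt_eqF.
  apply: ler_wpM2l; first exact: ltW.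
  by apply: ler_wpM2r; [exact: ltW|rewrite lerDl].
have IE y : `|H y - H (- y)| = `|I y| by rewrite normrM (norm_of_sqr1 s1) mul1r.
have JE y : J y = y `^ gamma * expR (l * phase gamma y) by [].
clearbody I J.
pose D := `|I Y| + c1 * J Y.
have D0 : 0 <= D by rewrite addr_ge0// mulr_ge0// ltW.
have [Y2 Y21 Y2P] := powR_large gamma_gt0 (2 * D / c1).
exists (Num.max Y Y2), (c1 / 2), (C1 + `|I Y| / J Y); split.
- by rewrite le_max Y1.
- by rewrite divr_gt0.
- by rewrite ltr_wpDr// divr_ge0// ltW.
move=> y; rewrite ge_max => /andP[Yy Y2y].
rewrite IE -JE; have [y1 y0 _] := Ypos y Yy.
have JD : D <= c1 / 2 * J y.
  have h : 2 * D / c1 <= J y.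
    apply: (le_trans (Y2P y Y2y)); rewrite JE ler_peMr ?powR_ge0//.
    rewrite -expR0 ler_expR mulr_ge0 ?(ltW l0)// mulr_ge0 ?powR_ge0//.
    by rewrite invr_ge0 subr_ge0 ltW.
  by move: h; rewrite ler_pdivrMr//; move: (J y) => *; lra.
have hlo : c1 / 2 * J y <= I y.
  have := lo y Yy; have : - `|I Y| <= I Y := lerNnormlW (lexx _).
  by move: JD; rewrite /D; move: (J y) (I y) (I Y) (J Y) => *; lra.
have Jy0 : 0 <= J y := le_trans (ltW JY0) (Jmono y Yy).
have c120 : 0 <= c1 / 2 by rewrite ltW// divr_gt0.
rewrite ger0_norm; last exact: le_trans (mulr_ge0 c120 Jy0) hlo.
rewrite hlo /= mulrDl; have := hi y Yy.
have IY : I Y <= `|I Y| := ler_norm _.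
have IJ : `|I Y| <= `|I Y| / J Y * J y.
  rewrite -[leLHS](divfK (lt0r_neq0 JY0)); apply: ler_wpM2l (Jmono y Yy).
  exact: divr_ge0 (normr_ge0 _) (ltW JY0).
move: (mulr_gt0 C10 JY0) IJ IY; move: (`|I Y| / J Y * J y) (C1 * J y) (C1 * J
  Y).
by move: (`|I Y|) (I Y) (I y); clear; move=> *; lra.
Qed.

End SpectralGrowth.

(** * Criteria for window and profile cut-off *)

Section CutoffCriterion.
Context {R : realType}.
Implicit Types (r t eps : R) (k m n : nat).

Lemma limf_einf_ge (T : choiceType) (X : filteredType T) (f : X -> \bar R)
    (F : set_system X) (x : \bar R) :
  (\forall z \near F, x <= f z)%E -> (x <= limf_einf f F)%E.
Proof.
move=> Ff; rewrite limf_einfE.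
apply: (@le_trans _ _ (ereal_inf (f @` [set z | (x <= f z)%E]))).
  by apply: le_ereal_inf_tmp => _ [z xz <-].
by apply: ereal_sup_ubound; exists [set z | (x <= f z)%E].
Qed.

Lemma limf_esup_le (T : choiceType) (X : filteredType T) (f : X -> \bar R)
    (F : set_system X) (x : \bar R) :
  (\forall z \near F, f z <= x)%E -> (limf_esup f F <= x)%E.
Proof.
move=> Ff; rewrite limf_esupE.
apply: (@le_trans _ _ (ereal_sup (f @` [set z | (f z <= x)%E]))).
  by apply: ereal_inf_lbound; exists [set z | (f z <= x)%E].
by apply: ge_ereal_sup => _ [z xz <-].
Qed.

Lemma near_forall_lt (T : Type) (F : set_system T) (FF : Filter F)
    (P : nat -> T -> Prop) n :
  (forall k, (k < n)%N -> \forall x \near F, P k x) ->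
  \forall x \near F, forall k, (k < n)%N -> P k x.
Proof.
elim: n => [|n IH] h; first by apply: nearW => x k.
have h1 := IH (fun k kn => h k (ltnW kn)); have h2 := h n (ltnSn n).
apply: filterS2 h1 h2 => x h1 h2 k; rewrite ltnS leq_eqVlt.
by move=> /predU1P[->//|]; exact: h1.
Qed.

Variables (d : R -> R -> R) (w : R -> R) (L : nat -> R) (a : nat -> R -> R).
Variables (n m : nat).
Hypothesis d_ge0 : forall eps t, 0 <= d eps t.
Hypothesis m_range : (0 < m <= n)%N.
Hypothesis L_gt0 : forall k, (0 < k)%N -> 0 < L k.
Hypothesis L_ge1 : forall k, (0 < k)%N -> L 1 <= L k.
Hypothesis w_gt0 : \forall eps \near (0 : R)^'+, 0 < w eps.
Hypothesis am_infty : `|a m eps| @[eps --> (0 : R)^'+] --> +oo.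
Hypothesis dE : \forall eps \near (0 : R)^'+, forall t, 0 <= t ->
  d eps t =
  Num.sqrt (\sum_(i < n) (expR (- (L i.+1 / w eps) * t) * a i.+1 eps) ^+ 2).

(** The time at which the mode [m] has size 1, and the size of the mode [k] at
    that time, namely [a k * `|a m| ^ (- L k / L m)]. *)
Definition cutoff_time eps := w eps / L m * ln `|a m eps|.

Definition relative_mode k eps := a k eps * expR (- (L k / L m) * ln `|a m
  eps|).

Let Lm_gt0 : 0 < L m. Proof. by apply: L_gt0; case/andP: m_range. Qed.

Lemma ln_mode_infty A : \forall eps \near (0 : R)^'+, A <= ln `|a m eps|.
Proof.
move/cvgryPge/(_ (expR A)) : am_infty; apply: filterS => eps h.
by rewrite -(expRK A) ler_ln ?posrE ?expR_gt0// (lt_le_trans (expR_gt0 A)).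
Qed.

(** Measured from the cut-off time in units of [w eps], the [k]-th mode is
    [relative_mode k eps] at [r = 0] and decays at the fixed rate [L k]. *)
Lemma dist_at_cutoff r : \forall eps \near (0 : R)^'+,
  d eps (cutoff_time eps + r * w eps) =
  Num.sqrt (\sum_(i < n) (expR (- L i.+1 * r) * relative_mode i.+1 eps) ^+ 2).
Proof.
near=> eps; have w0 : 0 < w eps by near: eps.
have rA : - r * L m <= ln `|a m eps| by near: eps; exact: ln_mode_infty.
have -> : forall t, 0 <= t -> d eps t =
    Num.sqrt (\sum_(i < n) (expR (- (L i.+1 / w eps) * t) * a i.+1 eps) ^+ 2).
- by near: eps.
- congr Num.sqrt; apply: eq_bigr => i _; congr (_ ^+ 2).
  rewrite /relative_mode mulrCA mulrC; congr (_ * _).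
  rewrite -expRD; congr expR; rewrite /cutoff_time; field.
  by rewrite !gt_eqF.
have -> : cutoff_time eps + r * w eps = w eps * ((ln `|a m eps| + r * L m) / L
  m).
  by rewrite /cutoff_time; field; rewrite gt_eqF.
by rewrite mulr_ge0 ?(ltW w0)// divr_ge0 ?(ltW Lm_gt0)//; lra.
Unshelve. all: end_near. Qed.

Lemma relative_mode_ref : \forall eps \near (0 : R)^'+,
  `|relative_mode m eps| = 1.
Proof.
near=> eps; have am0 : 0 < `|a m eps|.
  by near: eps; move/cvgryPgt/(_ 0) : am_infty.
rewrite /relative_mode normrM mulfV ?gt_eqF// mulN1r (ger0_norm (expR_ge0 _)).
by rewrite expRN lnK ?posrE// mulfV// gt_eqF.
Unshelve. all: end_near. Qed.

Lemma dist_lower_bound r : \forall eps \near (0 : R)^'+,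
  expR (- L m * r) <= d eps (cutoff_time eps + r * w eps).
Proof.
have h1 := dist_at_cutoff r; have h2 := relative_mode_ref.
apply: filterS2 h1 h2 => eps -> qm.
case/andP: m_range => m0 mn.
have im : (m.-1 < n)%N by rewrite prednK.
rewrite (bigD1 (Ordinal im)) //= prednK// -[leLHS]ger0_norm ?expR_ge0//.
rewrite -sqrtr_sqr ler_wsqrtr//.
rewrite exprMn -[relative_mode m eps ^+ 2]real_normK ?num_real// qm.
by rewrite expr1n mulr1 lerDl sumr_ge0// => i _; rewrite sqr_ge0.
Qed.

Lemma cutoff_time_gt0 :
  \forall eps \near (0 : R)^'+, 0 < cutoff_time eps /\ 0 < w eps.
Proof.
near=> eps; have w0 : 0 < w eps by near: eps.
have l1 : 1 <= ln `|a m eps| by near: eps; exact: ln_mode_infty.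
by split=> //; rewrite mulr_gt0 ?divr_gt0//; lra.
Unshelve. all: end_near. Qed.

Lemma window_over_time :
  w eps / cutoff_time eps @[eps --> (0 : R)^'+] --> (0 : R).
Proof.
apply/cvgrPdist_le => e e0; near=> eps.
have w0 : 0 < w eps by near: eps.
have le : L m / e <= ln `|a m eps| by near: eps; exact: ln_mode_infty.
have l0 : 0 < ln `|a m eps| by apply: lt_le_trans le; rewrite divr_gt0.
have -> : w eps / cutoff_time eps = L m / ln `|a m eps|.
  by rewrite /cutoff_time; field; rewrite !gt_eqF.
rewrite sub0r normrN ger0_norm ?divr_ge0 ?(ltW l0) ?(ltW Lm_gt0)//.
by rewrite ler_pdivrMr// mulrC -ler_pdivrMr.
Unshelve. all: end_near. Qed.

(** The reference mode alone is [exp (- L m * r)], which bounds the distance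
    from below; bounded relative modes give the upper bound [C * exp (- L 1 *
    r)]. *)
Lemma window_cutoff_criterion (D : nat -> R) :
  (forall k, (0 < k <= n)%N ->
    \forall eps \near (0 : R)^'+, `|relative_mode k eps| <= D k) ->
  window_cutoff d cutoff_time w.
Proof.
move=> qD; split.
- exact: cutoff_time_gt0.
- exact: window_over_time.
- apply/cvgeyPge => A; near=> r.
  apply: limf_einf_ge; apply: filterS (dist_lower_bound r) => eps.
  rewrite lee_fin; apply: le_trans.
  have Ar : r <= - `|A| / L m by near: r; apply: nbhs_ninfty_le; exact:
    num_real.
  apply: (le_trans (ler_norm A)); apply: le_trans (expR_ge1Dx _).
  by move: Ar; rewrite ler_pdivlMr//; lra.
- pose M := \sum_(k < n) `|D k.+1|.
  have DM k : (k < n)%N -> `|D k.+1| <= M.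
    by move=> kn; rewrite /M (bigD1 (Ordinal kn))//= lerDl sumr_ge0.
  pose C := Num.sqrt n%:R * M.
  have bound r : 0 <= r -> \forall eps \near (0 : R)^'+,
      d eps (cutoff_time eps + r * w eps) <= C * expR (- L 1 * r).
    move=> r0; have h1 := dist_at_cutoff r.
    have h2 : \forall eps \near (0 : R)^'+, forall k, (k < n)%N ->
        `|relative_mode k.+1 eps| <= D k.+1.
      by apply: near_forall_lt => k kn; exact: qD.
    apply: filterS2 h1 h2 => eps -> q.
    have M0 : 0 <= M by apply: sumr_ge0.
    rewrite /C -mulrA -[M * _]ger0_norm ?mulr_ge0 ?expR_ge0//.
    rewrite -sqrtr_sqr -sqrtrM ?ler0n// ler_wsqrtr//.
    rewrite mulr_natl -[n in leRHS]card_ord -sumr_const ler_sum// => i _.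
    rewrite -[leLHS]real_normK ?num_real// lerXn2r ?nnegrE ?mulr_ge0
      ?expR_ge0//.
    rewrite normrM (ger0_norm (expR_ge0 _)) mulrC ler_pM ?expR_ge0//.
      exact: le_trans (q i (ltn_ord i)) (le_trans (ler_norm _) (DM i (ltn_ord
        i))).
    by rewrite ler_expR ler_wpM2r// lerN2 L_ge1.
  apply: (@squeeze_cvge _ _ _ _ (cst 0%E) _ (fun r => (C * expR (- L 1 *
    r))%:E)).
  + near=> r; apply/andP; split.
      apply: limf_esup_ge0 => [|eps]; last by rewrite lee_fin.
      exact: (@filter_not_empty _ (0 : R)^'+ _).
    have r0 : 0 <= r by near: r; exact: nbhs_pinfty_ge.
    by apply: limf_esup_le; apply: filterS (bound r r0) => eps; rewrite lee_fin.
  + exact: cvg_cst.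
  + apply/cvg_EFin; first exact: nearW.
    rewrite -[X in _ --> X](mulr0 C); apply: cvgM; first exact: cvg_cst.
    have h : (fun r : R => L 1 * r) r @[r --> +oo%R] --> +oo%R.
      by apply: gt0_cvgMry; first exact: L_gt0.
    have := cvg_comp _ _ h (@cvgr_expR R); apply: cvg_trans.
    by apply: near_eq_cvg; apply: nearW => r /=; rewrite mulNr.
Unshelve. all: end_near. Qed.

Lemma profile_criterion r :
  (forall k, (0 < k <= n)%N -> k != m ->
    relative_mode k eps @[eps --> (0 : R)^'+] --> (0 : R)) ->
  d eps (cutoff_time eps + r * w eps) @[eps --> (0 : R)^'+] --> expR (- L m *
    r).
Proof.
move=> q0; case/andP: m_range => m0 mn.
have im : (m.-1 < n)%N by rewrite prednK.
pose lim (i : 'I_n) : R := if i.+1 == m then expR (- L m * r) ^+ 2 else 0.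
have -> : expR (- L m * r) = Num.sqrt (\sum_(i < n) lim i).
  rewrite (bigD1 (Ordinal im)) //= big1 => [|i ne].
    by rewrite addr0 /lim /= prednK// eqxx sqrtr_sqr ger0_norm ?expR_ge0.
  rewrite /lim; case: eqP => // im'; case/eqP: ne; apply/val_inj.
  by rewrite /= -im'.
apply: (@cvg_trans _ (Num.sqrt (\sum_(i < n)
    (expR (- L i.+1 * r) * relative_mode i.+1 eps) ^+ 2) @[eps --> (0 :
      R)^'+])).
  apply: near_eq_cvg; apply: filterS (dist_at_cutoff r) => eps ->.
  by [].
apply: (continuous_cvg _ (@sqrt_continuous R _)).
apply: cvg_big; first exact: add_continuous.
move=> i _; rewrite /lim; case: eqP => [im'|/eqP im'].
  apply: (@cvg_trans _ ((fun=> expR (- L m * r) ^+ 2) @ (0 : R)^'+)); last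
    exact: cvg_cst.
  apply: near_eq_cvg; apply: filterS relative_mode_ref => eps qm.
  rewrite im' exprMn -[relative_mode m eps ^+ 2]real_normK ?num_real// qm.
  by rewrite expr1n mulr1.
have h : expR (- L i.+1 * r) * relative_mode i.+1 eps @[eps --> (0 : R)^'+] -->
  (0 : R).
  rewrite -[X in _ --> X](mulr0 (expR (- L i.+1 * r))).
  by apply: cvgM; [exact: cvg_cst|apply: q0; rewrite /= ?ltn_ord].
by rewrite -[X in _ --> X](mulr0 0); exact: (cvgM h h).
Qed.

End CutoffCriterion.

(** * The truncated distance as a finite sum of modes *)

Section TruncatedDistance.
Context {R : realType}.
Variables gamma eps : R.
Hypotheses (gamma_gt0 : 0 < gamma) (gamma_lt1 : gamma < 1) (eps_gt0 : 0 < eps).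
Implicit Types (x t : R) (k n : nat).
Variables (lam : nat -> R) (psi : nat -> R -> R).
Hypothesis spec : spectral_decomposition gamma eps lam psi.
Local Notation inL2 := (inL2 gamma eps).
Local Notation inner := (inner gamma eps).

Let psiL k : inL2 (psi k). Proof. by case: spec => _ _ _ _ []. Qed.
Let psiE j k : inner (psi j) (psi k) = (j == k)%:R.
Proof. by case: spec => _ _ _ _ []. Qed.

Lemma modes_L2 (c : nat -> R) n :
  inL2 (fun x => \sum_(i < n) c i.+1 * psi i.+1 x).
Proof.
elim: n => [|n IH].
  under eq_fun do rewrite big_ord0.
  have := inL2_scal 0 (psiL 0%N).
  by under eq_fun do rewrite mul0r.
under eq_fun do rewrite big_ord_recr.
exact: (inL2_add gamma_gt0 IH (inL2_scal (c n.+1) (psiL n.+1))).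
Qed.

Lemma inner_modes_orthogonal (c : nat -> R) n k : (n < k)%N ->
  inner (fun x => \sum_(i < n) c i.+1 * psi i.+1 x) (psi k) = 0.
Proof.
elim: n => [|n IH] nk.
  under eq_fun do rewrite big_ord0.
  have := innerZl gamma_gt0 0 (psiL 0%N) (psiL k).
  under eq_fun do rewrite mul0r.
  by rewrite mul0r.
under eq_fun do rewrite big_ord_recr.
rewrite (innerDl gamma_gt0 (modes_L2 c n) (inL2_scal (c n.+1) (psiL n.+1))
  (psiL k)).
rewrite IH ?(ltn_trans _ nk)// innerZl// psiE.
by rewrite ltn_eqF// mulr0 addr0.
Qed.

Lemma inner_modes (c : nat -> R) n :
  inner (fun x => \sum_(i < n) c i.+1 * psi i.+1 x)
        (fun x => \sum_(i < n) c i.+1 * psi i.+1 x) = \sum_(i < n) c i.+1 ^+ 2.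
Proof.
elim: n => [|n IH].
  have zL : inL2 (fun=> 0).
    have := inL2_scal 0 (psiL 0%N).
    by under eq_fun do rewrite mul0r.
  under eq_fun do rewrite big_ord0.
  have := innerZl gamma_gt0 0 zL zL.
  under eq_fun do rewrite mul0r.
  by rewrite mul0r big_ord0.
under eq_fun do rewrite big_ord_recr.
have gL := modes_L2 c n; have pL := inL2_scal (c n.+1) (psiL n.+1).
rewrite (innerDl gamma_gt0 gL pL (inL2_add gamma_gt0 gL pL)).
rewrite (innerDr gamma_gt0 gL pL gL) (innerDr gamma_gt0 gL pL pL).
have gp : inner (fun x => \sum_(i < n) c i.+1 * psi i.+1 x)
    (fun x => c n.+1 * psi n.+1 x) = 0.
  by rewrite innerZr// inner_modes_orthogonal// mulr0.
have pp : inner (fun x => c n.+1 * psi n.+1 x) (fun x => c n.+1 * psi n.+1 x) =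
    c n.+1 ^+ 2.
  by rewrite innerZl// innerZr// psiE eqxx mulr1 expr2.
by rewrite IH gp innerC gp pp addr0 add0r [RHS]big_ord_recr.
Qed.

Hypothesis psi1_le : forall k, exists2 K : R, 0 <= K &
  forall x, `|derive1 (psi k) x| <= K * (`|psi k x| + 1).
Variables (delta x0 : R) (rho : R -> R -> R).
Hypothesis delta_gt0 : 0 < delta.
Hypothesis sol : fokker_planck_solution gamma eps (rho0 delta x0) rho.

Lemma eigenvalue_ge0 k : 0 <= lam k.
Proof.
case: spec => -[l0 _] [inc _] _ _ _; rewrite -l0.
by case: k => // k; rewrite ltW// (increasing_lt inc).
Qed.

(** The mode of index 0 is the conserved total mass, which cancels the
    constant 1 subtracted in the distance. *)
Lemma trunc_dist_formula n t : 0 <= t -> trunc_dist gamma eps psi rho n t =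
  Num.sqrt (\sum_(i < n) (expR (- lam i.+1 * t) *
    intR (fun x => rho0 delta x0 x * psi i.+1 x)) ^+ 2).
Proof.
move=> t0; have [Z0 _ L1] := spectral_mass spec.
pose c k := expR (- lam k * t) * intR (fun x => rho0 delta x0 x * psi k x).
have modeE k : inner (fun x => rho t x / rho_inf gamma eps x) (psi k) = c k.
  have [K K0 Kle] := psi1_le k.
  case: (spec) => _ _ /(_ k)/(eigenfunction_ode gamma_gt0 eps_gt0)[du du1] _ _.
  exact: (fokker_planck_mode gamma_gt0 gamma_lt1 eps_gt0 Z0 L1
    (eigenvalue_ge0 k) K0 (psiL k) du (fun x => du1 x) Kle sol t0).
have psi0 : psi 0%N = fun=> 1.
  by case: spec => -[_ p0] _ _ _ _; apply/funext.
have c0 : c 0%N = 1.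
  have l0 : lam 0%N = 0 by case: spec => -[].
  rewrite /c l0 oppr0 mul0r expR0 mul1r psi0.
  rewrite (@average_antiderivative _ _ id)//.
  - by field; rewrite gt_eqF.
  - exact: continuous_fun_const.
rewrite /trunc_dist /norm2 -(inner_modes c n); congr Num.sqrt.
suff -> : (fun x => Defs.proj gamma eps psi n (fun y => rho t y / rho_inf gamma
  eps y) x - 1)
  = (fun x => \sum_(i < n) c i.+1 * psi i.+1 x) by [].
apply/funext => x; rewrite /Defs.proj big_ord_recl /= modeE c0 psi0 mulr1 addrC
  addrA.
by rewrite addNr add0r; apply: eq_bigr => i _; rewrite modeE.
Qed.

End TruncatedDistance.

(** * Asymptotics of the initial modes *)

Section Assembly.
Context {R : realType}.
Variables (gamma : R) (delta w : R -> R).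
Hypothesis hgamma : 3^-1 < gamma < 1.
Hypothesis hdelta :
  forall eps, delta eps = eps `^ ((1 - gamma) / (1 + gamma)).
Hypothesis hw : forall eps, w eps = eps `^ ((1 - gamma) / (1 + gamma)).
Variables (lam : R -> nat -> R) (psi : R -> nat -> R -> R).
Hypothesis hspec : forall eps, 0 < eps <= 1 ->
  spectral_decomposition gamma eps (lam eps) (psi eps).
Variable rho : R -> R -> R -> R -> R.
Hypothesis hrho : forall eps x0, 0 < eps <= 1 ->
  fokker_planck_solution gamma eps (rho0 (delta eps) x0) (rho eps x0).
Implicit Types (eps x y : R) (k n m : nat).

Local Notation L := (lam 1).
Local Notation d k eps t x0 := (trunc_dist gamma eps (psi eps) (rho eps x0) k
  t).
Local Notation a k eps x0 :=
  (intR (fun x => rho0 (delta eps) x0 x * psi eps k x)).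
(* The microscopic length: the dilation by [s eps] turns [eps] into 1. *)
Let s eps := eps `^ (gamma + 1)^-1.

Let g3 : 3^-1 < gamma. Proof. by case/andP: hgamma. Qed.
Let g1 : gamma < 1. Proof. by case/andP: hgamma. Qed.
Let g0 : 0 < gamma. Proof. by apply: lt_trans g3; rewrite invr_gt0. Qed.
Let spec1 : spectral_decomposition gamma 1 (L) (psi 1).
Proof. by apply: hspec; rewrite ltr01 lexx. Qed.

Lemma eps_range : \forall eps \near (0 : R)^'+, 0 < eps <= 1.
Proof.
near=> eps; apply/andP; split; near: eps; first exact: nbhs_right_gt.
exact: nbhs_right_le.
Unshelve. all: end_near. Qed.

Lemma scale_gt0 eps : 0 < eps -> 0 < s eps. Proof. exact: powR_gt0. Qed.

Lemma window_gt0 eps : 0 < eps -> 0 < w eps.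
Proof. by move=> e0; rewrite hw powR_gt0. Qed.

Lemma delta_window eps : delta eps = w eps. Proof. by rewrite hdelta hw. Qed.

Lemma scale_window eps : s eps `^ (1 - gamma) = w eps.
Proof. by rewrite /s -powRrM hw mulrC [1 + gamma]addrC. Qed.

Lemma window_cvg0 : w eps @[eps --> (0 : R)^'+] --> (0 : R).
Proof.
have k0 : 0 < (1 - gamma) / (1 + gamma).
  by rewrite divr_gt0 ?subr_gt0// addr_gt0.
apply: cvg_trans (powR_cvg0 k0); apply: near_eq_cvg; apply: nearW => eps.
by rewrite hw.
Qed.

Lemma eigenvalueE eps k : 0 < eps <= 1 -> lam eps k = L k / w eps.
Proof.
move=> e01; have e0 : 0 < eps by case/andP: e01.
by rewrite (rescaled_spectrum g0 e0 spec1 (hspec e01)) -/(s eps) scale_window.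
Qed.

Let dpsi eps k x : 0 < eps <= 1 -> is_derive x 1 (psi eps k) (derive1 (psi eps
  k) x).
Proof.
move=> e01; case/andP: (e01) => e0 _.
by case: (hspec e01) => _ _ /(_ k)/(eigenfunction_ode g0 e0)[].
Qed.

Lemma rescaled_derivative_bound eps k : 0 < eps <= 1 ->
  exists2 K : R, 0 <= K &
  forall x, `|derive1 (psi eps k) x| <= K * (`|psi eps k x| + 1).
Proof.
move=> e01; case/andP: (e01) => e0 _; have s0 := scale_gt0 e0.
have [K K0 Kle] := eigenfunction_derivative_bound g0 g1 g3 spec1 k.
have [c c1 cE] := rescaled_eigenfunction g0 e0 spec1 (hspec e01) k.
exists (K / s eps) => [|x]; first by rewrite divr_ge0// ltW.
have dx : is_derive x 1 (fun x => x / s eps) (s eps)^-1.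
  apply: is_derive_eq (is_derive_mul (is_derive_var x) (is_derive_const _ x)) _.
  by rewrite mul1r mulr0 addr0.
have d1 : 0 < (1 : R) <= 1 by rewrite ltr01 lexx.
have dE := is_derive_scal c (@is_derive_comp R (psi 1 k) (fun x => x / s eps) x
  _ _
  (dpsi k (x / s eps) d1) dx).
have fE : psi eps k = (fun x => c * psi 1 k (x / s eps)) by apply/funext.
have := dpsi k x e01; rewrite {1}fE; case: dE => _ dE [_]; rewrite dE => <-.
rewrite fE !normrM (norm_of_sqr1 c1) !mul1r normfV (gtr0_norm s0) mulrAC.
by rewrite mulrC ler_pM2r ?invr_gt0// Kle.
Qed.

Lemma trunc_distE eps x0 n t : 0 < eps <= 1 -> 0 <= t ->
  d n eps t x0 = Num.sqrt
    (\sum_(i < n) (expR (- (L i.+1 / w eps) * t) * a i.+1 eps x0) ^+ 2).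
Proof.
move=> e01 t0; case/andP: (e01) => e0 _.
have d0 : 0 < delta eps by rewrite delta_window window_gt0.
rewrite (trunc_dist_formula g0 g1 e0 (hspec e01) _ d0 (hrho x0 e01) n t0).
  by congr Num.sqrt; apply: eq_bigr => i _; rewrite eigenvalueE.
by move=> k; exact: rescaled_derivative_bound.
Qed.

Let cpsi eps k : 0 < eps <= 1 -> continuous (psi eps k).
Proof. by move=> e01; apply: continuous_is_derive => x; exact: dpsi. Qed.

Lemma norm_average eps x0 k (H : R -> R) : 0 < eps <= 1 ->
  (forall x, is_derive x 1 H (psi 1 k x)) ->
  `|a k eps x0| = s eps / (2 * w eps) *
    `|H ((x0 + w eps) / s eps) - H ((x0 - w eps) / s eps)|.
Proof.
move=> e01 dH; case/andP: (e01) => e0 _; have s0 := scale_gt0 e0.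
have w0 := window_gt0 e0.
have [c c1 cE] := rescaled_eigenfunction g0 e0 spec1 (hspec e01) k.
have dHs x : is_derive x 1 (fun x => c * (s eps * H (x / s eps))) (psi eps k x).
  have dx : is_derive x 1 (fun x => x / s eps) (s eps)^-1.
    apply: is_derive_eq (is_derive_mul (is_derive_var x) (is_derive_const _ x))
      _.
    by rewrite mul1r mulr0 addr0.
  apply: is_derive_eq (is_derive_scal c (is_derive_scal (s eps)
    (@is_derive_comp R H (fun x => x / s eps) x _ _ (dH (x / s eps)) dx))) _.
  by rewrite cE mulVKf// gt_eqF.
rewrite delta_window (average_antiderivative x0 w0 (@cpsi eps k e01) dHs).
rewrite -mulrBr -mulrBr !normrM (norm_of_sqr1 c1) mul1r (gtr0_norm s0).
by rewrite gtr0_norm ?invr_gt0 ?mulr_gt0// mulrA [_^-1 * _]mulrC.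
Qed.

Lemma norm_average_mean_value eps x0 k : 0 < eps <= 1 ->
  exists2 x, `|x - x0| < w eps & `|a k eps x0| = `|psi 1 k (x / s eps)|.
Proof.
move=> e01; case/andP: (e01) => e0 _; have w0 := window_gt0 e0.
have [c c1 cE] := rescaled_eigenfunction g0 e0 spec1 (hspec e01) k.
have [H dH] := exists_antiderivative (@cpsi eps k e01).
have [x xw aE] := average_mean_value x0 w0 (@cpsi eps k e01) dH.
exists x => //; rewrite delta_window aE cE.
by rewrite normrM (norm_of_sqr1 c1) mul1r.
Qed.

(** The modes are compared through two-sided bounds of the common form
    [g * exp (L k * T)]; the powers of [exp T] cancel in the relative modes. *)
Lemma relative_mode_bound (b : nat -> R -> R) m k (g T : R -> R) (c C : R) :
  0 < c -> 0 < C -> 0 < L m -> 0 < L k ->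
  (\forall eps \near (0 : R)^'+, 0 < g eps) ->
  (\forall eps \near (0 : R)^'+, `|b k eps| <= C * (g eps * expR (L k * T
    eps))) ->
  (\forall eps \near (0 : R)^'+, c * (g eps * expR (L m * T eps)) <= `|b m
    eps|) ->
  \forall eps \near (0 : R)^'+, `|relative_mode (L) b m k eps| <=
    C * expR (- (L k / L m) * ln c) * expR ((1 - L k / L m) * ln (g eps)).
Proof.
move=> c0 C0 Lm Lk gp bk bm; near=> eps.
have ge0 : 0 < g eps by near: eps.
have hk : `|b k eps| <= C * (g eps * expR (L k * T eps)) by near: eps.
have hm : c * (g eps * expR (L m * T eps)) <= `|b m eps| by near: eps.
have gE : 0 < g eps * expR (L m * T eps) by rewrite mulr_gt0 ?expR_gt0.
have bm0 : 0 < `|b m eps| by apply: lt_le_trans hm; rewrite mulr_gt0.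
have lnm : ln c + (ln (g eps) + L m * T eps) <= ln `|b m eps|.
  have -> : ln c + (ln (g eps) + L m * T eps) = ln (c * (g eps * expR (L m * T
    eps))).
    by rewrite !lnM ?posrE ?expR_gt0// expRK.
  by rewrite ler_ln ?posrE// mulr_gt0.
rewrite /relative_mode normrM (ger0_norm (expR_ge0 _)).
apply: le_trans (ler_wpM2r (expR_ge0 _) hk) _.
rewrite -!mulrA ler_pM2l// -{1}(@lnK _ (g eps)) ?posrE// -!expRD ler_expR.
have th0 : 0 < L k / L m by rewrite divr_gt0.
have -> : L k * T eps = L k / L m * (L m * T eps) by field; rewrite gt_eqF.
have := ler_wpM2l (ltW th0) lnm.
by move: (ln c) (ln (g eps)) (ln `|b m eps|) => *; lra.
Unshelve. all: end_near. Qed.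

Let one_range : 0 < (1 : R) <= 1. Proof. by rewrite ltr01 lexx. Qed.

(** Away from the origin the average over the interval of radius [w eps] is a
    value of the eigenfunction inside it, and across the interval the phase
    [phase x / w eps] varies by O(1) only. *)
Lemma average_away x0 k : x0 != 0 -> (0 < k)%N -> exists c C : R,
  [/\ 0 < c, 0 < C & \forall eps \near (0 : R)^'+,
    c * (1 * expR (L k * (phase gamma `|x0| / w eps))) <= `|a k eps x0| <=
    C * (1 * expR (L k * (phase gamma `|x0| / w eps)))].
Proof.
move=> x0n k0; have l0 := eigenvalue_gt0 spec1 k0.
pose b := Num.sg x0; have b1 : b ^+ 2 = 1 by rewrite sqr_sg x0n.
have [Y [c [C [e [Y1 c0 C0 e1 uY]]]]] := spectral_growth_side g0 g1 g3 spec1 k0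
  b1.
pose h := `|x0| / 2; have h0 : 0 < h by rewrite divr_gt0// normr_gt0.
pose K := (h `^ gamma)^-1.
exists (c * expR (- (L k * K))), (C * expR (L k * K)).
split; [by rewrite mulr_gt0 ?expR_gt0|by rewrite mulr_gt0 ?expR_gt0|].
have Y0 : 0 < Y := lt_le_trans ltr01 Y1.
have ig0 : 0 < (gamma + 1)^-1 by rewrite invr_gt0 addr_gt0.
near=> eps.
have e01 : 0 < eps <= 1 by near: eps; exact: eps_range.
have e0 : 0 < eps by case/andP: e01.
have w0 := window_gt0 e0; have s0 := scale_gt0 e0.
have wh : w eps <= h.
  have : `|0 - w eps| <= h by near: eps; move/cvgrPdist_le: window_cvg0; apply.
  by rewrite sub0r normrN gtr0_norm.
have sh : s eps <= h / Y by near: eps; apply: small_powR => //; rewrite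
  divr_gt0.
have [x xx0 ->] := norm_average_mean_value x0 k e01.
pose z := b * x; have bx0 : b * x0 = `|x0| by rewrite /b -normrEsg.
have zx0 : `|z - `|x0| | < w eps.
  by rewrite -bx0 -mulrBr normrM (norm_of_sqr1 b1) mul1r.
have hz : h <= z.
  by move: zx0 wh; rewrite ltr_norml /h => /andP[+ _]; lra.
have hx0 : h <= `|x0| by rewrite /h; have := normr_ge0 x0; lra.
have -> : x / s eps = b * (z / s eps).
  by rewrite /z mulrA mulrA -expr2 b1 mul1r.
have zY : Y <= z / s eps.
  by rewrite ler_pdivlMr// mulrC -ler_pdivlMr// (le_trans sh)// ler_pM2r
    ?invr_gt0.
have E0 y : 0 < expR y by exact: expR_gt0.
have := norm_between e1 (mulr_ge0 (ltW c0) (expR_ge0 _)) (uY _ zY).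
rewrite phase_scale// scale_window => /andP[lo hi].
have ph : `|phase gamma z / w eps - phase gamma `|x0| / w eps| <= K.
  rewrite -mulrBl normrM normfV (gtr0_norm w0) ler_pdivrMr//.
  apply: (le_trans (phase_lipschitz g0 g1 h0 hx0 hz)).
  by rewrite ler_wpM2l ?invr_ge0 ?powR_ge0// ltW.
move: ph; rewrite ler_norml => /andP[ph1 ph2].
apply/andP; split.
  apply: le_trans lo; rewrite mul1r -mulrA ler_pM2l// -expRD ler_expR.
  rewrite -mulrN -mulrDr ler_pM2l//.
  by lra.
apply: (le_trans hi); rewrite mul1r -[leRHS]mulrA.
apply: ler_wpM2l; first exact: ltW.
rewrite -expRD ler_expR -mulrDr ler_pM2l//.
by lra.
Unshelve. all: end_near. Qed.

(* The radius of the initial interval in microscopic units. *)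
Let ell eps := w eps / s eps.
Let alpha := gamma / (1 + gamma).

Let alpha_gt0 : 0 < alpha. Proof. by rewrite divr_gt0// addr_gt0. Qed.

Lemma ellE eps : 0 < eps -> ell eps = (eps `^ alpha)^-1.
Proof.
move=> e0; rewrite /ell /s hw -[RHS]powRN -powRB; last first.
  by apply/implyP => _; rewrite gt_eqF.
have gn : 1 + gamma != 0 by rewrite gt_eqF// addr_gt0.
by congr (_ `^ _); rewrite /alpha [gamma + 1]addrC; field.
Qed.

Lemma ell_weight eps : 0 < eps ->
  (ell eps `^ (1 - gamma))^-1 = eps `^ (alpha * (1 - gamma)).
Proof.
by move=> e0; rewrite ellE// powRV ?powR_ge0// invrK powRrM.
Qed.

Lemma ell_large (Y : R) : 0 < Y -> \forall eps \near (0 : R)^'+, Y <= ell eps.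
Proof.
move=> Y0; near=> eps; have e0 : 0 < eps by near: eps; exact: nbhs_right_gt.
rewrite ellE// -[Y]invrK lef_pV2 ?posrE ?invr_gt0 ?powR_gt0//.
by near: eps; apply: small_powR => //; rewrite invr_gt0.
Unshelve. all: end_near. Qed.

(** Around the origin the interval of radius [w eps] has microscopic radius
    [ell eps], and only a fraction [ell eps ^ (gamma - 1)] of it contributes. *)
Lemma average_center k : (0 < k)%N -> psi 1 k 0 != 0 -> exists c C : R,
  [/\ 0 < c, 0 < C & \forall eps \near (0 : R)^'+,
    c * (eps `^ (alpha * (1 - gamma)) * expR (L k * phase gamma (ell eps))) <=
    `|a k eps 0| <=
    C * (eps `^ (alpha * (1 - gamma)) * expR (L k * phase gamma (ell eps)))].
Proof.
move=> k0 p0; have [H dH] := exists_antiderivative (@cpsi 1 k one_range).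
have [Y [c [C [Y0 c0 C0 HY]]]] := even_integral_growth g0 g1 g3 spec1 k0 p0 dH.
exists (c / 2), (C / 2); split; [by rewrite divr_gt0|by rewrite divr_gt0|].
near=> eps.
have e01 : 0 < eps <= 1 by near: eps; exact: eps_range.
have e0 : 0 < eps by case/andP: e01.
have w0 := window_gt0 e0; have s0 := scale_gt0 e0.
have Yl : Y <= ell eps.
  by near: eps; apply: ell_large; exact: lt_le_trans Y0.
have l0 : 0 < ell eps by rewrite divr_gt0.
rewrite (norm_average 0 e01 dH) add0r sub0r mulNr -/(ell eps).
have -> : s eps / (2 * w eps) = 2^-1 * (ell eps)^-1.
  by rewrite /ell; field; rewrite !gt_eqF.
rewrite -ell_weight// powR1B// invfM invrK.
have := HY _ Yl; move: (expR _) => E /andP[h1 h2].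
have i0 : 0 < 2^-1 * (ell eps)^-1 :> R by rewrite mulr_gt0 ?invr_gt0.
apply/andP; split.
  apply: le_trans (ler_wpM2l (ltW i0) h1).
  by rewrite le_eqVlt; apply/orP; left; apply/eqP; field; rewrite gt_eqF.
apply: (le_trans (ler_wpM2l (ltW i0) h2)).
by rewrite le_eqVlt; apply/orP; left; apply/eqP; field; rewrite gt_eqF.
Unshelve. all: end_near. Qed.

Lemma average_center_odd eps k : 0 < eps <= 1 -> psi 1 k 0 = 0 -> a k eps 0 = 0.
Proof.
move=> e01 p0; have odd := odd_of_eq0 g0 spec1 p0.
have [H dH] := exists_antiderivative (@cpsi 1 k one_range).
have dHH y : is_derive y 1 (fun y => H y - H (- y)) 0.
  have dN : is_derive y 1 (fun x => - x) (- 1).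
    exact: is_derive_opp (is_derive_var y).
  apply: is_derive_eq (is_derive_sub (dH y)
    (@is_derive_comp R H (fun x => - x) y _ _ (dH (- y)) dN)) _.
  by rewrite odd; ring.
have e0 : 0 < eps by case/andP: e01.
have l0 : 0 <= ell eps by rewrite divr_ge0// ltW// ?window_gt0 ?scale_gt0.
apply/eqP; rewrite -normr_eq0 (norm_average 0 e01 dH) add0r sub0r mulNr.
rewrite -/(ell eps) -(constant_of_derive l0 (fun y _ => dHH y)).
by rewrite oppr0 subrr normr0 mulr0.
Qed.

(** * Cut-off away from the origin and at the origin *)

Lemma dist_ge0 k eps t x0 : 0 <= d k eps t x0. Proof. exact: sqrtr_ge0. Qed.

Lemma eigenvalue_ge1 k : (0 < k)%N -> L 1 <= L k.
Proof.
case: spec1 => _ [inc _] _ _ _; rewrite leq_eqVlt => /predU1P[<-//|k1].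
by rewrite ltW// (increasing_lt inc).
Qed.

Lemma near_window_gt0 : \forall eps \near (0 : R)^'+, 0 < w eps.
Proof. by apply: filterS eps_range => eps /andP[e0 _]; exact: window_gt0. Qed.

Lemma near_trunc_distE n x0 : \forall eps \near (0 : R)^'+, forall t, 0 <= t ->
  d n eps t x0 = Num.sqrt
    (\sum_(i < n) (expR (- (L i.+1 / w eps) * t) * a i.+1 eps x0) ^+ 2).
Proof. by apply: filterS eps_range => eps e01 t; exact: trunc_distE. Qed.

Lemma first_mode_infty x0 : x0 != 0 ->
  `|a 1 eps x0| @[eps --> (0 : R)^'+] --> +oo.
Proof.
move=> x0n; have l0 := eigenvalue_gt0 spec1 (ltn0Sn 0).
have [c [C [c0 _ ca]]] := average_away x0n (ltn0Sn 0).
have T0 : 0 < phase gamma `|x0|.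
  by rewrite mulr_gt0 ?invr_gt0 ?subr_gt0// powR_gt0// normr_id normr_gt0.
apply: (@cvg_infty_powR R _ ((1 - gamma) / (1 + gamma))
  (c * (L 1 * phase gamma `|x0|))).
- by rewrite divr_gt0 ?subr_gt0// addr_gt0.
- by apply: mulr_gt0 => //; exact: mulr_gt0.
apply: filterS ca => eps /andP[+ _]; apply: le_trans.
rewrite -hw mul1r -[leLHS]mulrA -[_ * _ / _]mulrA.
apply: ler_wpM2l; first exact: ltW.
have := expR_ge1Dx (L 1 * (phase gamma `|x0| / w eps)).
by move: (expR _) => z; lra.
Qed.

(** The mode [k] is comparable to the power [L k] of [exp (phase `|x0| / w
    eps)], with no other large or small factor, so that all relative modes are
    bounded. *)
Theorem window_cutoff_away n x0 : (1 <= n)%N -> x0 != 0 ->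
  exists t : R -> R,
    (\forall eps \near (0 : R)^'+,
      [/\ 0 < t eps,
          unique (fun s => 0 <= s /\ d 1%N eps s x0 = 1) (t eps) &
          t eps = (lam eps 1%N)^-1 * ln `|a 1%N eps x0| ]) /\
    window_cutoff (fun eps s => d n eps s x0) t w.
Proof.
move=> n1 x0n; pose b k eps := a k eps x0.
have ainf := first_mode_infty x0n; have l0 := eigenvalue_gt0 spec1.
have m1 : (0 < 1 <= n)%N by rewrite n1.
exists (cutoff_time w (L) b 1); split.
- have tpos := cutoff_time_gt0 (a := b) m1 l0 near_window_gt0 ainf.
  near=> eps; have e01 : 0 < eps <= 1 by near: eps; exact: eps_range.
  have [t0 w0] : 0 < cutoff_time w (L) b 1 eps /\ 0 < w eps by near: eps.
  have b1 : 0 < `|b 1 eps|.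
    by near: eps; move/cvgryPgt/(_ 0) : ainf.
  have L1 := l0 1%N isT.
  split => //; last by rewrite /cutoff_time (eigenvalueE _ e01) invf_div.
  have dE t : 0 <= t -> d 1%N eps t x0 = expR (- (L 1 / w eps) * t) * `|b 1
    eps|.
    move=> t0'; rewrite trunc_distE// big_ord_recl big_ord0 addr0 sqrtr_sqr.
    by rewrite normrM (ger0_norm (expR_ge0 _)).
  have key t : expR (- (L 1 / w eps) * t) * `|b 1 eps| =
      expR (- (L 1 / w eps) * (t - cutoff_time w (L) b 1 eps)).
    rewrite -{1}(@lnK _ `|b 1 eps|) ?posrE// -expRD; congr expR.
    by rewrite /cutoff_time; field; rewrite !gt_eqF.
  split; first by split; [exact: ltW|rewrite dE ?ltW// key subrr mulr0 expR0].
  have rate : - (L 1 / w eps) != 0 by rewrite oppr_eq0 gt_eqF// divr_gt0.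
  move=> t [t0']; rewrite dE// key -[1 in RHS]expR0 => /expR_inj /eqP.
  by rewrite mulf_eq0 (negbTE rate) subr_eq0 => /eqP.
- have [c [C1 [c0 _ ca]]] := average_away x0n (ltn0Sn 0).
  have kD k : exists D : R, (0 < k)%N -> \forall eps \near (0 : R)^'+,
      `|relative_mode (L) b 1 k eps| <= D.
    have [->|k0] := eqVneq k 0%N; first by exists 0.
    rewrite -lt0n in k0; have [c1 [C [_ C0 Ca]]] := average_away x0n k0.
    exists (C * expR (- (L k / L 1) * ln c) * expR ((1 - L k / L 1) * ln 1)) =>
      _.
    apply: (@relative_mode_bound b 1 k (fun=> 1)
      (fun eps => phase gamma `|x0| / w eps)) => //; try exact: l0.
    - exact: nearW.
    - by apply: filterS Ca => eps /andP[].
    - by apply: filterS ca => eps /andP[].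
  have [D DP] := choice kD.
  apply: (@window_cutoff_criterion _ (fun eps s => d n eps s x0) _ _ b n 1 _ m1
    l0
    eigenvalue_ge1 near_window_gt0 ainf (near_trunc_distE n x0) D).
  + by move=> eps t; exact: dist_ge0.
  + by move=> k /andP[k0 _]; exact: DP.
Unshelve. all: end_near. Qed.

Lemma center_mode_infty m : (0 < m)%N -> psi 1 m 0 != 0 ->
  `|a m eps 0| @[eps --> (0 : R)^'+] --> +oo.
Proof.
move=> m0 pm; have l0 := eigenvalue_gt0 spec1 m0.
have [c [C [c0 _ ca]]] := average_center m0 pm.
have g10 : 0 < 1 - gamma by rewrite subr_gt0.
have al0 : 0 < alpha * (1 - gamma) by rewrite mulr_gt0.
apply: (@cvg_infty_powR R _ (alpha * (1 - gamma))
  (c * (L m / (2 * (1 - gamma))) ^+ 2)) => //.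
  by rewrite mulr_gt0 ?exprn_gt0// divr_gt0// mulr_gt0.
near=> eps; have e0 : 0 < eps by near: eps; exact: nbhs_right_gt.
have : c * (eps `^ (alpha * (1 - gamma)) * expR (L m * phase gamma (ell eps)))
    <= `|a m eps 0| by near: eps; apply: filterS ca => eps /andP[].
apply: le_trans.
have G0 : 0 < eps `^ (alpha * (1 - gamma)) by exact: powR_gt0.
have l1 : 0 < ell eps by rewrite ellE// invr_gt0 powR_gt0.
have phE : phase gamma (ell eps) = ((1 - gamma) * eps `^ (alpha * (1 -
  gamma)))^-1.
  by rewrite -ell_weight// invfM invrK /phase gtr0_norm.
(* [expR z >= (z / 2) ^+ 2] beats the factor [1 / phase (ell eps)] *)
have sq (z : R) : 0 <= z -> (z / 2) ^+ 2 <= expR z.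
  move=> z0; have -> : expR z = expR (z / 2) ^+ 2.
    by rewrite expr2 -expRD; congr expR; field.
  rewrite lerXn2r ?nnegrE ?expR_ge0 ?divr_ge0//.
  by have := expR_ge1Dx (z / 2); lra.
have ph0 : 0 <= L m * phase gamma (ell eps).
  by rewrite mulr_ge0 ?(ltW l0)// phE invr_ge0 mulr_ge0 ?ltW.
have := ler_wpM2l (ltW c0) (ler_wpM2l (ltW G0) (sq _ ph0)).
apply: le_trans.
rewrite phE le_eqVlt; apply/orP; left; apply/eqP.
by field; rewrite !gt_eqF.
Unshelve. all: end_near. Qed.

(** The weight [eps ^ (alpha * (1 - gamma))], which tends to 0, is common to all
    even modes; relative to the mode [m] the others therefore keep a positive
    power of it, and a profile survives. *)
Theorem profile_cutoff_center n m : (0 < m <= n)%N -> psi 1 m 0 != 0 ->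
  (forall k, (0 < k <= n)%N -> psi 1 k 0 != 0 -> (k <= m)%N) ->
  exists t : R -> R,
    (\forall eps \near (0 : R)^'+,
      0 < t eps /\
      unique (fun s => expR (- 2 * lam eps m * s) * a m eps 0 ^+ 2 = 1) (t
        eps)) /\
    profile_cutoff (fun eps s => d n eps s 0) t w (fun r => expR (- L m * r)).
Proof.
move=> mn pm mmax; have m0 : (0 < m)%N by case/andP: mn.
pose b k eps := a k eps 0.
have ainf := center_mode_infty m0 pm; have l0 := eigenvalue_gt0 spec1.
have [c [C1 [c0 _ ca]]] := average_center m0 pm.
have q0 k : (0 < k <= n)%N -> k != m ->
    relative_mode (L) b m k eps @[eps --> (0 : R)^'+] --> (0 : R).
  move=> kn km; have k0 : (0 < k)%N by case/andP: kn.
  have [pk|pk] := eqVneq (psi 1 k 0) 0.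
    apply: (@cvg_trans _ ((fun=> 0 : R) @ (0 : R)^'+)); last exact: cvg_cst.
    apply: near_eq_cvg; apply: filterS eps_range => eps e01.
    by rewrite /relative_mode /b average_center_odd// mul0r.
  have [c1 [C [_ C0 Ca]]] := average_center k0 pk.
  have kltm : (k < m)%N by rewrite ltn_neqAle km mmax.
  have th : 0 < 1 - L k / L m.
    rewrite subr_gt0 ltr_pdivrMr ?l0// mul1r.
    by case: spec1 => _ [inc _] _ _ _; rewrite (increasing_lt inc).
  have al0 : 0 < alpha * (1 - gamma) by rewrite mulr_gt0// subr_gt0.
  pose D := C * expR (- (L k / L m) * ln c).
  have D0 : 0 < D by rewrite mulr_gt0 ?expR_gt0.
  apply/cvgrPdist_le => e e0; near=> eps; rewrite sub0r normrN.
  have ep : 0 < eps by near: eps; exact: nbhs_right_gt.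
  have : `|relative_mode (L) b m k eps| <=
      D * expR ((1 - L k / L m) * ln (eps `^ (alpha * (1 - gamma)))).
    near: eps; apply: (@relative_mode_bound b m k
      (fun eps => eps `^ (alpha * (1 - gamma)))
      (fun eps => phase gamma (ell eps))) => //; try exact: l0.
    - by apply: filterS eps_range => eps /andP[ep _]; exact: powR_gt0.
    - by apply: filterS Ca => eps /andP[].
    - by apply: filterS ca => eps /andP[].
  move=> /le_trans; apply.
  have -> : expR ((1 - L k / L m) * ln (eps `^ (alpha * (1 - gamma)))) =
      eps `^ (alpha * (1 - gamma) * (1 - L k / L m)).
    rewrite [RHS]powRrM; have := powR_gt0 (alpha * (1 - gamma)) ep.
    by move: (eps `^ _) => G G0; rewrite /powR gt_eqF.
  rewrite mulrC -ler_pdivlMr//.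
  by near: eps; apply: small_powR; [exact: mulr_gt0|exact: divr_gt0].
exists (cutoff_time w (L) b m); split; last split.
- have tpos := cutoff_time_gt0 (a := b) mn l0 near_window_gt0 ainf.
  near=> eps; have e01 : 0 < eps <= 1 by near: eps; exact: eps_range.
  have [t0 w0] : 0 < cutoff_time w (L) b m eps /\ 0 < w eps by near: eps.
  have bm : 0 < `|b m eps| by near: eps; move/cvgryPgt/(_ 0) : ainf.
  have Lm := l0 m m0; split => //.
  have key t : expR (- 2 * lam eps m * t) * b m eps ^+ 2 =
      expR (- 2 * (L m / w eps) * (t - cutoff_time w (L) b m eps)).
    rewrite (eigenvalueE _ e01) -[b m eps ^+ 2]real_normK ?num_real//.
    rewrite -(@lnK _ `|b m eps|) ?posrE// expr2 -!expRD; congr expR.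
    by rewrite /cutoff_time; field; rewrite !gt_eqF.
  split; first by rewrite key subrr mulr0 expR0.
  have rate : - 2 * (L m / w eps) != 0.
    by rewrite mulNr oppr_eq0 gt_eqF// mulr_gt0// divr_gt0.
  move=> t; rewrite key -[1 in RHS]expR0 => /expR_inj /eqP.
  by rewrite mulf_eq0 (negbTE rate) subr_eq0 => /eqP.
- have kD k : exists D : R, (0 < k <= n)%N -> \forall eps \near (0 : R)^'+,
      `|relative_mode (L) b m k eps| <= D.
    exists 1 => kn; have [->|km] := eqVneq k m.
      by apply: filterS (relative_mode_ref (a := b) mn l0 ainf) => eps ->.
    move/cvgrPdist_le: (q0 k kn km) => /(_ _ ltr01).
    by apply: filterS => eps; rewrite sub0r normrN.
  have [D DP] := choice kD.
  apply: (@window_cutoff_criterion _ (fun eps s => d n eps s 0) _ _ b n m _ mn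
    l0
    eigenvalue_ge1 near_window_gt0 ainf (near_trunc_distE n 0) D) => //.
  by move=> eps t; exact: dist_ge0.
- move=> r; apply: (@profile_criterion _ (fun eps s => d n eps s 0) _ _ b n m
    mn l0 near_window_gt0 ainf (near_trunc_distE n 0)).
  exact: q0.
Unshelve. all: end_near. Qed.

Lemma dist_center_eq0 n : (forall k, (0 < k <= n)%N -> psi 1 k 0 = 0) ->
  forall eps t, 0 < eps <= 1 -> 0 <= t -> d n eps t 0 = 0.
Proof.
move=> p0 eps t e01 t0; rewrite trunc_distE// big1 ?sqrtr0// => i _.
by rewrite average_center_odd ?p0 ?ltn_ord// mulr0 expr0n.
Qed.

End Assembly.

Lemma bigmax_seq_mem (s : seq nat) : s <> [::] -> (\max_(j <- s) j)%N \in s.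
Proof.
elim: s => // x s IH _; rewrite big_cons inE.
have [->|sn] := eqVneq s [::]; first by rewrite big_nil maxn0 eqxx.
have := IH (elimN eqP sn); case: (leqP x (\max_(j <- s) j)%N) => h ms.
  by rewrite ms orbT.
by rewrite eqxx.
Qed.

Unset Implicit Arguments.

Theorem theorem1p2 (R : realType) (gamma : R) (n : nat)
  (hgamma : 3^-1 < gamma < 1) (hn : (1 <= n)%N)
  (delta w : R -> R)
  (hdelta : forall eps, delta eps = eps `^ ((1 - gamma) / (1 + gamma)))
  (hw : forall eps, w eps = eps `^ ((1 - gamma) / (1 + gamma)))
  (lam : R -> nat -> R) (psi : R -> nat -> R -> R)
  (hspec : forall eps, 0 < eps <= 1 ->
     spectral_decomposition gamma eps (lam eps) (psi eps))
  (rho : R -> R -> R -> R -> R)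
  (hrho : forall eps x0, 0 < eps <= 1 ->
     fokker_planck_solution gamma eps (rho0 (delta eps) x0) (rho eps x0)) :
  let d (k : nat) (eps t x0 : R) :=
    trunc_dist gamma eps (psi eps) (rho eps x0) k t in
  let a (k : nat) (eps x0 : R) :=
    intR (fun x => rho0 (delta eps) x0 x * psi eps k x) in
  (forall x0, x0 != 0 ->
     exists t : R -> R,
       (\forall eps \near (0 : R)^'+,
          [/\ 0 < t eps,
              unique (fun s => 0 <= s /\ d 1%N eps s x0 = 1) (t eps) &
              t eps = (lam eps 1%N)^-1 * ln `|a 1%N eps x0| ]) /\
       window_cutoff (fun eps s => d n eps s x0) t w)
  /\
  (let E := [seq j <- iota 1 n | psi 1 j 0 != 0] in
   (E = [::] ->
      forall eps t, 0 < eps <= 1 -> 0 <= t -> d n eps t 0 = 0) /\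
   (E <> [::] ->
      let m := (\max_(j <- E) j)%N in
      exists t : R -> R,
        (\forall eps \near (0 : R)^'+,
           0 < t eps /\
           unique (fun s => expR (- 2 * lam eps m * s) * a m eps 0 ^+ 2 = 1)
             (t eps)) /\
        profile_cutoff (fun eps s => d n eps s 0) t w
          (fun r => expR (- lam 1 m * r)))).
Proof.
move=> d a; split.
  by move=> x0 x0n; exact: (window_cutoff_away hgamma hdelta hw hspec hrho hn
    x0n).
move=> E; have inE' j : (j \in E) = (psi 1 j 0 != 0) && (0 < j <= n)%N.
  by rewrite mem_filter mem_iota add1n ltnS.
split=> [E0|En m].
  apply: (dist_center_eq0 hgamma hdelta hw hspec hrho) => k kn.
  by apply/eqP; have := inE' k; rewrite E0 in_nil kn andbT => /esym/negbFE.
have := bigmax_seq_mem En; rewrite -/m inE' => /andP[pm mn].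
apply: (profile_cutoff_center hgamma hdelta hw hspec hrho mn pm) => k kn pk.
by apply: leq_bigmax_seq => //; rewrite inE' pk.
Qed.
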